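(* Let $d>0$ be fixed. Given $\alpha\in(0,\tfrac12)$, there exists $\beta_0>0$ such that for every $\beta\in\mathbb{R}$ with $|\beta|<\beta_0$ the operator $H_{\alpha;\beta}$ has no discrete spectrum.
   Context: Fix $d>0$ and put $r_n=d(n+\tfrac12)$ for $n=0,1,2,\dots$. $\mathbb{R}_+=(0,\infty)$. Radial operators. For $\alpha\in(0,1)$, $\beta\in\mathbb{R}$, $l\in\mathbb{Z}$ let $c_{\alpha,l}=-\tfrac14+(l+\alpha)^2$. The self-adjoint operator $H_{\alpha;\beta,l}$ in $L^2(\mathbb{R}_+)$ acts as $f\mapsto -f''+\frac{c_{\alpha,l}}{r^2}f$ (away from the points $r_n$) on all $f\in L^2(\mathbb{R}_+)$ such that: $f$ is continuous on $\mathbb{R}_+$; $f,f'$ are locally absolutely continuous on $\mathbb{R}_+\setminus\{r_n\}_{n\ge 0}$ with one-sided limits at each $r_n$; $-f''+\frac{c_{\alpha,l}}{r^2}f\in L^2(\mathbb{R}_+)$; $f'(r_n^+)-f'(r_n^-)=\beta f(r_n)$ for all $n\ge0$; and, if $l=0$, $\lim_{r\to0^+}r^{\alpha-1/2}f(r)=0$, while if $l=-1$, $\lim_{r\to0^+}r^{1-\alpha-1/2}f(r)=0$ (no condition at $0$ for other $l$). Full operator. $H_{\alpha;\beta}$ is the self-adjoint operator in $L^2(\mathbb{R}^2)$ equal to the orthogonal sum of the $H_{\alpha;\beta,l}$ over $l\in\mathbb{Z}$, under the unitary identification $(f_l)_{l\in\mathbb{Z}}\mapsto \sum_{l}(2\pi)^{-1/2}r^{-1/2}f_l(r)e^{il\varphi}$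 in polar coordinates. It describes a pure Aharonov-Bohm flux $\alpha$ at the origin plus $\delta$ interactions of strength $\beta$ on the circles of radii $r_n$ centered at the origin. Threshold. Let $x_n=d(n+\tfrac12)$, $n\in\mathbb{Z}$, and let $\mathrm{h}_\beta$ be the operator in $L^2(\mathbb{R})$ acting as $f\mapsto -f''$ on continuous $f\in W^{2,2}(\mathbb{R}\setminus\{x_n\}_{n\in\mathbb{Z}})$ with $f'(x_n^+)-f'(x_n^-)=\beta f(x_n)$ for all $n\in\mathbb{Z}$. Put $E_0:=\inf\sigma(\mathrm{h}_\beta)$. One has $\sigma_{\mathrm{ess}}(H_{\alpha;\beta})=[E_0,\infty)$, so the discrete spectrum of $H_{\alpha;\beta}$ is its spectrum in $(-\infty,E_0)$. *)

(* Defs.v *)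
(* MathComp-Analysis; complex scalars are R[i] from mathcomp-real-closed. *)
From HB Require Import structures.
From mathcomp Require Import all_boot all_order all_algebra.
From mathcomp Require Import all_classical all_reals all_analysis.
From mathcomp Require Import complex.

Set Implicit Arguments.
Unset Strict Implicit.
Unset Printing Implicit Defensive.

Import Order.TTheory GRing.Theory Num.Theory.
Import numFieldNormedType.Exports.

Local Open Scope classical_set_scope.
Local Open Scope ring_scope.
Local Open Scope complex_scope.

(** * Complex L^2 functions *)

Definition sqnorm {dT : measure_display} {T : measurableType dT} {R : realType}
    (mu : {measure set T -> \bar R}) (D : set T) (f : T -> R[i]) : \bar R :=
  (\int[mu]_(x in D) ((ComplexField.Normc.normc (f x)) ^+ 2)%:E)%E.

Definition L2fun {dT : measure_display} {T : measurableType dT} {R : realType}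
    (mu : {measure set T -> \bar R}) (D : set T) (f : T -> R[i]) : Prop :=
  [/\ measurable_fun D (fun x => complex.Re (f x)),
      measurable_fun D (fun x => complex.Im (f x)) &
      (sqnorm mu D f < +oo)%E].

(** * Spectrum of an unbounded operator

   An operator in L^2(mu) is given by its graph, a relation [A] between square
   integrable functions: [A f g] means that f is in the domain and that
   g = A f, functions being understood up to almost everywhere equality. *)

Definition operator_graph (T : Type) (R : realType) : Type :=
  (T -> R[i]) -> (T -> R[i]) -> Prop.

Section Spectrum.
Context {dT : measure_display} {T : measurableType dT} {R : realType}.
Variable mu : {measure set T -> \bar R}.
Implicit Types (A : operator_graph T R) (z : R[i]).

(* A - z is a bijection from the domain of A onto L^2(mu), with a bounded
   inverse; (A - z) f = g is written A f = g + z f. *)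
Definition resolvent_set A : set R[i] := [set z |
  exists M : R, forall g : T -> R[i], L2fun mu setT g ->
    exists f : T -> R[i],
      [/\ A f (fun x => g x + z * f x),
          (forall f' : T -> R[i], A f' (fun x => g x + z * f' x) ->
             {ae mu, forall x, f' x = f x}) &
          (sqnorm mu setT f <= M%:E * sqnorm mu setT g)%E]].

Definition spectrum A : set R[i] := ~` resolvent_set A.

Definition eigenfunction A z (f : T -> R[i]) : Prop :=
  A f (fun x => z * f x).

Definition eigenvalue A z : Prop :=
  exists f : T -> R[i], eigenfunction A z f /\ ~ {ae mu, forall x, f x = 0}.

Definition finite_multiplicity A z : Prop :=
  exists (n : nat) (e : 'I_n -> T -> R[i]),
    (forall i, eigenfunction A z (e i)) /\
    (forall f : T -> R[i], eigenfunction A z f ->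
       exists a : 'I_n -> R[i],
         {ae mu, forall x, f x = \sum_(i < n) a i * e i x}).

Definition isolated_in_spectrum A z : Prop :=
  spectrum A z /\
  exists2 e : R, 0 < e & forall w : R[i], spectrum A w -> w != z ->
    e <= ComplexField.Normc.normc (w - z).

Definition discrete_spectrum A : set R[i] := [set z |
  [/\ isolated_in_spectrum A z, eigenvalue A z & finite_multiplicity A z]].

End Spectrum.

(** * Local absolute continuity *)

Definition abs_cont {R : realType} (a b : R) (f : R -> R) : Prop :=
  forall e : R, 0 < e -> exists2 delta : R, 0 < delta &
    forall (n : nat) (s t : 'I_n -> R),
      (forall i, [/\ a <= s i, s i <= t i & t i <= b]) ->
      (forall i j, i != j -> t i <= s j \/ t j <= s i) ->
      \sum_(i < n) (t i - s i) < delta ->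
      \sum_(i < n) `|f (t i) - f (s i)| < e.

Definition loc_abs_cont {R : realType} (D : set R) (f : R -> R) : Prop :=
  forall a b : R, a <= b -> `[a, b]%classic `<=` D -> abs_cont a b f.

(** * The operators *)

Section Operators.
Context {R : realType}.
Variables (d alpha beta : R).

Definition circle_radius (n : nat) : R := d * (n%:R + 2^-1).

Definition regular_radii : set R :=
  [set r | 0 < r /\ forall n : nat, r != circle_radius n].

Definition centrifugal (l : int) : R := - 4^-1 + (l%:~R + alpha) ^+ 2.

(* All the requirements on f and on g = - f'' + c f / r^2 except square
   integrability, for real-valued functions. Functions are defined on the whole
   of R but only their values on ]0, +oo[ are used. *)
Definition radial_real (l : int) (f g : R -> R) : Prop :=
  [/\ forall r : R, 0 < r -> {for r, continuous f},
      [/\ forall r : R, regular_radii r -> derivable f r 1,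
          loc_abs_cont regular_radii f &
          loc_abs_cont regular_radii (derive1 f)],
      {ae (@lebesgue_measure R), forall r : R, 0 < r ->
         derivable (derive1 f) r 1 /\
         g r = - derive1 (derive1 f) r + centrifugal l / r ^+ 2 * f r},
      forall n : nat, exists p m : R,
        [/\ derive1 f x @[x --> (circle_radius n)^'+] --> p,
            derive1 f x @[x --> (circle_radius n)^'-] --> m &
            p - m = beta * f (circle_radius n)] &
      (l = 0 -> (r `^ (alpha - 2^-1) * f r) @[r --> 0^'+] --> (0 : R)) /\
      (l = -1 -> (r `^ (1 - alpha - 2^-1) * f r) @[r --> 0^'+] --> (0 : R))].

(* Graph of H_{alpha;beta,l} in L^2(]0, +oo[). Continuity, limits and
   derivatives of complex-valued functions are taken componentwise, and all the
   conditions are real-linear with real coefficients. *)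
Definition radial_op (l : int) : operator_graph R R := fun f g =>
  [/\ L2fun (@lebesgue_measure R) `]0, +oo[%classic f,
      L2fun (@lebesgue_measure R) `]0, +oo[%classic g,
      radial_real l (fun r => complex.Re (f r)) (fun r => complex.Re (g r)) &
      radial_real l (fun r => complex.Im (f r)) (fun r => complex.Im (g r))].

Definition lebesgue_plane :
    {measure set (measurableTypeR R * measurableTypeR R)%type -> \bar R} :=
  (@lebesgue_measure R \x @lebesgue_measure R)%E.

(* (2 pi)^(-1/2) r^(-1/2) f(r) e^(i l phi) at the point p = (x, y), where
   e^(i phi) = (x + i y) / r. *)
Definition angular_mode (l : int) (f : R -> R[i]) (p : R * R) : R[i] :=
  let r := Num.sqrt (p.1 ^+ 2 + p.2 ^+ 2) in
  ((Num.sqrt (2 * pi))^-1 * (Num.sqrt r)^-1)%:C * f r *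
  ((p.1 +i* p.2) / r%:C) ^ l.

(* psi is the image of (f l)_l under the unitary identification: the series of
   the angular modes over -N <= l <= N tends to psi in L^2(R^2). By
   orthogonality of the modes, convergence forces the sum of the squared norms
   of the f l to be finite. *)
Definition angular_sum (f : int -> R -> R[i]) (psi : R * R -> R[i]) : Prop :=
  sqnorm lebesgue_plane setT (fun p => psi p -
    \sum_(k < N.*2.+1) angular_mode (k%:Z - N%:Z) (f (k%:Z - N%:Z)) p)
    @[N --> \oo] --> 0%E.

(* Graph of H_{alpha;beta} in L^2(R^2), the orthogonal sum of the radial
   operators. *)
Definition AB_op : operator_graph (R * R)%type R := fun psi eta =>
  [/\ L2fun lebesgue_plane setT psi,
      L2fun lebesgue_plane setT eta &
      exists f g : int -> R -> R[i],
        [/\ forall l : int, radial_op l (f l) (g l),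
            angular_sum f psi & angular_sum g eta]].

End Operators.

(* Main.v *)
(** Let u be the positive d-periodic solution of - u'' = E u with the jump
   conditions of strength beta, so that E is the threshold. A square integrable
   solution of the radial equation for z = x + i y is written f = u g, and
   P + i Q = conj g * (u^2 g') is followed along the half-line:
     P' = u^2 |g'|^2 + (c_l / r^2 + E - x) u^2 |g|^2,   Q' = - y u^2 |g|^2,
   and both vanish at 0 by the boundary conditions. For small beta the bounds
   m <= u^2 <= M satisfy (1/4 - alpha^2) M <= m / 4, so that Hardy's inequality
   absorbs the only negative centrifugal term, the one of l = 0. If x < E, or if
   y <> 0 (through Q), then P is eventually bounded below by a positive constant,
   |g|^2 grows linearly and f is not square integrable. Hence every eigenvalue of
   the full operator is real and at least E.
   Conversely every E + lambda with lambda > 0 lies in the spectrum: for l large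
   and c_l / r0^2 = lambda, the product of u and a wide bump centered at r0 is an
   approximate eigenfunction. So no point of [E, +oo[ is isolated in the
   spectrum, and no eigenvalue is discrete. *)

Require Import Defs.
From HB Require Import structures.
From mathcomp Require Import all_boot all_order all_algebra.
From mathcomp Require Import all_classical all_reals all_analysis.
From mathcomp Require Import complex measurable_realfun.
From mathcomp Require Import ring lra zify.

Set Implicit Arguments.
Unset Strict Implicit.
Unset Printing Implicit Defensive.

Import Order.TTheory GRing.Theory Num.Theory.
Import numFieldNormedType.Exports.

Local Open Scope classical_set_scope.
Local Open Scope ring_scope.

(** * Calculus rules *)

Section Derivation_rules.
Context {R : realType}.
Implicit Types (f g : R -> R) (x a b c : R).

(** The obstacle is that f' jumps at infinitely many radii. Since f and u obey the same jump
    condition, the jumps cancel in [u f' - u' f = u^2 g'], so P and Q are continuous and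
    monotonicity arguments pass through every circle. Square integrability enters the growth
    argument as a bounded primitive F of |f|^2, and each contradiction there says that F is
    unbounded. Hardy's inequality with the weight u^2 costs a factor M / m. For l = 0 the potential
    is (alpha^2 - 1/4) / r^2, and the gap alpha^2 to the critical constant 1/4 pays for that factor;
    this is what limits beta. As alpha < 1/2, the channel l = -1 has (1 - alpha)^2 > 1/4 and is
    repulsive. The vanishing of P and Q at 0 has two sources: the boundary condition for l = 0 and l
    = -1, and, for the other l, the fact that r^(1/2 - |l + alpha|) is not square integrable at 0
    once |l + alpha| > 1. The step from the plane to the channels rests on rotation invariance:
    averaging over finitely many rotations extracts one angular mode from a partial sum without
    increasing its norm. Hence the radial components of an eigenfunction solve the radial
    equations. *)

Definition has_der (f : R -> R) (x a : R) : Prop := is_derive x (1 : R) f a.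

Lemma has_der_eq f x a b : has_der f x a -> a = b -> has_der f x b.
Proof. by move=> + <-. Qed.

Lemma der_cst c x : has_der (fun=> c) x 0.
Proof. exact: is_derive_cst. Qed.

Lemma der_id x : has_der (fun t => t) x 1.
Proof. exact: is_derive_id. Qed.

Lemma derD f g x a b : has_der f x a -> has_der g x b ->
  has_der (fun t => f t + g t) x (a + b).
Proof. by move=> ? ?; exact: is_deriveD. Qed.

Lemma derN f x a : has_der f x a ->
  has_der (fun t => - f t) x (- a).
Proof. by move=> ?; exact: is_deriveN. Qed.

Lemma derM f g x a b : has_der f x a -> has_der g x b ->
  has_der (fun t => f t * g t) x (a * g x + f x * b).
Proof.
move=> df dg; apply: (is_derive_eq (is_deriveM df dg)).
by rewrite /GRing.scale /= addrC [a * _]mulrC.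
Qed.

Lemma derX f n x a : has_der f x a ->
  has_der (fun t => f t ^+ n.+1) x (n.+1%:R * f x ^+ n * a).
Proof.
move=> df; elim: n => [|n IH]; first by rewrite expr0 !mul1r.
have -> : (fun t => f t ^+ n.+2) = (fun t => f t * f t ^+ n.+1).
  by apply/funext => t; rewrite exprS.
apply: (is_derive_eq (derM df IH)).
by rewrite [n.+2%:R]mulrS exprS; ring.
Qed.

Lemma derV f x a : f x != 0 -> has_der f x a ->
  has_der (fun t => (f t)^-1) x (- a / f x ^+ 2).
Proof.
move=> f0 df; apply: (is_derive_eq (is_deriveV f0 df)).
by rewrite /GRing.scale /= mulrC mulrN mulNr.
Qed.

Lemma der_comp f g x a b : has_der f (g x) a ->
  has_der g x b -> has_der (fun t => f (g t)) x (b * a).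
Proof. by move=> df dg; rewrite mulrC; exact: (is_derive1_comp df dg). Qed.

Lemma der_powR x p : 0 < x ->
  has_der (fun t => t `^ p) x (p * x `^ (p - 1)).
Proof.
move=> x0; apply: DeriveDef.
  by apply: derivable_powR; rewrite in_itv /= x0.
by rewrite -derive1E powR_derive1 // in_itv /= x0.
Qed.

Lemma der_ln x : 0 < x -> has_der (@ln R) x x^-1.
Proof. exact: is_derive1_ln. Qed.

Lemma der_near f g x a : (\near x, f x = g x) -> has_der f x a ->
  has_der g x a.
Proof. exact: near_eq_is_derive. Qed.

Lemma der_cont f x a : has_der f x a -> {for x, continuous f}.
Proof.
by move=> [/derivable1_diffP fx _]; exact: differentiable_continuous.
Qed.

End Derivation_rules.

Ltac der := repeat first
  [ eassumption | apply: der_cst | apply: der_id | apply: derD | apply: derN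
  | apply: derX | apply: derM ].

(** * Monotonicity across the circles *)

Section Monotone.
Context {R : realType}.
Implicit Types (f h : R -> R).

Lemma ndecr_der f df (a b : R) : a <= b ->
  (forall x, a <= x <= b -> {for x, continuous f}) ->
  (forall x, a < x < b -> has_der f x (df x)) ->
  (forall x, a < x < b -> 0 <= df x) -> f a <= f b.
Proof.
move=> ab cf dfx df0.
move: ab; rewrite le_eqVlt => /predU1P[->//|ab].
have dfx' x : x \in `]a, b[ -> is_derive x 1 f (df x).
  by rewrite in_itv /=; exact: dfx.
have cf' : {within `[a, b], continuous f}.
  apply: continuous_in_subspaceT => x; rewrite inE /= in_itv /= => xab.
  exact: cf.
have [c cab E] := MVT ab dfx' cf'.
rewrite -subr_ge0 E mulr_ge0 //; last by rewrite subr_ge0 ltW.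
by apply: df0; move: cab; rewrite in_itv.
Qed.

Variable d : R.
Hypothesis d0 : 0 < d.

Lemma circle_radius_gt0 n : 0 < circle_radius d n.
Proof. by rewrite /circle_radius mulr_gt0 // ltr_pwDr // invr_gt0. Qed.

Lemma circle_radius_unbounded (x : R) : exists n, x <= circle_radius d n.
Proof.
have [n xn] : exists n : nat, `|x / d| < n%:R.
  by exists (Num.truncn `|x / d|).+1; exact: truncnS_gt.
exists n; rewrite /circle_radius -ler_pdivrMl // mulrC.
apply: (le_trans (ler_norm _)); apply: (le_trans (ltW xn)).
by rewrite lerDl invr_ge0.
Qed.

(** The circles are discrete, so an induction on the number of circles below the right endpoint cuts
    the interval into pieces free of circles in their interior, and continuity glues the pieces.
    Every later inequality that crosses circles is obtained by applying this to a suitable [h]. *)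
Lemma ndecr_off_circles h dh (a b : R) : 0 < a -> a <= b ->
  (forall x, a <= x <= b -> {for x, continuous h}) ->
  (forall x, a <= x <= b -> regular_radii d x -> has_der h x (dh x)) ->
  (forall x, a <= x <= b -> regular_radii d x -> 0 <= dh x) -> h a <= h b.
Proof.
move=> a0 ab ch hdh dh0.
have reg x n : a <= x -> x < circle_radius d n.+1 -> circle_radius d n < x ->
    regular_radii d x.
  move=> ax xn nx; split=> [|k]; first exact: lt_le_trans ax.
  have [kn|nk] := leqP k n.
    rewrite gt_eqF // (le_lt_trans _ nx) // /circle_radius ler_pM2l //.
    by rewrite lerD2r ler_nat.
  rewrite lt_eqF // (lt_le_trans xn) // /circle_radius ler_pM2l //.
  by rewrite lerD2r ler_nat.
have reg0 x : a <= x -> x < circle_radius d 0 -> regular_radii d x.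
  move=> ax xn; split=> [|k]; first exact: lt_le_trans ax.
  by rewrite lt_eqF // (lt_le_trans xn) // /circle_radius ler_pM2l // lerD2r
             ler_nat.
have step s t : a <= s -> s <= t -> t <= b ->
    (forall x, s < x < t -> regular_radii d x) -> h s <= h t.
  move=> as_ st tb r; apply: (ndecr_der (df := dh)) => //.
  - by move=> x /andP[sx xt]; apply: ch; lra.
  - by move=> x /[dup] /r ? /andP[sx xt]; apply: hdh => //; lra.
  - by move=> x /[dup] /r ? /andP[sx xt]; apply: dh0 => //; lra.
suff H n : forall s t, a <= s -> s <= t -> t <= b -> t <= circle_radius d n ->
    h s <= h t.
  by have [n bn] := circle_radius_unbounded b; exact: (H n).
elim: n => [|n IH] s t as_ st tb tn.
  by apply: step => // x /andP[sx xt]; apply: reg0; lra.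
have [tn'|nt] := leP t (circle_radius d n); first exact: IH.
have [ns|sn] := leP (circle_radius d n) s.
  by apply: step => // x /andP[sx xt]; apply: (reg _ n); lra.
apply: (@le_trans _ _ (h (circle_radius d n))); first by apply: IH => //; lra.
by apply: step => [|||x /andP[nx xt]]; [lra|lra|lra|apply: (reg _ n); lra].
Qed.

End Monotone.

(** * Growth of solutions *)

Section Continuity_rules.
Context {R : realType}.
Implicit Types (f g : R -> R) (x : R).

Lemma cts_cst (c : R) x : {for x, continuous (fun=> c)}.
Proof. exact: cvg_cst. Qed.

Lemma cts_id x : {for x, continuous (fun t : R => t)}.
Proof. exact: cvg_id. Qed.

Lemma ctsD f g x : {for x, continuous f} -> {for x, continuous g} ->
  {for x, continuous (fun t => f t + g t)}.
Proof. by move=> cf cg; exact: cvgD. Qed.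

Lemma ctsN f x : {for x, continuous f} -> {for x, continuous (fun t => - f t)}.
Proof. by move=> cf; exact: cvgN. Qed.

Lemma ctsM f g x : {for x, continuous f} -> {for x, continuous g} ->
  {for x, continuous (fun t => f t * g t)}.
Proof. by move=> cf cg; exact: cvgM. Qed.

Lemma ctsX f n x : {for x, continuous f} ->
  {for x, continuous (fun t => f t ^+ n)}.
Proof.
move=> cf; elim: n => [|n IH].
  rewrite (_ : (fun t => _) = fun=> 1); first exact: cts_cst.
  by apply/funext => t; rewrite expr0.
rewrite (_ : (fun t => _) = fun t => f t * f t ^+ n); first exact: ctsM.
by apply/funext => t; rewrite exprS.
Qed.

Lemma ctsV f x : f x != 0 -> {for x, continuous f} ->
  {for x, continuous (fun t => (f t)^-1)}.
Proof. by move=> f0 cf; exact: cvgV. Qed.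

End Continuity_rules.

Ltac cts := repeat match goal with |- context [@continuous_at _ _ _ ?f] =>
  lazymatch f with
  | (fun _ => _ + _) => apply: ctsD
  | (fun _ => - _) => apply: ctsN
  | (fun _ => _ * _) => apply: ctsM
  | *%R _ => apply: ctsM
  | +%R _ => apply: ctsD
  | -%R => apply: ctsN
  | (fun _ => _ ^+ _) => apply: ctsX
  | _ => first [apply: cts_cst | apply: cts_id | assumption]
  end end.

(** * Energy inequalities for [g = f / u] and growth at infinity *)

Section No_square_integrable_solution.
Context {R : realType}.
Variables (d : R) (u ga gb wa wb F : R -> R) (c E x y m M K : R).
Hypotheses (d0 : 0 < d) (m0 : 0 < m).
Hypothesis um : forall r : R, 0 < r -> m <= u r ^+ 2 <= M.
Hypothesis cga : forall r : R, 0 < r -> {for r, continuous ga}.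
Hypothesis cgb : forall r : R, 0 < r -> {for r, continuous gb}.
Hypothesis cwa : forall r : R, 0 < r -> {for r, continuous wa}.
Hypothesis cwb : forall r : R, 0 < r -> {for r, continuous wb}.
Hypothesis cF : forall r : R, 0 < r -> {for r, continuous F}.
Hypothesis dga : forall r : R, regular_radii d r ->
  has_der ga r (wa r / u r ^+ 2).
Hypothesis dgb : forall r : R, regular_radii d r ->
  has_der gb r (wb r / u r ^+ 2).
Hypothesis dwa : forall r : R, regular_radii d r ->
  has_der wa r (((c / r ^+ 2 + E - x) * ga r + y * gb r) * u r ^+ 2).
Hypothesis dwb : forall r : R, regular_radii d r ->
  has_der wb r (((c / r ^+ 2 + E - x) * gb r - y * ga r) * u r ^+ 2).
Hypothesis dF : forall r : R, regular_radii d r ->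
  has_der F r (u r ^+ 2 * (ga r ^+ 2 + gb r ^+ 2)).
Hypothesis F_bound : forall r : R, 0 < r -> 0 <= F r <= K.

(** Here g = [ga] + i [gb] and u^2 g' = [wa] + i [wb], so that [S] is |g|^2 and [P] + i [Q] is conj
    g times u^2 g'. [F] is a primitive of |f|^2 = u^2 S, and its bound [K] expresses square
    integrability. *)
Let S r := ga r ^+ 2 + gb r ^+ 2.
Let P r := ga r * wa r + gb r * wb r.
Let Q r := ga r * wb r - gb r * wa r.

Let S_ge0 r : 0 <= S r. Proof. by rewrite addr_ge0 ?sqr_ge0. Qed.

Let u0 (r : R) : 0 < r -> u r != 0.
Proof. by move=> /um /andP[mu _]; apply/eqP => u0; move: mu m0; rewrite u0; lra. Qed.

Let reg0 r : regular_radii d r -> 0 < r. Proof. by case. Qed.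

Let dS r : regular_radii d r -> has_der S r (2 * P r / u r ^+ 2).
Proof.
move=> rr; have := dga rr; have := dgb rr => hb ha.
rewrite /S; apply: has_der_eq; first by der.
by rewrite /P; field; exact/u0/reg0.
Qed.

Let dP r : regular_radii d r -> has_der P r
  ((wa r ^+ 2 + wb r ^+ 2) / u r ^+ 2 + (c / r ^+ 2 + E - x) * (u r ^+ 2 * S r)).
Proof.
move=> rr; have := dga rr; have := dgb rr; have := dwa rr; have := dwb rr => *.
rewrite /P; apply: has_der_eq; first by der.
by rewrite /S; field; rewrite gt_eqF ?u0 //; exact/reg0.
Qed.

Let dQ r : regular_radii d r -> has_der Q r (- y * (u r ^+ 2 * S r)).
Proof.
move=> rr; have := dga rr; have := dgb rr; have := dwa rr; have := dwb rr => *.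
rewrite /Q; apply: has_der_eq; first by der.
by rewrite /S; field; rewrite gt_eqF ?u0 //; exact/reg0.
Qed.

Let cS (r : R) : 0 < r -> {for r, continuous S}.
Proof. by move=> r0; have := cga r0; have := cgb r0 => *; rewrite /S; cts. Qed.

Let cP (r : R) : 0 < r -> {for r, continuous P}.
Proof.
move=> r0; have := cga r0; have := cgb r0; have := cwa r0; have := cwb r0 => *.
by rewrite /P; cts.
Qed.

Let cQ (r : R) : 0 < r -> {for r, continuous Q}.
Proof.
move=> r0; have := cga r0; have := cgb r0; have := cwa r0; have := cwb r0 => *.
by rewrite /Q; cts.
Qed.

Let M0 : 0 < M.
Proof. by have /andP[] := um (@ltr01 R); move: m0; lra. Qed.

(* P >= p > 0 makes S = |f/u|^2 grow linearly. *)
Let no_growth (R0 p : R) : 0 < R0 -> 0 < p -> (forall r : R, R0 <= r -> p <= P r) -> False.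
Proof.
move=> R00 p0 hP.
have hS (r : R) : R0 <= r -> 2 * p / M * (r - R0) <= S r.
  move=> Rr; suff : S R0 - 2 * p / M * R0 <= S r - 2 * p / M * r.
    by have := S_ge0 R0; lra.
  apply: (ndecr_off_circles (h := fun r => S r - 2 * p / M * r)
    (dh := fun r => 2 * P r / u r ^+ 2 - 2 * p / M) d0 R00 Rr).
  - move=> t /andP[Rt _]; have := cS (lt_le_trans R00 Rt) => ?; cts.
  - move=> t /andP[Rt _] rt; have := dS rt => ?; apply: has_der_eq; first by der.
    by rewrite /=; ring.
  move=> t /andP[Rt _] rt; have /andP[mu uM] := um (lt_le_trans R00 Rt).
  have Pt := hP t Rt; have u2 := lt_le_trans m0 mu.
  rewrite subr_ge0 ler_pdivrMr // mulrAC ler_pdivlMr //; nra.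
(* Integrating the linear bound on [S] once more gives quadratic growth of [F], against the bound
   [K]. *)
have hF (r : R) : R0 <= r -> m * p / M * (r - R0) ^+ 2 <= F r.
  move=> Rr; suff : F R0 - m * p / M * (R0 - R0) ^+ 2 <=
      F r - m * p / M * (r - R0) ^+ 2.
    by have /andP[] := F_bound R00; rewrite subrr expr0n /= mulr0; lra.
  apply: (ndecr_off_circles (h := fun r => F r - m * p / M * (r - R0) ^+ 2)
    (dh := fun r => u r ^+ 2 * S r - m * p / M * (2 * (r - R0))) d0 R00 Rr).
  - move=> t /andP[Rt _]; have := cF (lt_le_trans R00 Rt) => ?; cts.
  - move=> t /andP[Rt _] rt; have := dF rt => ?; apply: has_der_eq; first by der.
    by rewrite /S /=; ring.
  move=> t /andP[Rt _] rt; have /andP[mu uM] := um (lt_le_trans R00 Rt).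
  have := hS t Rt; set q := 2 * p / M * _ => qS.
  rewrite (_ : m * p / M * (2 * (t - R0)) = m * q); last by rewrite /q; ring.
  have q0 : 0 <= q by rewrite /q mulr_ge0 ?subr_ge0 // divr_ge0 ?mulr_ge0 // ltW.
  by nra.
have q0 : 0 < m * p / M by rewrite divr_gt0 // mulr_gt0.
have K0 : 0 <= K by have /andP[h1 h2] := F_bound R00; lra.
have [t [t1 tK]] : exists t, 1 <= t /\ K < m * p / M * t.
  exists (1 + K / (m * p / M)); split; first by rewrite lerDl divr_ge0 // ltW.
  by rewrite mulrDr mulr1 mulrCA mulfV ?gt_eqF // mulr1; lra.
have R0t : R0 <= R0 + t by lra.
have /andP[_ FK] := F_bound (lt_le_trans R00 R0t).
by have := hF _ R0t; rewrite addrAC subrr add0r; nra.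
Qed.

Let F_mono (a b : R) : 0 < a -> a <= b -> F a <= F b.
Proof.
move=> a0 ab; apply: (ndecr_off_circles (dh := fun r => u r ^+ 2 * S r) d0 a0 ab).
- by move=> t /andP[at_ _]; apply: cF; exact: lt_le_trans at_.
- by move=> t _; exact: dF.
- by move=> t _ _; rewrite mulr_ge0 // sqr_ge0.
Qed.

(** By continuity [S] stays above half of [S r1] on a short interval to the right of [r1], and [s]
    is what [F] gains there. This fixed gain is what keeps P, or Q, away from 0 at large radii. *)
Let F_strict (r1 : R) : 0 < r1 -> S r1 != 0 ->
  exists2 r2 : R, r1 < r2 & exists2 s : R, 0 < s & forall r : R, r2 <= r -> F r1 + s <= F r.
Proof.
move=> r10 S1; have S1' : 0 < S r1 by rewrite lt_neqAle eq_sym S1 S_ge0.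
have : \forall t \near r1, S r1 / 2 < S t.
  by apply: (cvgr_gt (S r1) (cS r10)); lra.
case=> e /= e0 he.
have [h [h0 he']] : exists h, 0 < h /\ forall t, r1 <= t -> t <= r1 + h -> S r1 / 2 <= S t.
  exists (e / 2); split; first by lra.
  move=> t rt tr; apply/ltW/he; rewrite /= ltr_norml; apply/andP; split; lra.
have Fq_mono (a b q : R) : 0 < a -> a <= b -> (forall t, a <= t <= b -> q <= m * S t) ->
    F a - q * a <= F b - q * b.
  move=> a0 ab hq; apply: (ndecr_off_circles (h := fun t => F t - q * t)
    (dh := fun r => u r ^+ 2 * S r - q) d0 a0 ab).
  - by move=> t /andP[at_ tb]; have := cF (lt_le_trans a0 at_) => ?; cts.
  - move=> t at_ rt; have := dF rt => ?; apply: has_der_eq; first by der.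
    by rewrite /S /=; ring.
  - move=> t /[dup] /hq qS /andP[at_ tb] rt.
    have /andP[mu uM] := um (lt_le_trans a0 at_); have := S_ge0 t; nra.
exists (r1 + h); first by lra.
exists (m * (S r1 / 2) * h); first by rewrite !mulr_gt0 //; lra.
move=> r hr; apply: (@le_trans _ _ (F (r1 + h))); last by apply: F_mono; lra.
have := Fq_mono r1 (r1 + h) (m * (S r1 / 2)) => /(_ r10).
have -> : r1 <= r1 + h by lra.
move=> /(_ isT) H; suff : F r1 - m * (S r1 / 2) * r1 <=
  F (r1 + h) - m * (S r1 / 2) * (r1 + h) by lra.
by apply: H => t /andP[rt tr]; rewrite ler_pM2l //; exact: he'.
Qed.

Hypothesis hardy : - c * M <= m / 4.
Hypothesis P0 : forall e : R, 0 < e -> exists2 t : R, 0 < t &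
  forall r : R, 0 < r -> r < t -> `|P r| <= e.
Hypothesis Q0 : forall e : R, 0 < e -> exists2 t : R, 0 < t &
  forall r : R, 0 < r -> r < t -> `|Q r| <= e.
Hypothesis S0 : forall e : R, 0 < e -> exists2 t : R, 0 < t &
  forall r : R, 0 < r -> r < t -> S r / r <= e.

(** The corrected quantity [T] satisfies T' >= (E - x) F' and tends to 0 at the origin, hence T >=
    (E - x) (F - F r1) beyond r1. Since P >= T, the gain of [F_strict] keeps P above (E - x) s,
    which [no_growth] forbids. *)
Let below_E_zero (r1 : R) : y = 0 -> x < E -> 0 < r1 -> S r1 = 0.
Proof.
move=> y0 xE r10; apply/eqP/negP => /negP /(F_strict r10)[r2 r12 [s s0 Fs]].
pose T r := P r - m / 2 * (S r / r).
(* The Hardy correction: completing the square in g' - g / (2 r). *)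
have T_mono (a b : R) : 0 < a -> a <= b ->
    T a - (E - x) * F a <= T b - (E - x) * F b.
  move=> a0 ab; apply: (ndecr_off_circles (h := fun r => T r - (E - x) * F r)
    (dh := fun r => (wa r ^+ 2 + wb r ^+ 2) / u r ^+ 2
        + (c / r ^+ 2 + E - x) * (u r ^+ 2 * S r)
      - m / 2 * (2 * P r / u r ^+ 2 / r - S r / r ^+ 2)
      - (E - x) * (u r ^+ 2 * S r)) d0 a0 ab).
  - move=> t /andP[at_ _]; have t0 := lt_le_trans a0 at_.
    have := cF t0; have := cP t0; have := cS t0 => *; rewrite /T.
    have ? : {for t, continuous (fun r : R => r^-1)}.
      by apply: ctsV; [rewrite gt_eqF|exact: cts_id].
    by cts.
  - move=> t _ rt; have t0 := reg0 rt.
    have := dF rt; have := dP rt; have := dS rt => *.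
    have ? := derV (lt0r_neq0 t0) (der_id t).
    rewrite /T; apply: has_der_eq; first by der.
    by rewrite /= -/(S t); field; rewrite gt_eqF // u0.
  move=> t _ rt; have t0 := reg0 rt; have /andP[mu uM] := um t0.
  have U0 := lt_le_trans m0 mu.
  set U := u t ^+ 2 in mu uM U0 *.
  (* With U = u^2 and U >= m, only the part m |g'|^2 of U |g'|^2 enters the square; the surplus (U -
     m) |g'|^2 is nonnegative. The square uses m / 4 of the m / 2 produced by the correction, and
     the other m / 4 dominates c U by [hardy]. *)
  rewrite (_ : _ - _ = ((wa t ^+ 2 + wb t ^+ 2) / U - m * (P t / U / t)
      + m / 4 * S t / t ^+ 2) + (c * U + m / 4) * S t / t ^+ 2); last first.
    by field; rewrite ?gt_eqF.
  have St0 : 0 <= S t / t ^+ 2 by rewrite divr_ge0 // sqr_ge0.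
  rewrite addr_ge0 //; last first.
    rewrite -mulrA mulr_ge0 //.
    have [c0|c0] := leP 0 c.
      by apply: addr_ge0; [apply: mulr_ge0|apply: divr_ge0] => //; exact: ltW.
    by move: hardy c0 m0 uM; nra.
  rewrite [X in _ <= X](_ : _ = (U - m) * ((wa t / U) ^+ 2 + (wb t / U) ^+ 2)
    + m * ((wa t / U - ga t / (2 * t)) ^+ 2 + (wb t / U - gb t / (2 * t)) ^+ 2)).
    by apply: addr_ge0; apply: mulr_ge0; rewrite ?subr_ge0 //;
       first [exact: ltW | by rewrite addr_ge0 ?sqr_ge0].
  by rewrite /S /P; field; rewrite ?gt_eqF.
have T_ge (r : R) : 0 < r -> (E - x) * (F r - F r1) <= T r \/ r < r1.
  move=> r0; have [?|rr1] := ltP r r1; first by right.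
  left; apply/ler_addgt0Pr => e e0.
  have e20 : 0 < e / 2 by rewrite divr_gt0.
  have m20 : 0 < e / 2 / (m / 2) by rewrite !divr_gt0.
  (* Half of [e] is allotted to P and half to (m / 2) S / r, so that T is at least -e at the
     starting radius t. *)
  have [t1 t10 h1] := P0 e20; have [t2 t20 h2] := S0 m20.
  pose t := Num.min r1 (Num.min t1 t2) / 2.
  have t0 : 0 < t by rewrite divr_gt0 // !lt_min r10 t10 t20.
  have [tr1 [tt1 tt2]] : t < r1 /\ t < t1 /\ t < t2.
    have lt2 : t < Num.min r1 (Num.min t1 t2).
      by rewrite /t ltr_pdivrMr // ltr_pMr ?ltr1n // !lt_min r10 t10 t20.
    by move: lt2; rewrite !lt_min => /andP[-> /andP[-> ->]].
  have tr : t <= r by rewrite ltW // (lt_le_trans tr1).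
  have := T_mono _ _ t0 tr; have := h1 _ t0 tt1; have := h2 _ t0 tt2.
  rewrite ler_pdivlMr ?divr_gt0 // => hS; rewrite ler_norml => /andP[hP _].
  have := F_mono t0 (ltW tr1) => hF; rewrite {1}/T => hT.
  have Ex : 0 < E - x by rewrite subr_gt0.
  have : 0 <= (E - x) * (F r1 - F t) by rewrite mulr_ge0 ?subr_ge0 // ltW.
  by lra.
apply: (@no_growth r2 ((E - x) * s)).
- exact: lt_trans r12.
- by rewrite mulr_gt0 // subr_gt0.
move=> r r2r; have r0 : 0 < r by rewrite (lt_le_trans _ r2r) // (lt_trans r10).
have [hT|] := T_ge r r0; last by move=> h; move: (lt_le_trans r12 r2r) h; lra.
have : T r <= P r.
  by rewrite lerBlDr lerDl mulr_ge0 // divr_ge0 // ltW.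
have : (E - x) * s <= (E - x) * (F r - F r1).
  by rewrite ler_pM2l ?subr_gt0 // lerBrDl; exact: Fs.
by lra.
Qed.

(** The combination y Q + y^2 F is constant and Q vanishes at 0, so |Q| is bounded below by a
    positive constant beyond r2. The AM-GM inequality 2 |Q| <= u^2 |g'|^2 + u^2 |g|^2 turns this
    into a lower bound for P', up to a multiple of F' that absorbs the potential, bounded below on
    [r2, +oo[. So P + (k + 1) F grows linearly; F being bounded, P exceeds 1 eventually. *)
Let nonreal_zero (r1 : R) : y != 0 -> 0 < r1 -> S r1 = 0.
Proof.
move=> y0 r10; apply/eqP/negP => /negP /(F_strict r10)[r2 r12 [s s0 Fs]].
have r20 := lt_trans r10 r12.
have Q_mono (a b : R) : 0 < a -> a <= b -> y * Q b + y ^+ 2 * F b <= y * Q a + y ^+ 2 * F a.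
  move=> a0 ab; rewrite -lerN2.
  apply: (ndecr_off_circles (h := fun r => - (y * Q r + y ^+ 2 * F r))
    (dh := fun r => 0) d0 a0 ab).
  - move=> t /andP[at_ _]; have t0 := lt_le_trans a0 at_.
    by have := cF t0; have := cQ t0 => *; cts.
  - move=> t _ rt; have := dF rt; have := dQ rt => *.
    by apply: has_der_eq; first (by der); rewrite /= /S; ring.
  - by [].
have y2 : 0 < y ^+ 2 by rewrite exprn_even_gt0.
have Q_le (r : R) : r1 <= r -> y * Q r <= y ^+ 2 * (F r1 - F r).
  move=> r1r; have Q1 : y * Q r1 <= 0.
    apply/ler_addgt0Pr => e e0; rewrite add0r.
    have ye : 0 < e / `|y| by rewrite divr_gt0 // normr_gt0.
    have [t1 t10 h1] := Q0 ye; pose t := Num.min r1 t1 / 2.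
    have t0 : 0 < t by rewrite divr_gt0 // lt_min r10.
    have [tr1 tt1] : t < r1 /\ t < t1.
      have : t < Num.min r1 t1.
        by rewrite /t ltr_pdivrMr // ltr_pMr ?ltr1n // lt_min r10.
      by rewrite lt_min => /andP[-> ->].
    have := h1 t t0 tt1; rewrite ler_pdivlMr ?normr_gt0 // mulrC -normrM => hQ.
    have := Q_mono _ _ t0 (ltW tr1); have := ler_norm (y * Q t).
    have : y ^+ 2 * F t <= y ^+ 2 * F r1 by rewrite ler_pM2l // F_mono // ltW.
    by lra.
  by have := Q_mono _ _ r10 r1r; lra.
pose q := y ^+ 2 * s.
have Q_abs (r : R) : r2 <= r -> q <= `|y| * `|Q r|.
  move=> rr; rewrite -normrM ler_normr; apply/orP; right.
  have := Q_le r (le_trans (ltW r12) rr); have := Fs r rr => h1 h2.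
  have : y ^+ 2 * s <= y ^+ 2 * (F r - F r1) by rewrite ler_pM2l // lerBrDl.
  by rewrite /q; lra.
pose k := `|c| / r2 ^+ 2 + `|E - x|.
have ay0 : 0 < `|y| by rewrite normr_gt0.
have P_mono (b : R) : r2 <= b -> P r2 + (k + 1) * F r2 - 2 * q / `|y| * r2 <=
    P b + (k + 1) * F b - 2 * q / `|y| * b.
  move=> r2b; apply: (ndecr_off_circles
    (h := fun r => P r + (k + 1) * F r - 2 * q / `|y| * r)
    (dh := fun r => (wa r ^+ 2 + wb r ^+ 2) / u r ^+ 2
        + (c / r ^+ 2 + E - x) * (u r ^+ 2 * S r)
        + (k + 1) * (u r ^+ 2 * S r) - 2 * q / `|y|) d0 r20 r2b).
  - move=> t /andP[rt _]; have t0 := lt_le_trans r20 rt.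
    by have := cF t0; have := cP t0 => *; cts.
  - move=> t _ rt; have := dF rt; have := dP rt => *.
    by apply: has_der_eq; first (by der); rewrite /= /S; ring.
  move=> t /andP[rt _] _; have t0 := lt_le_trans r20 rt.
  have /andP[mu _] := um t0; have U0 := lt_le_trans m0 mu.
  have kc : - k <= c / t ^+ 2 + E - x.
    have h1 : `|c / t ^+ 2| <= `|c| / r2 ^+ 2.
      rewrite normrM ler_wpM2l // ger0_norm ?invr_ge0 ?sqr_ge0 //.
      by rewrite lef_pV2 ?posrE ?exprn_gt0 // lerXn2r // nnegrE ltW.
    have := ler_norm (- (c / t ^+ 2)); have := ler_norm (- (E - x)).
    by rewrite !normrN /k; lra.
  have US : 0 <= u t ^+ 2 * S t by rewrite mulr_ge0 // ltW.
  have hQ : 2 * q / `|y| <= 2 * `|Q t|.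
    by rewrite ler_pdivrMr // -!mulrA ler_pM2l // mulrC; exact: Q_abs.
  have hW : 2 * `|Q t| <= (wa t ^+ 2 + wb t ^+ 2) / u t ^+ 2 + u t ^+ 2 * S t.
    (* The difference of the two sides is |w / u - i z u g|^2 with w = u^2 g'; the values z = 1 and
       z = -1 give both signs of Q. *)
    have h (z : R) : 2 * z * Q t <= (wa t ^+ 2 + wb t ^+ 2) / u t ^+ 2 +
        z ^+ 2 * u t ^+ 2 * S t.
      rewrite -subr_ge0 [X in _ <= X](_ : _ = (wb t / u t - z * u t * ga t) ^+ 2
        + (wa t / u t + z * u t * gb t) ^+ 2).
        by rewrite addr_ge0 ?sqr_ge0.
      by rewrite /Q /S; field; exact: u0.
    have := h 1; have := h (-1); rewrite !(sqrrN, expr1n, mul1r).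
    by case: (ger0P (Q t)) => _; lra.
  have : 0 <= (c / t ^+ 2 + E - x + k) * (u t ^+ 2 * S t).
    by rewrite mulr_ge0 //; lra.
  by lra.
have k0 : 0 <= k by rewrite addr_ge0 // divr_ge0 // sqr_ge0.
have z0 : 0 < 2 * q / `|y| by rewrite divr_gt0 // mulr_gt0 // mulr_gt0.
(* [B] is the total growth needed to outweigh P r2 and the bounded term (k + 1) F and still leave P
   >= 1. *)
pose B := `|P r2| + (k + 1) * K + 1.
have K0 : 0 <= K by have /andP[] := F_bound r20; exact: le_trans.
have B0 : 0 <= B by rewrite !addr_ge0 // mulr_ge0 // addr_ge0.
apply: (@no_growth (r2 + B / (2 * q / `|y|)) 1) => //.
  by rewrite ltr_wpDr // divr_ge0 // ltW.
move=> r hr; have r2r : r2 <= r by apply: le_trans hr; rewrite lerDl divr_ge0 // ltW.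
have := P_mono r r2r; have /andP[F0 _] := F_bound r20.
have /andP[_ FK] := F_bound (lt_le_trans r20 r2r).
have : B <= 2 * q / `|y| * (r - r2).
  by rewrite mulrC -ler_pdivrMr // lerBrDl.
have := ler_norm (- P r2); rewrite normrN /B.
have : (k + 1) * F r <= (k + 1) * K by rewrite ler_wpM2l // addr_ge0.
have : 0 <= (k + 1) * F r2 by rewrite mulr_ge0 // addr_ge0.
by lra.
Qed.

Lemma no_square_integrable_solution : y != 0 \/ x < E ->
  forall r, 0 < r -> ga r = 0 /\ gb r = 0.
Proof.
move=> yx r r0; have : S r = 0.
  have [y0|] := eqVneq y 0; last by move=> ?; exact: nonreal_zero.
  by case: yx => [/eqP//|?]; exact: below_E_zero.
move=> /eqP; rewrite /S paddr_eq0 ?sqr_ge0 // !sqrf_eq0.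
by move=> /andP[/eqP -> /eqP ->].
Qed.

End No_square_integrable_solution.

(** * Behaviour of radial solutions at the origin *)

Section Radial_asymptotics.
Context {R : realType}.
Implicit Types (f g h : R -> R) (r s t e : R).

Lemma powRDp r e e' : 0 < r -> r `^ (e + e') = r `^ e * r `^ e'.
Proof. by move=> r0; rewrite powRD // (gt_eqF r0) implybT. Qed.

Lemma powRB1 r e : 0 < r -> r `^ (e - 1) = r `^ e / r.
Proof. by move=> r0; rewrite powRDp // powRN powRr1 // ltW. Qed.

Lemma der_powR_div r e : 0 < r -> has_der (fun t => t `^ e) r (e * r `^ e / r).
Proof.
by move=> r0; apply: (has_der_eq (der_powR e r0)); rewrite powRB1 // mulrA.
Qed.

Lemma ler_dist_der h dh g dg t r :
  (forall z : R, t <= z <= r -> has_der h z (dh z)) ->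
  (forall z : R, t <= z <= r -> has_der g z (dg z)) ->
  (forall z : R, t <= z <= r -> `|dh z| <= dg z) -> t <= r ->
  `|h r - h t| <= g r - g t.
Proof.
move=> hh hg hb tr; rewrite ler_norml; apply/andP; split.
- suff : g t + h t <= g r + h r by lra.
  apply: (ndecr_der (f := fun z => g z + h z) (df := fun z => dg z + dh z) tr).
  + by move=> z zr; apply: ctsD; apply: der_cont; [exact: hg|exact: hh].
  + move=> z /andP[tz zr]; apply: derD; [apply: hg|apply: hh]; lra.
  + move=> z /andP[tz zr]; have : `|dh z| <= dg z by apply: hb; lra.
    by rewrite ler_norml; lra.
- suff : g t - h t <= g r - h r by lra.
  apply: (ndecr_der (f := fun z => g z - h z) (df := fun z => dg z - dh z) tr).
  + move=> z zr; apply: ctsD; first by apply: der_cont; exact: hg.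
    by apply: ctsN; apply: der_cont; exact: hh.
  + move=> z /andP[tz zr]; apply: derD; first by apply: hg; lra.
    by apply: derN; apply: hh; lra.
  + move=> z /andP[tz zr]; have : `|dh z| <= dg z by apply: hb; lra.
    by rewrite ler_norml; lra.
Qed.

Variables (nu s0 : R).
Hypotheses (nu0 : 0 < nu) (s00 : 0 < s0).
Let c := nu ^+ 2 - 4^-1.
(** The powers 1/2 + nu and 1/2 - nu are the two exponents of f'' = (c / r^2) f; [p] is the regular
    solution and [q] the singular one. *)
Let p r := r `^ (2^-1 + nu).
Let q r := r `^ (2^-1 - nu).

Let p_gt0 (r : R) : 0 < r -> 0 < p r. Proof. exact: powR_gt0. Qed.
Let q_gt0 (r : R) : 0 < r -> 0 < q r. Proof. exact: powR_gt0. Qed.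

Let pq (r : R) : 0 < r -> p r * q r = r.
Proof.
move=> r0; rewrite /p /q -powRDp // -[RHS](powRr1 (ltW r0)).
by congr (_ `^ _); lra.
Qed.

Let qp (r : R) : 0 < r -> q r * r `^ (2 * nu) = p r.
Proof. by move=> r0; rewrite /q /p -powRDp //; congr (_ `^ _); lra. Qed.

Let dp (r : R) : 0 < r -> has_der p r ((2^-1 + nu) * p r / r).
Proof. exact: der_powR_div. Qed.

Let dq (r : R) : 0 < r -> has_der q r ((2^-1 - nu) * q r / r).
Proof. exact: der_powR_div. Qed.

Section Weak_singularity.
Variables (f f1 g : R -> R) (k : R).
Hypothesis nu1 : nu < 1.
Hypothesis df : forall r : R, 0 < r -> r < s0 -> has_der f r (f1 r).
Hypothesis df1 : forall r : R, 0 < r -> r < s0 ->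
  has_der f1 r (c / r ^+ 2 * f r + g r).
Hypothesis gk : forall r : R, 0 < r -> r < s0 -> `|g r| <= k * q r.
Hypothesis f0 : forall e : R, 0 < e -> exists2 t : R, 0 < t &
  forall r : R, 0 < r -> r < t -> `|f r / q r| <= e.

(** The Wronskian V = q f' - q' f = q^2 (f / q)' has derivative q g, of size q^2 = r^(1 - 2 nu),
    integrable at 0 because nu < 1. So V is bounded and (f / q)' = O(r^(2 nu - 1)). The boundary
    condition f / q -> 0 fixes the integration constant, whence f / q = O(r^(2 nu)) and f = O(p);
    the bound on f' is read off V. *)
Lemma weak_singularity_bound : exists2 C : R, 0 <= C & forall r : R, 0 < r ->
  r < s0 / 2 -> `|f r| <= C * r `^ (2^-1 + nu) /\ `|f1 r| <= C * r `^ (nu - 2^-1).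
Proof.
pose V r := q r * f1 r - (2^-1 - nu) * q r / r * f r.
have dV (r : R) : 0 < r -> r < s0 -> has_der V r (q r * g r).
  move=> r0 rs; have := df r0 rs; have := df1 r0 rs; have := dq r0 => *.
  have ? := derV (lt0r_neq0 r0) (der_id r).
  rewrite /V; apply: has_der_eq; first by der.
  by rewrite /= /c; field; rewrite gt_eqF.
have dy (r : R) : 0 < r -> r < s0 -> has_der (fun z => f z / q z) r (V r / q r ^+ 2).
  move=> r0 rs; have := df r0 rs => ?.
  have ? := derV (lt0r_neq0 (q_gt0 r0)) (dq r0).
  apply: has_der_eq; first by der.
  by rewrite /= /V; field; rewrite !gt_eqF // q_gt0.
pose s := s0 / 2; have sp : 0 < s by rewrite divr_gt0.
have ss0 : s < s0 by rewrite /s; move: s00; lra.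
have n1 : 0 < 2 - 2 * nu by move: nu1; lra.
have q2 (r : R) : 0 < r -> q r ^+ 2 = r `^ (2 - 2 * nu) / r.
  by move=> r0; rewrite /q expr2 -powRDp // -powRB1 //; congr (_ `^ _); by lra.
have k0 : 0 <= k.
  have := gk sp ss0; have := normr_ge0 (g s); have := q_gt0 sp.
  by move=> h1 h2 h3; have := le_trans h2 h3; rewrite pmulr_lge0.
pose B := `|V s| + k * s `^ (2 - 2 * nu) / (2 - 2 * nu).
have VB (r : R) : 0 < r -> r < s -> `|V r| <= B.
  move=> r0 rs.
  have := @ler_dist_der V (fun r => q r * g r)
    (fun r => k * r `^ (2 - 2 * nu) / (2 - 2 * nu))
    (fun r => k * r `^ (2 - 2 * nu) / r) r s.
  move=> /(_ _ _ _ (ltW rs)) H.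
  have {}H : `|V s - V r| <= k * s `^ (2 - 2 * nu) / (2 - 2 * nu) -
      k * r `^ (2 - 2 * nu) / (2 - 2 * nu).
    apply: H => z /andP[rz zs].
    - by apply: dV; lra.
    - have z0 : 0 < z by lra.
      have ? := der_powR_div (2 - 2 * nu) z0.
      by apply: has_der_eq; first (by der); rewrite /=; field; rewrite !gt_eqF.
    - have z0 : 0 < z by lra. have zs0 : z < s0 by lra.
      rewrite normrM gtr0_norm ?q_gt0 // -mulrA -q2 // expr2 mulrCA ler_pM2l ?q_gt0 //.
      exact: gk.
  have : 0 <= k * r `^ (2 - 2 * nu) / (2 - 2 * nu).
    by rewrite divr_ge0 ?mulr_ge0 ?powR_ge0 // ltW.
  by have := ler_normB (V s) (V s - V r); rewrite subKr /B; lra.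
have B0 : 0 <= B.
  by rewrite addr_ge0 // divr_ge0 ?mulr_ge0 ?powR_ge0 // ltW.
have n2 : 0 < 2 * nu by move: nu0; lra.
have yB (r : R) : 0 < r -> r < s -> `|f r / q r| <= B / (2 * nu) * r `^ (2 * nu).
  move=> r0 rs; apply/ler_addgt0Pr => e e0; have [t t0 ht] := f0 e0.
  pose t' := Num.min t r / 2.
  have t'0 : 0 < t' by rewrite divr_gt0 // lt_min t0 r0.
  have [t't t'r] : t' < t /\ t' < r.
    have : t' < Num.min t r.
      by rewrite /t' ltr_pdivrMr // ltr_pMr ?ltr1n // lt_min t0.
    by rewrite lt_min => /andP[].
  have H : `|f r / q r - f t' / q t'| <= B / (2 * nu) * r `^ (2 * nu) -
      B / (2 * nu) * t' `^ (2 * nu).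
    apply: (@ler_dist_der (fun z => f z / q z) (fun z => V z / q z ^+ 2)
      (fun r => B / (2 * nu) * r `^ (2 * nu))
      (fun r => B * (r `^ (2 * nu) / r)) t' r) => [z|z|z|].
    - by move=> /andP[tz zr]; apply: dy; lra.
    - move=> /andP[tz zr]; have z0 : 0 < z by lra.
      have ? := der_powR_div (2 * nu) z0.
      by apply: has_der_eq; first (by der); rewrite /=; field; rewrite !gt_eqF.
    - move=> /andP[tz zr]; have z0 : 0 < z by lra.
      rewrite normrM [X in _ <= B * X](_ : _ = (q z ^+ 2)^-1); last first.
        have Rz : 0 < z `^ (2 * nu) by exact: powR_gt0.
        have zE : z = q z * z `^ (2 * nu) * q z by rewrite qp // pq.
        by rewrite [X in _ / X]zE; field; rewrite !gt_eqF ?q_gt0.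
      by rewrite [`|_^-1|]gtr0_norm ?invr_gt0 ?exprn_gt0 ?q_gt0 // ler_pM2r
        ?invr_gt0 ?exprn_gt0 ?q_gt0 //; apply: VB; lra.
    - exact: ltW.
  have := ht _ t'0 t't; have : 0 <= B / (2 * nu) * t' `^ (2 * nu).
    by rewrite mulr_ge0 ?powR_ge0 // divr_ge0 // ltW.
  have := ler_normD (f r / q r - f t' / q t') (f t' / q t'); rewrite subrK.
  by lra.
have fB (r : R) : 0 < r -> r < s -> `|f r| <= B / (2 * nu) * p r.
  move=> r0 rs; have := yB r r0 rs.
  rewrite normrM normfV [`|q r|]gtr0_norm ?q_gt0 // ler_pdivrMr ?q_gt0 //.
  suff <- : B / (2 * nu) * r `^ (2 * nu) * q r = B / (2 * nu) * p r by [].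
  by rewrite -(qp r0); ring.
have C0 : 0 <= B / (2 * nu) by rewrite divr_ge0 // ltW.
exists (B / (2 * nu) + B + `|2^-1 - nu| * (B / (2 * nu))) => [|r r0 rs].
  by apply: addr_ge0; [exact: addr_ge0|exact: mulr_ge0].
have pp := p_gt0 r0; split.
  apply: (le_trans (fB r r0 rs)); rewrite ler_pM2r //.
  by rewrite -addrA lerDl addr_ge0 // mulr_ge0.
rewrite (_ : nu - 2^-1 = 2^-1 + nu - 1); last by lra.
rewrite powRB1 // -/(p r) mulrA ler_pdivlMr // mulrC.
have hq : `|q r * f1 r| <= B + `|2^-1 - nu| * (B / (2 * nu)).
  rewrite (_ : q r * _ = V r + (2^-1 - nu) * (q r / r * f r)); last first.
    by rewrite /V; ring.
  apply: (le_trans (ler_normD _ _)); apply: lerD; first exact: VB.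
  rewrite normrM ler_wpM2l // !normrM normfV (gtr0_norm (q_gt0 r0)) (gtr0_norm r0).
  have rE : B / (2 * nu) * r = q r * (B / (2 * nu) * p r).
    by rewrite mulrCA (mulrC (q r)) pq.
  by rewrite mulrAC ler_pdivrMr // rE ler_pM2l ?q_gt0 //; exact: fB.
have rE : r * `|f1 r| = p r * `|q r * f1 r|.
  by rewrite normrM (gtr0_norm (q_gt0 r0)) mulrA pq.
by rewrite rE mulrC ler_pM2r // (le_trans hq) // lerD2r lerDr.
Qed.

End Weak_singularity.

Section Strong_singularity.
Variable nu1 : 1 < nu.

(** The Wronskian p f' - p' f = p^2 (f / p)'. For nu > 1 it takes the place of the Wronskian with q,
    and its smallness at 0 comes from square integrability. *)
Let U f f1 r := p r * f1 r - (2^-1 + nu) * p r / r * f r.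

(* Otherwise f would be of size r^(1/2 - nu), which is not square integrable. *)
Let U_small f f1 (g D F : R -> R) (K : R) :
  (forall r : R, 0 < r -> r < s0 -> has_der f r (f1 r)) ->
  (forall r : R, 0 < r -> r < s0 -> has_der F r (D r)) ->
  (forall r : R, 0 < r -> r < s0 -> 0 <= F r <= K) ->
  (forall r : R, 0 < r -> r < s0 -> f r ^+ 2 <= D r) ->
  forall e s : R, 0 < e -> 0 < s -> s < s0 ->
  exists2 t : R, 0 < t < s & U f f1 t <= e.
Proof.
move=> df dF FK fD e s e0 sp ss0; apply: contrapT => H.
have {}H (t : R) : 0 < t -> t < s -> e < U f f1 t.
  move=> t0 ts; rewrite ltNge; apply/negP => Ue; apply: H.
  by exists t => //; rewrite t0.
have nu00 := nu0; have nu11 := nu1.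
(* As r^(- 2 nu) has derivative - 2 nu / p^2, the assumption U > e makes this function nondecreasing
   near 0. Hence f <= A p - (e / (2 nu)) q there. *)
have dh (r : R) : 0 < r -> r < s0 ->
    has_der (fun z => f z / p z + e / (2 * nu) * z `^ (- (2 * nu))) r
      ((U f f1 r - e) / p r ^+ 2).
  move=> r0 rs; have := df r r0 rs => ?.
  have ? := derV (lt0r_neq0 (p_gt0 r0)) (dp r0).
  have ? := der_powR_div (- (2 * nu)) r0.
  apply: has_der_eq; first by der.
  have R2 : 0 < r `^ (2 * nu) by exact: powR_gt0.
  have pE : p r ^+ 2 = r * r `^ (2 * nu).
    by rewrite expr2 -{2}(qp r0) mulrA pq.
  rewrite /= /U powRN; set z := r `^ _ in R2 pE *.
  have -> : e / (2 * nu) * (- (2 * nu) / z / r) = - (e / p r ^+ 2).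
    by rewrite pE; field; rewrite !gt_eqF.
  by field; rewrite !gt_eqF //; exact: p_gt0.
pose s' := s / 2; have s'0 : 0 < s' by rewrite divr_gt0.
have s's : s' < s by rewrite /s'; lra.
pose A := f s' / p s' + e / (2 * nu) * s' `^ (- (2 * nu)).
have fA (t : R) : 0 < t -> t < s' -> f t <= A * p t - e / (2 * nu) * q t.
  move=> t0 ts.
  have : f t / p t + e / (2 * nu) * t `^ (- (2 * nu)) <= A.
    apply: (ndecr_der (f := fun z => f z / p z + e / (2 * nu) * z `^ (- (2 * nu)))
      (df := fun r => (U f f1 r - e) / p r ^+ 2) (ltW ts)) => z /andP[tz zs].
    - by apply: der_cont; apply: dh; lra.
    - by apply: dh; lra.
    - have z0 : 0 < z by lra.
      by rewrite divr_ge0 ?sqr_ge0 // subr_ge0 ltW // H //; lra.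
  have pt := p_gt0 t0; have R2 : 0 < t `^ (2 * nu) by exact: powR_gt0.
  have -> : q t = p t * t `^ (- (2 * nu)).
    by rewrite powRN -(qp t0); field; exact: lt0r_neq0.
  rewrite -lerBrDr ler_pdivrMr // => h; apply: (le_trans h).
  by rewrite le_eqVlt; apply/orP; left; apply/eqP; ring.
have [k [k0 kE]] : exists k : R, 0 < k /\ e / (2 * nu) = k + k.
  exists (e / (4 * nu)); split; first by rewrite divr_gt0 //; lra.
  by field; exact: lt0r_neq0.
pose t0 := Num.min (s' / 2) (Num.min 1 (k / (`|A| + 1))).
have A1 : 0 < `|A| + 1 by have := normr_ge0 A; lra.
have t00 : 0 < t0 by rewrite !lt_min divr_gt0 // ltr01 divr_gt0.
have [t0s [t01 t0A]] : t0 < s' /\ t0 <= 1 /\ t0 * (`|A| + 1) <= k.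
  have : t0 <= t0 by []. rewrite {2}/t0 !le_min => /andP[h1 /andP[h2]].
  rewrite ler_pdivlMr // => h3; split => //; lra.
(* One of the two halves [k] of e / (2 nu) absorbs A p, which is small against q near 0. The other
   leaves f <= - k q, and q^2 >= 1 / t for t <= 1 because nu > 1. *)
have fk (t : R) : 0 < t -> t <= t0 -> k ^+ 2 / t <= D t.
  move=> tp tt0; apply: le_trans (fD t tp _); last by lra.
  have ts : t < s' by lra. have t1 : t <= 1 by lra.
  have := fA t tp ts; have qt := q_gt0 tp.
  have h1 : A * p t <= k * q t.
    rewrite -(qp tp) mulrCA mulrC ler_pM2r //.
    apply: (le_trans (y := `|A| * t `^ (2 * nu))).
      by rewrite ler_wpM2r ?powR_ge0 // ler_norm.
    have : t `^ (2 * nu) <= t.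
      rewrite -[leRHS](powRr1 (ltW tp)); apply: ger_powR; last by lra.
      by rewrite tp.
    move=> h; have : `|A| * t `^ (2 * nu) <= `|A| * t0 by rewrite ler_wpM2l //; lra.
    by have := ltW t00; lra.
  rewrite kE => h2; have {h1 h2}hf : k * q t <= - f t by lra.
  have q2 : t^-1 <= q t ^+ 2.
    rewrite expr2 /q -powRDp // -(powR_inv1 (ltW tp)); apply: ger_powR; last by lra.
    by rewrite tp.
  rewrite -[leRHS]sqrrN; apply: (le_trans (y := (k * q t) ^+ 2)).
    by rewrite exprMn ler_wpM2l ?sqr_ge0.
  by rewrite lerXn2r // nnegrE ?mulr_ge0 ?ltW // (lt_le_trans _ hf) ?mulr_gt0.
have k2 : 0 < k ^+ 2 by rewrite exprn_gt0.
have t0_s0 : t0 < s0 by lra.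
have K0 : 0 <= K by have /andP[h1 h2] := FK t0 t00 t0_s0; exact: le_trans h2.
(* The integral of k^2 / r from t to t0 is k^2 ln (t0 / t), and this t makes it K + 1, more than F
   can increase. *)
pose t := t0 * expR (- ((K + 1) / k ^+ 2)).
have tp : 0 < t by rewrite mulr_gt0 // expR_gt0.
have tt0 : t <= t0.
  apply: ler_piMr; first exact: ltW.
  by rewrite expR_le1 oppr_le0; apply: divr_ge0; [exact: addr_ge0|exact: ltW].
have : F t - k ^+ 2 * ln t <= F t0 - k ^+ 2 * ln t0.
  apply: (ndecr_der (f := fun z => F z - k ^+ 2 * ln z)
    (df := fun z => D z - k ^+ 2 / z) tt0) => z /andP[tz zt].
  - have z0 := lt_le_trans tp tz; apply: ctsD.
      by apply: der_cont; apply: dF z0 (le_lt_trans zt t0_s0).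
    by apply: ctsN; apply: ctsM; [exact: cts_cst|apply: der_cont; exact: der_ln].
  - have z0 := lt_trans tp tz; have ? := der_ln z0.
    have ? : has_der F z (D z) by apply: dF z0 (lt_trans zt t0_s0).
    by apply: has_der_eq; first (by der); rewrite /=; ring.
  - by rewrite subr_ge0; apply: fk; [exact: lt_trans tz|exact: ltW].
have -> : ln t = ln t0 - (K + 1) / k ^+ 2.
  by rewrite lnM ?posrE ?expR_gt0 // expRK.
rewrite mulrBr [_ * (_ / _)]mulrC divfK ?gt_eqF //.
have /andP[_ Ft0] := FK t0 t00 t0_s0.
have /andP[Ft _] := FK t tp (le_lt_trans tt0 t0_s0).
by clear - Ft0 Ft; lra.
Qed.

Variables (f f1 g D F : R -> R) (k K : R).
Hypothesis df : forall r : R, 0 < r -> r < s0 -> has_der f r (f1 r).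
Hypothesis df1 : forall r : R, 0 < r -> r < s0 ->
  has_der f1 r (c / r ^+ 2 * f r + g r).
Hypothesis dF : forall r : R, 0 < r -> r < s0 -> has_der F r (D r).
Hypothesis FK : forall r : R, 0 < r -> r < s0 -> 0 <= F r <= K.
Hypothesis fD : forall r : R, 0 < r -> r < s0 -> f r ^+ 2 <= D r.
Hypothesis gD : forall r : R, 0 < r -> r < s0 -> g r ^+ 2 <= k * D r.

(** Here g is controlled only in L^2. The bound [osc] on the oscillation of U, together with small
    values of U arbitrarily near 0, gives U = O(r^(1 + nu)). Then (f / p)' = U / p^2 = O(r^(- nu)),
    and integrating from s0 / 2 down to r gives f / p = O(r^(1 - nu)), that is f = O(r^(3/2)). *)
Lemma strong_singularity_bound : exists2 C : R, 0 <= C & forall r : R, 0 < r ->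
  r < s0 / 2 -> `|f r| <= C * r `^ (2^-1 + 1) /\ `|f1 r| <= C * r `^ (1 - 2^-1).
Proof.
have nu00 := nu0; have nu11 := nu1; have s000 := s00.
have dU (r : R) : 0 < r -> r < s0 -> has_der (U f f1) r (p r * g r).
  move=> r0 rs; have := df r0 rs; have := df1 r0 rs; have := dp r0 => *.
  have ? := derV (lt0r_neq0 r0) (der_id r).
  rewrite /U; apply: has_der_eq; first by der.
  by rewrite /= /c; field; rewrite gt_eqF.
have p2 (r : R) : 0 < r -> p r ^+ 2 = r `^ (2 + 2 * nu) / r.
  by move=> r0; rewrite /p expr2 -powRDp // -powRB1 //; congr (_ `^ _); lra.
have K0 : 0 <= K by have /andP[h1 h2] := FK (r := s0 / 2) ltac:(lra) ltac:(lra); lra.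
have k0 : 0 <= `|k| by [].
have n1 : 0 < 2 + 2 * nu by lra.
(* AM-GM with parameter r^(-1-nu) plays the role of Cauchy-Schwarz. *)
pose C1 := 1 + `|k| * K.
have osc (t r : R) : 0 < t -> t <= r -> r < s0 ->
    `|U f f1 r - U f f1 t| <= C1 * r `^ (1 + nu).
  move=> t0 tr rs; have r0 := lt_le_trans t0 tr.
  pose w := r `^ (1 + nu); have w0 : 0 < w by exact: powR_gt0.
  have H : `|U f f1 r - U f f1 t| <=
      (w^-1 / (2 + 2 * nu) * r `^ (2 + 2 * nu) + w * `|k| * F r) -
      (w^-1 / (2 + 2 * nu) * t `^ (2 + 2 * nu) + w * `|k| * F t).
    apply: (ler_dist_der (dh := fun z => p z * g z)
      (g := fun z => w^-1 / (2 + 2 * nu) * z `^ (2 + 2 * nu) + w * `|k| * F z)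
      (dg := fun z => w^-1 * p z ^+ 2 + w * `|k| * D z) _ _ _ tr) => z /andP[tz zr].
    - by apply: dU; lra.
    - have z0 : 0 < z by lra. have zs : z < s0 by lra.
      have ? := der_powR_div (2 + 2 * nu) z0; have ? := dF z0 zs.
      apply: has_der_eq; first (by der); rewrite /= p2 //; field.
      by rewrite !gt_eqF.
    - have z0 : 0 < z by lra. have zs : z < s0 by lra.
      have D0 : 0 <= D z by apply: le_trans (fD z0 zs); exact: sqr_ge0.
      have gk : `|g z| ^+ 2 <= `|k| * D z.
        rewrite real_normK ?num_real //; apply: (le_trans (gD z0 zs)).
        by rewrite ler_wpM2r // ler_norm.
      rewrite normrM (gtr0_norm (p_gt0 z0)).
      have wi : 0 < w^-1 by rewrite invr_gt0.
      have h : 0 <= w^-1 * (p z - w * `|g z|) ^+ 2 by rewrite mulr_ge0 ?sqr_ge0 ?ltW.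
      have hE : w^-1 * (p z - w * `|g z|) ^+ 2 =
          w^-1 * p z ^+ 2 - 2 * (p z * `|g z|) + w * `|g z| ^+ 2.
        by field; exact: lt0r_neq0.
      have : w * `|g z| ^+ 2 <= w * `|k| * D z by rewrite -mulrA ler_pM2l.
      have : 0 <= p z * `|g z| by rewrite mulr_ge0 // ltW // p_gt0.
      by lra.
  apply: (le_trans H).
  have -> : r `^ (2 + 2 * nu) = w * w.
    by rewrite /w -powRDp //; congr (_ `^ _); lra.
  have h1 : w^-1 / (2 + 2 * nu) * (w * w) <= w.
    rewrite (_ : _ * (w * w) = w / (2 + 2 * nu)); last by field; rewrite !gt_eqF.
    by rewrite ler_pdivrMr // ler_peMr ?ltW //; lra.
  have h2 : 0 <= w^-1 / (2 + 2 * nu) * t `^ (2 + 2 * nu).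
    by rewrite mulr_ge0 ?powR_ge0 // divr_ge0 ?invr_ge0 // ltW.
  have /andP[Fr FrK] := FK r0 rs. have /andP[Ft _] := FK t0 (le_lt_trans tr rs).
  have h3 : w * `|k| * F r <= w * `|k| * K by rewrite ler_wpM2l // mulr_ge0 // ltW.
  have h4 : 0 <= w * `|k| * F t by rewrite !mulr_ge0 // ltW.
  by rewrite /C1 -/w; lra.
(* [U_small] bounds U from above only; applying it to f and to - f yields the two sides. *)
have UB (r : R) : 0 < r -> r < s0 -> `|U f f1 r| <= C1 * r `^ (1 + nu).
  move=> r0 rs; apply/ler_addgt0Pr => e e0.
  have [t1 /andP[t10 t1r] U1] := U_small g df dF FK fD e0 r0 rs.
  have dNf (z : R) : 0 < z -> z < s0 -> has_der (fun y => - f y) z (- f1 z).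
    by move=> z0 zs; apply: derN; exact: df.
  have fND (z : R) : 0 < z -> z < s0 -> (- f z) ^+ 2 <= D z.
    by move=> z0 zs; rewrite sqrrN; exact: fD.
  have [t2 /andP[t20 t2r] U2] := U_small g dNf dF FK fND e0 r0 rs.
  have := osc t1 r t10 (ltW t1r) rs; rewrite ler_norml => /andP[_ h1].
  have := osc t2 r t20 (ltW t2r) rs; rewrite ler_norml => /andP[h2 _].
  have UN : U (fun y => - f y) (fun y => - f1 y) t2 = - U f f1 t2.
    by rewrite /U; ring.
  by move: U2; rewrite UN ler_norml => U2; apply/andP; split; lra.
have C10 : 0 <= C1 by rewrite addr_ge0 // mulr_ge0.
have dh (r : R) : 0 < r -> r < s0 ->
    has_der (fun z => f z / p z) r (U f f1 r / p r ^+ 2).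
  move=> r0 rs; have := df r0 rs => ?.
  have ? := derV (lt0r_neq0 (p_gt0 r0)) (dp r0).
  apply: has_der_eq; first by der.
  by rewrite /= /U; field; rewrite !gt_eqF // p_gt0.
pose s := s0 / 2; have sp : 0 < s by rewrite divr_gt0.
have ss0 : s < s0 by rewrite /s; lra.
have n2 : 0 < nu - 1 by lra.
pose C2 := `|f s / p s| / s `^ (1 - nu) + C1 / (nu - 1).
have C20 : 0 <= C2 by apply: addr_ge0; rewrite divr_ge0 ?powR_ge0 // ltW.
have fB (r : R) : 0 < r -> r < s -> `|f r| <= C2 * r `^ (2^-1 + 1).
  move=> r0 rs.
  have H : `|f s / p s - f r / p r| <=
      - (C1 / (nu - 1)) * s `^ (1 - nu) - - (C1 / (nu - 1)) * r `^ (1 - nu).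
    apply: (ler_dist_der (h := fun z => f z / p z)
      (dh := fun z => U f f1 z / p z ^+ 2)
      (g := fun z => - (C1 / (nu - 1)) * z `^ (1 - nu))
      (dg := fun z => C1 * z `^ (1 - nu) / z)); last exact: ltW.
    - by move=> z /andP[rz zs]; apply: dh; lra.
    - move=> z /andP[rz zs]; have z0 : 0 < z by lra.
      have ? := der_powR_div (1 - nu) z0.
      by apply: has_der_eq; first (by der); rewrite /=; field; rewrite !gt_eqF.
    - move=> z /andP[rz zs]; have z0 : 0 < z by lra. have zs0 : z < s0 by lra.
      have pz := exprn_gt0 2 (p_gt0 z0).
      rewrite normrM normfV (gtr0_norm pz) ler_pdivrMr //.
      apply: (le_trans (UB z z0 zs0)); rewrite -!mulrA ler_wpM2l //.
      have pE : p z ^+ 2 = z * z `^ (2 * nu) by rewrite expr2 -{2}(qp z0) mulrA pq.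
      have -> : z `^ (1 - nu) * (z^-1 * p z ^+ 2) = z `^ (1 - nu) * z `^ (2 * nu).
        by rewrite pE; field; exact: lt0r_neq0.
      rewrite -powRDp // le_eqVlt; apply/orP; left.
      by apply/eqP; congr (_ `^ _); lra.
  have r1 : 0 < r `^ (1 - nu) by exact: powR_gt0.
  have s1 : 0 < s `^ (1 - nu) by exact: powR_gt0.
  have sr : s `^ (1 - nu) <= r `^ (1 - nu).
    have -> : 1 - nu = - (nu - 1) by lra.
    rewrite !powRN lef_pV2 ?posrE ?powR_gt0 // ge0_ler_powR ?nnegrE ?ltW //.
  have : `|f r / p r| <= C2 * r `^ (1 - nu).
    have := ler_normB (f s / p s) (f s / p s - f r / p r); rewrite subKr.
    have : `|f s / p s| <= `|f s / p s| / s `^ (1 - nu) * r `^ (1 - nu).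
      by rewrite mulrAC ler_pdivlMr // ler_wpM2l.
    have : 0 <= C1 / (nu - 1) * s `^ (1 - nu) by rewrite mulr_ge0 ?divr_ge0 // ltW.
    by rewrite /C2; lra.
  have pr := p_gt0 r0.
  rewrite normrM normfV (gtr0_norm pr) ler_pdivrMr // => h; apply: (le_trans h).
  rewrite -mulrA ler_wpM2l // /p -powRDp // le_eqVlt; apply/orP; left; apply/eqP.
  by congr (_ `^ _); lra.
exists (C2 + C1 + (2^-1 + nu) * C2) => [|r r0 rs].
  by apply: addr_ge0; [exact: addr_ge0|rewrite mulr_ge0 //; lra].
have n3 : 0 <= 2^-1 + nu by lra.
split.
  apply: (le_trans (fB r r0 rs)); rewrite ler_wpM2r ?powR_ge0 //.
  by rewrite -addrA lerDl addr_ge0 // mulr_ge0.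
have pr := p_gt0 r0.
have f1E : f1 r = U f f1 r / p r + (2^-1 + nu) / r * f r.
  by rewrite /U; field; rewrite !gt_eqF.
rewrite f1E; apply: (le_trans (ler_normD _ _)); rewrite [leRHS]mulrDl.
have hr : r `^ (2^-1 + 1) = r * r `^ (1 - 2^-1).
  rewrite -{2}(powRr1 (ltW r0)) -powRDp //; congr (_ `^ _); lra.
apply: lerD; last first.
  rewrite !normrM normfV (gtr0_norm r0) (ger0_norm n3) -mulrA -mulrA ler_wpM2l //.
  by rewrite ler_pdivrMl // mulrCA -hr; exact: fB.
apply: (le_trans (y := C1 * r `^ (1 - 2^-1))); last first.
  by rewrite ler_wpM2r ?powR_ge0 // lerDr.
rewrite normrM normfV (gtr0_norm pr) ler_pdivrMr //.
apply: (le_trans (UB r r0 (lt_trans rs ss0))).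
rewrite -mulrA ler_wpM2l // /p -powRDp // le_eqVlt; apply/orP; left.
by apply/eqP; congr (_ `^ _); lra.
Qed.

End Strong_singularity.
End Radial_asymptotics.

(** * Derivatives of absolutely continuous functions *)

Section Differentiability_eps.
Context {R : realType}.
Implicit Types (f h : R -> R).

Lemma has_der_epsP f (x a : R) : has_der f x a <->
  forall e : R, 0 < e -> exists2 t : R, 0 < t &
    forall z : R, `|z - x| < t -> `|f z - f x - a * (z - x)| <= e * `|z - x|.
Proof.
have key (e h : R) : h != 0 ->
    (`|a - h^-1 *: (f (h *: (1 : R) + x) - f x)| <= e) =
    (`|f (x + h) - f x - a * (x + h - x)| <= e * `|h|).
  move=> h0; rewrite /GRing.scale /= mulr1 [h + x]addrC [x + h - x]addrAC subrr add0r.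
  rewrite -(ler_pM2r (x := `|h|)) ?normr_gt0 // -normrM distrC.
  by congr (`|_| <= _); field.
split=> [df e e0|H].
  have /cvgrPdist_le : h^-1 *: (f (h *: (1 : R) + x) - f x) @[h --> 0^'] --> a.
    by case: df => df <-.
  move=> /(_ e e0); rewrite near_withinE => -[t /= t0 ht].
  exists t => // z zt; have [->|zx] := eqVneq z x.
    by rewrite !subrr mulr0 subr0 normr0 mulr0.
  have h0 : z - x != 0 by rewrite subr_eq0.
  have := ht (z - x); rewrite /= sub0r normrN => /(_ zt h0).
  by rewrite key // [x + (z - x)]addrC subrK.
have cv : h^-1 *: (f (h *: (1 : R) + x) - f x) @[h --> 0^'] --> a.
  apply/cvgrPdist_le => e e0; rewrite near_withinE.
  have [t t0 ht] := H e e0; exists t => //= h; rewrite /= sub0r normrN => hs h0.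
  by rewrite key //; have := ht (x + h); rewrite [x + h]addrC addrK; exact.
by apply: DeriveDef; [apply/cvg_ex; exists a|exact: cvg_lim].
Qed.

End Differentiability_eps.

Section Absolute_continuity.
Context {R : realType}.
Implicit Types (h : R -> R).
Local Notation mu := (@lebesgue_measure R).

(** The interval is traversed from a to b by a supremum argument. Near a point outside [N] the
    derivative gives a slope of at least k - e. A point of [N] is crossed by an interval contained
    in an open set V of tiny measure that covers [N], and absolute continuity bounds the variation
    over all such intervals together. *)
Lemma abs_cont_slope h (a b k : R) (N : set R) : a <= b -> abs_cont a b h ->
  mu.-negligible N ->
  (forall x : R, a <= x <= b -> ~ N x -> exists2 k', k <= k' & has_der h x k') ->
  k * (b - a) <= h b - h a.
Proof.
move=> ab ach [A [mA A0 NA]] hder; apply/ler_addgt0Pr => e0 e00.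
(* The losses are e (b - a) in the slope, e in the variation of h over the crossed intervals, and
   |k| e for their total length. *)
pose e := e0 / (b - a + 1 + `|k|).
have ba1 : 0 < b - a + 1 + `|k| by have := normr_ge0 k; lra.
have e_gt0 : 0 < e by rewrite divr_gt0.
have [eta0 eta00 heta] := ach e e_gt0.
pose eta := Num.min eta0 e.
have eta_gt0 : 0 < eta by rewrite lt_min eta00.
have A0' : mu A = 0%E := A0.
have Afin : (mu A < +oo)%E by rewrite A0' ltry.
have [V [oO AO OA]] := lebesgue_regularity_outer mA Afin eta_gt0.
have mO : measurable V by exact: open_measurable.
have Oeta : (mu V < eta%:E)%E.
  have -> : V = (V `\` A) `|` A by rewrite setUC setDUK.
  apply: le_lt_trans OA.
  rewrite (le_trans (measureU2 _ _ _)) //; first exact: measurableD.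
  by rewrite [X in (_ + X <= _)%E](_ : _ = 0%E) ?adde0 //; exact: A0'.
pose m x := fine (mu (V `&` `]a, x]%classic)).
have mfin x : mu (V `&` `]a, x]%classic) \is a fin_num.
  rewrite ge0_fin_numE //; apply: le_lt_trans (lt_trans Oeta (ltry _)).
  by apply: le_measure; rewrite ?inE //; exact: measurableI.
have m_lt x : m x < eta.
  rewrite -lte_fin fineK //; apply: le_lt_trans Oeta.
  by apply: le_measure; rewrite ?inE //; exact: measurableI.
have m_step (u v : R) : a <= u -> u <= v -> m u <= m v /\
    ((forall z : R, u <= z <= v -> V z) -> m v = m u + (v - u)).
  move=> au uv.
  have E : V `&` `]a, v]%classic =
      (V `&` `]a, u]%classic) `|` (V `&` `]u, v]%classic).
    rewrite -setIUr; congr (_ `&` _); apply/seteqP; split => z /=;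
      rewrite !in_itv /=; last by case; lra.
    by move=> zz; have [zu|uz] := leP z u; [left|right]; lra.
  have mE : mu (V `&` `]a, v]%classic) =
      (mu (V `&` `]a, u]%classic) + mu (V `&` `]u, v]%classic))%E.
    rewrite E measureU //; [exact: measurableI|exact: measurableI|].
    apply/seteqP; split => // z /= [[_]]; rewrite !in_itv /= => z1 [_].
    by lra.
  have fin2 : mu (V `&` `]u, v]%classic) \is a fin_num.
    rewrite ge0_fin_numE //; apply: le_lt_trans (lt_trans Oeta (ltry _)).
    by apply: le_measure; rewrite ?inE //; exact: measurableI.
  split.
    by rewrite /m mE fineD // lerDl fine_ge0.
  move=> Ouv; rewrite /m mE fineD //; congr (_ + _).
  have -> : V `&` `]u, v]%classic = `]u, v]%classic.
    apply/seteqP; split => z /=; rewrite in_itv /=; first by case.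
    by move=> zz; split => //; apply: Ouv; lra.
  rewrite lebesgue_measure_itv /= lte_fin; case: ltP => // vu.
  by rewrite /=; lra.
have m_ge0 x : 0 <= m x by exact: fine_ge0.
have eE : e * (b - a + 1 + `|k|) = e0 by rewrite /e divfK // lt0r_neq0.
have [eta_eta0 eta_e] : eta <= eta0 /\ eta <= e by rewrite !ge_min !lexx orbT.
clearbody m eta e; clear A0 A0' Afin OA mO Oeta mfin ba1 eta00 eta_gt0.
(* [L] records the intervals inside V crossed so far, the newest first. The measure [m x] of V in
   ]a, x] bounds their total length, and the last clause is the slope inequality with their
   contribution added back. *)
pose good (x : R) (L : seq (R * R)) := [/\
  all (fun p => [&& a <= p.1, p.1 <= p.2 & p.2 <= x]) L,
  pairwise (fun p q => q.2 <= p.1) L,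
  \sum_(p <- L) (p.2 - p.1) <= m x &
  (k - e) * (x - a) <= h x - h a + \sum_(p <- L) (`|h p.2 - h p.1| + `|k| * (p.2 - p.1))].
pose G := [set x : R | a <= x <= b /\ exists L, good x L].
have step (u v : R) : G u -> u <= v -> v <= b ->
    (exists c : R, [/\ u <= c <= v, N c & forall z : R, u <= z <= v -> V z]) \/
    (k - e) * (v - u) <= h v - h u -> G v.
  move=> [/andP[au ub] [L [L1 L2 L3 L4]]] uv vb H; split; first by lra.
  have [mm mO'] := m_step u v au uv.
  case: H => [[c [_ _ Ouv]]|H]; last first.
    exists L; split => //.
    - by apply: sub_all L1 => p /and3P[-> -> /le_trans ->].
    - exact: le_trans mm.
    - by lra.
  exists ((u, v) :: L); split.
  - rewrite /= au uv lexx /=; apply: sub_all L1 => p /and3P[-> -> /le_trans ->] //.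
  - rewrite /= L2 andbT; apply: sub_all L1 => p /and3P[_ _] //.
  - by rewrite big_cons mO' //= addrC lerD2r.
  - rewrite big_cons /=.
    have : (k - e) * (v - u) <= `|k| * (v - u).
      by rewrite ler_wpM2r ?subr_ge0 //; have := ler_norm k; lra.
    by have := ler_norm (- (h v - h u)); rewrite normrN; lra.
have Ga : G a.
  split; first by lra.
  exists [::]; split; rewrite ?big_nil //; last by rewrite !subrr mulr0 addr0.
have local (c : R) : a <= c <= b -> exists2 t : R, 0 < t & forall u v : R,
    a <= u <= b -> a <= v <= b -> u <= c <= v -> c - u < t -> v - c < t ->
    (exists c : R, [/\ u <= c <= v, N c & forall z : R, u <= z <= v -> V z]) \/
    (k - e) * (v - u) <= h v - h u.
  move=> cab; have [Nc|Nc] := pselect (N c).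
    have [t /= t0 ht] : nbhs c V by apply: open_nbhs_nbhs; split => //; exact/AO/NA.
    exists t => // u v _ _ ucv cu vc; left; exists c; split => // z zuv.
    apply: ht; clear - t0 ucv cu vc zuv => /=; rewrite ltr_norml; apply/andP; split; lra.
  have [k' kk' /has_der_epsP/(_ e e_gt0)[t t0 ht]] := hder c cab Nc.
  exists t => // u v _ _ ucv cu vc; right.
  have : `|u - c| < t by clear - t0 ucv cu vc; rewrite ltr_norml; apply/andP; split; lra.
  move=> /ht; rewrite (ler0_norm (x := u - c)) ?ler_norml; last by clear - ucv; lra.
  have : `|v - c| < t by clear - t0 ucv cu vc; rewrite ltr_norml; apply/andP; split; lra.
  move=> /ht; rewrite (ger0_norm (x := v - c)) ?ler_norml; last by clear - ucv; lra.
  have : 0 <= (k' - k) * (v - u) by clear - kk' ucv; rewrite mulr_ge0 //; lra.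
  by lra.
(* A step of one of the two kinds leads from a point of [G] just below the supremum c to a point
   beyond c, unless c = b. *)
have supG : has_sup G by split; [exists a|exists b => x [/andP[]]].
pose c := sup G.
have ac : a <= c by apply: ub_le_sup => //; exact: supG.2.
have cb : c <= b by apply: sup_le_ub => //; [exact: supG.1|move=> x [/andP[]]].
have [|t t0 ht] := local c; first by rewrite ac.
have [u Gu cu] := sup_adherent t0 supG.
have uc : u <= c by apply: ub_le_sup => //; exact: supG.2.
pose v := Num.min b (c + t / 2).
have vb : v <= b by rewrite ge_min lexx.
have cv : c <= v by rewrite le_min cb /=; lra.
have vt : v <= c + t / 2 by rewrite ge_min lexx orbT.
have Gv : G v.
  have [/andP[au ub] _] := Gu; rewrite -/c in cu.
  apply: (step u) => //; first by lra.
  apply: ht.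
  - by rewrite au ub.
  - by rewrite vb (le_trans ac cv).
  - by rewrite uc.
  - by clear - cu; lra.
  - by clear - vt t0; lra.
have vc : v <= c by apply: ub_le_sup => //; exact: supG.2.
have {Gv} Gb : G b.
  move: Gv vc; rewrite /v; case: (leP b (c + t / 2)) => [//|bc Gc hc]; exfalso.
  by move: hc; lra.
have [_ [L [L1 L2 L3 L4]]] := Gb.
have sumL : \sum_(p <- L) (p.2 - p.1) < eta := le_lt_trans L3 (m_lt b).
have sumh : \sum_(p <- L) `|h p.2 - h p.1| < e.
  rewrite (big_nth (0, 0)) big_mkord.
  apply: (heta (size L) (fun i => (nth (0, 0) L i).1) (fun i => (nth (0, 0) L i).2)).
  - by move=> i; have /allP/(_ _ (mem_nth (0, 0) (ltn_ord i)))/and3P[] := L1.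
  - move=> i j ij; have /(pairwiseP (0, 0)) pw := L2.
    have [ltij|ltji|eqij] := ltngtP i j; last by move: ij; rewrite (val_inj eqij) eqxx.
      by right; apply: pw; rewrite ?inE ?ltn_ord.
    by left; apply: pw; rewrite ?inE ?ltn_ord.
  - move: sumL; rewrite (big_nth (0, 0)) big_mkord => /lt_le_trans; exact.
move: L4; rewrite big_split /= -mulr_sumr.
have : `|k| * \sum_(p <- L) (p.2 - p.1) <= `|k| * e.
  by rewrite ler_wpM2l // (le_trans (ltW sumL)).
by lra.
Qed.

(* Two applications of the slope estimate near a point where phi is continuous. *)
Lemma abs_cont_has_der h phi (a b : R) (N : set R) : abs_cont a b h ->
  mu.-negligible N ->
  (forall x : R, a <= x <= b -> ~ N x -> has_der h x (phi x)) ->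
  forall x : R, a < x < b -> {for x, continuous phi} -> has_der h x (phi x).
Proof.
move=> ach N0 hder x /andP[ax xb] cphi; apply/has_der_epsP => e e0.
have := cphi; move=> /cvgrPdist_le/(_ e e0)[t0 /= t00 ht].
pose t := Num.min t0 (Num.min (x - a) (b - x)).
have t_gt0 : 0 < t by rewrite !lt_min t00 !subr_gt0 ax.
have [tt0 [tx tb]] : t <= t0 /\ t <= x - a /\ t <= b - x.
  by split; [|split]; rewrite !ge_min lexx ?orbT.
have sub_ac (u v : R) : a <= u -> v <= b -> abs_cont u v h.
  move=> au vb e' /ach[eta eta0 H]; exists eta => // n s s' h1.
  by apply: H => i; have [? ? ?] := h1 i; split; lra.
have Nac (u v : R) : abs_cont u v h -> abs_cont u v (fun z => - h z).
  move=> H e' /H[eta eta0 {}H]; exists eta => // n s s' h1 h2 h3.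
  under eq_bigr do rewrite -opprD normrN.
  exact: H.
have slope (u v : R) : x - t < u -> u <= v -> v < x + t ->
    (phi x - e) * (v - u) <= h v - h u <= (phi x + e) * (v - u).
  move=> xu uv vx.
  have hp (z : R) : u <= z <= v -> `|phi x - phi z| <= e.
    by move=> zuv; apply: ht; rewrite /= ltr_norml; apply/andP; split; lra.
  apply/andP; split.
    apply: (abs_cont_slope (N := N)) => //; first by apply: sub_ac; lra.
    move=> z zuv Nz; exists (phi z); last by apply: hder => //; lra.
    by have := hp z zuv; rewrite ler_norml; lra.
  have := @abs_cont_slope (fun z => - h z) u v (- (phi x + e)) N uv.
  suff : - (phi x + e) * (v - u) <= - h v - - h u by lra.
  apply: (abs_cont_slope (h := fun z => - h z) (N := N)) => //.
    by apply: Nac; apply: sub_ac; lra.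
  move=> z zuv Nz; exists (- phi z).
    by have := hp z zuv; rewrite ler_norml; lra.
  by apply: derN; apply: hder => //; lra.
exists t => // z; rewrite ltr_norml => /andP[z1 z2].
have [zx|xz] := leP z x.
  have := slope z x ltac:(lra) zx ltac:(lra) => /andP[h1 h2].
  by rewrite (ler0_norm (x := z - x)) ?ler_norml; first (apply/andP; split; lra); lra.
have := slope x z ltac:(lra) (ltW xz) ltac:(lra) => /andP[h1 h2].
by rewrite (ger0_norm (x := z - x)) ?ler_norml; first (apply/andP; split; lra); lra.
Qed.

End Absolute_continuity.

(** * The periodic ground state *)

Section Cell_function.
Context {R : realType}.
Implicit Types (co si : R -> R).

Lemma der_sin (x : R) : has_der (@sin R) x (cos x).
Proof. exact: is_derive_sin. Qed.

Lemma der_cos (x : R) : has_der (@cos R) x (- sin x).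
Proof. exact: is_derive_cos. Qed.

Lemma der_expR (x : R) : has_der (@expR R) x (expR x).
Proof. exact: is_derive_expR. Qed.

(* The even positive solution of - C'' = E C on a period cell [- d / 2, d / 2],
   satisfying the jump condition at the ends of the cell. *)
Record cell_function (d beta E m M : R) (C C1 : R -> R) : Prop := CellFunction {
  cell_der : forall x : R, has_der C x (C1 x) ;
  cell_der1 : forall x : R, has_der C1 x (- E * C x) ;
  cell_even : forall x : R, C (- x) = C x ;
  cell_odd : forall x : R, C1 (- x) = - C1 x ;
  cell_gt0 : forall x : R, `|x| <= d / 2 -> 0 < C x ;
  cell_bound : forall x : R, `|x| <= d / 2 -> m <= C x ^+ 2 <= M ;
  cell_jump : - 2 * C1 (d / 2) = beta * C (d / 2) }.

(** Both signs of beta at once: s = 1 with cos and sin, s = -1 with cosh and sinh. For C(x) = co(k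
    x) and E = s k^2, the jump condition with th = k d / 2 reads th si(th) = (s beta d / 4) co(th).
    The last hypothesis lets the intermediate value theorem place th in [0, alpha]. Then |k x| <=
    alpha on the cell, so si^2 <= 4 alpha^2 and C^2 = 1 - s si^2 lies between the announced
    bounds. *)
Lemma cell_function_of (d : R) (alpha beta s : R) co si : 0 < d ->
  0 < alpha < 2^-1 -> s ^+ 2 = 1 -> 0 <= s * beta ->
  (forall x : R, has_der co x (- s * si x)) ->
  (forall x : R, has_der si x (co x)) ->
  (forall x : R, co (- x) = co x) -> (forall x : R, si (- x) = - si x) ->
  si 0 = 0 ->
  (forall x : R, co x ^+ 2 + s * si x ^+ 2 = 1) ->
  (forall x : R, `|x| <= 2^-1 -> 0 < co x /\ `|si x| <= 2 * `|x|) ->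
  s * beta * d / 4 * co alpha <= alpha * si alpha ->
  exists E C C1, cell_function d beta E (Num.min 1 (1 - s * (4 * alpha ^+ 2)))
    (Num.max 1 (1 - s * (4 * alpha ^+ 2))) C C1.
Proof.
move=> d0 /andP[al0 al1] s2 sb dco dsi co_even si_odd si0 cosi hco hal.
pose g x := x * si x - s * beta * d / 4 * co x.
have cg : {within `[0, alpha], continuous g}.
  apply: continuous_in_subspaceT => x _; rewrite /g.
  have := der_cont (dco x); have := der_cont (dsi x) => *.
  exact: (ctsD (ctsM (@cts_id _ _) _) (ctsN (ctsM (@cts_cst _ _ _) _))).
have bd : 0 <= s * beta * d / 4 by rewrite divr_ge0 // mulr_ge0 // ltW.
have [th tha gth] : exists2 th, th \in `[0, alpha] & g th = 0.
  apply: (@IVT R g 0 alpha 0 (ltW al0) cg).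
  have c0 : 0 < co 0 by have [] := hco 0; rewrite ?normr0 // invr_ge0.
  rewrite /g si0 mulr0 sub0r ge_min le_max oppr_le0 subr_ge0 hal orbT andbT.
  by rewrite mulr_ge0 // ltW.
have [th0 tha'] : 0 <= th /\ th <= alpha by move: tha; rewrite in_itv /= => /andP[].
pose k := 2 * th / d.
have kth : k * (d / 2) = th by rewrite /k; field; exact: lt0r_neq0.
have k0 : 0 <= k by rewrite divr_ge0 ?mulr_ge0 // ltW.
have dk (x : R) : has_der (fun z => k * z) x k.
  by apply: has_der_eq; first (by der); rewrite mul0r mulr1 add0r.
have small (x : R) : `|x| <= d / 2 -> `|k * x| <= alpha.
  move=> xd; rewrite normrM (ger0_norm k0); apply: le_trans tha'.
  by rewrite -kth ler_wpM2l.
have smaller (x : R) : `|x| <= d / 2 -> `|k * x| <= 2^-1.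
  by move=> /small; lra.
exists (s * k ^+ 2), (fun x => co (k * x)), (fun x => - s * k * si (k * x)).
split.
- move=> x; apply: (has_der_eq (der_comp (dco _) (dk x))); ring.
- move=> x; have ? := der_comp (dsi _) (dk x).
  by apply: has_der_eq; first (by der); rewrite /=; ring.
- by move=> x; rewrite mulrN co_even.
- by move=> x; rewrite mulrN si_odd mulrN.
- by move=> x /smaller/hco[].
- move=> x xd; have := cosi (k * x); have [_ h1] := hco _ (smaller x xd).
  have h2 := small x xd.
  have si2 : si (k * x) ^+ 2 <= 4 * alpha ^+ 2.
    rewrite -(real_normK (num_real _)) (_ : 4 * _ = (2 * alpha) ^+ 2); last by ring.
    by rewrite lerXn2r ?nnegrE //; [lra|apply: (le_trans h1); lra].
  move/eqP: s2; rewrite sqrf_eq1 => /orP[] /eqP ->.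
    have := sqr_ge0 (si (k * x)); rewrite !mul1r ge_min le_max => h3 h4.
    by apply/andP; split; apply/orP; clear - h3 h4 si2; [right|left]; lra.
  have := sqr_ge0 (si (k * x)); rewrite !mulN1r ge_min le_max => h3 h4.
  by apply/andP; split; apply/orP; clear - h3 h4 si2; [left|right]; lra.
- rewrite kth; have -> : - 2 * (- s * k * si th) = 4 / d * s * (th * si th).
    by rewrite /k; field; exact: lt0r_neq0.
  move/subr0_eq : gth => ->.
  have -> : 4 / d * s * (s * beta * d / 4 * co th) = s ^+ 2 * beta * co th.
    by field; exact: lt0r_neq0.
  by rewrite s2 mul1r.
Qed.

Lemma sin_le (x : R) : `|sin x| <= `|x|.
Proof.
wlog x0 : x / 0 <= x.
  move=> H; have [/H//|x0] := leP 0 x.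
  by rewrite -normrN -sinN -(normrN x); apply: H; rewrite oppr_ge0 ltW.
have := @ler_dist_der R (@sin R) (@cos R) (fun z => z) (fun=> 1) 0 x.
rewrite sin0 !subr0 (ger0_norm x0); apply => // z _.
- exact: der_sin.
- exact: der_id.
- exact: cos_max.
Qed.

Definition ch (x : R) : R := (expR x + expR (- x)) / 2.
Definition sh (x : R) : R := (expR x - expR (- x)) / 2.

Let der_expRN (x : R) : has_der (fun z => expR (- z)) x (- expR (- x)).
Proof.
apply: (has_der_eq (der_comp (der_expR _) (derN (der_id x)))).
by rewrite mulN1r.
Qed.

Lemma der_ch (x : R) : has_der ch x (sh x).
Proof.
have := der_expRN x; have := der_expR x => *.
by apply: has_der_eq; first (by rewrite /ch; der); rewrite /= /sh; ring.
Qed.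

Lemma der_sh (x : R) : has_der sh x (ch x).
Proof.
have := der_expRN x; have := der_expR x => *.
by apply: has_der_eq; first (by rewrite /sh; der); rewrite /= /ch; ring.
Qed.

Lemma ch2_sh2 (x : R) : ch x ^+ 2 - sh x ^+ 2 = 1.
Proof.
have e1 : expR x * expR (- x) = 1 by rewrite -expRD subrr expR0.
by rewrite -e1 /ch /sh; field.
Qed.

Lemma ch_gt0 (x : R) : 0 < ch x.
Proof. by rewrite divr_gt0 // addr_gt0 ?expR_gt0. Qed.

Lemma ch_le2 (x : R) : `|x| <= 2^-1 -> ch x <= 2.
Proof.
have h (y : R) : y <= 2^-1 -> expR y <= 2.
  move=> y2; rewrite -(opprK y) expRN -[leRHS]invrK lef_pV2 ?posrE ?expR_gt0 //.
  by have := expR_ge1Dx (- y); lra.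
rewrite ler_norml => /andP[h1 h2].
by rewrite /ch; have := h x h2; have := h (- x) ltac:(lra); lra.
Qed.

Lemma shN (x : R) : sh (- x) = - sh x.
Proof. by rewrite /sh opprK; ring. Qed.

Lemma sh0 : sh 0 = 0.
Proof. by rewrite /sh oppr0 subrr mul0r. Qed.

Lemma sh_le (x : R) : `|x| <= 2^-1 -> `|sh x| <= 2 * `|x|.
Proof.
wlog x0 : x / 0 <= x.
  move=> H; have [/H//|x0] := leP 0 x; rewrite -(normrN x) -(normrN (sh x)) -shN.
  by apply: H; rewrite oppr_ge0 ltW.
move=> x2; have := @ler_dist_der R sh ch (fun z => 2 * z) (fun=> 2) 0 x.
rewrite sh0 mulr0 !subr0 (ger0_norm x0); apply => // z /andP[z0 zx].
- exact: der_sh.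
- by apply: has_der_eq; first (by der); rewrite /=; ring.
- rewrite gtr0_norm ?ch_gt0 //; apply: ch_le2; rewrite ger0_norm //.
  by move: x2; rewrite ger0_norm //; lra.
Qed.

Lemma sh_gt0 (x : R) : 0 < x -> 0 < sh x.
Proof. by move=> x0; rewrite divr_gt0 // subr_gt0 ltr_expR; lra. Qed.

(** The bound on beta is the smaller of (4 / d) alpha tan alpha and (4 / d) alpha tanh alpha: below
    it the root th of the cell equation is at most alpha, for either sign of beta. *)
Lemma exists_cell_function (d alpha : R) : 0 < d -> 0 < alpha < 2^-1 ->
  exists2 beta0 : R, 0 < beta0 & forall beta : R, `|beta| < beta0 ->
  exists E m M C C1, [/\ cell_function d beta E m M C C1, 0 < m &
    (4^-1 - alpha ^+ 2) * M <= m / 4].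
Proof.
move=> d0 al; have /andP[al0 al1] := al.
have pi2 := pihalf_ge1 R.
have ca : 0 < cos alpha by apply: cos_gt0_pihalf; lra.
have sa : 0 < sin alpha by apply: sin_gt0_pihalf; lra.
have a2 : alpha ^+ 2 < 4^-1.
  by rewrite (_ : 4^-1 = 2^-1 ^+ 2); [rewrite ltrXn2r ?nnegrE ?ltW|field].
exists (Num.min (4 / d * (alpha * sin alpha / cos alpha))
                (4 / d * (alpha * sh alpha / ch alpha))).
  have h (x y : R) : 0 < x -> 0 < y -> 0 < 4 / d * (alpha * x / y).
    move=> x0 y0; apply: mulr_gt0; first exact: divr_gt0.
    by apply: divr_gt0 => //; exact: mulr_gt0.
  by rewrite lt_min !h // ?sh_gt0 ?ch_gt0.
move=> beta; rewrite lt_min => /andP[b1 b2].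
have a20 : 0 <= alpha ^+ 2 := sqr_ge0 alpha.
have fin (s : R) co si : s ^+ 2 = 1 -> 0 <= s * beta -> 0 < co alpha ->
    `|beta| < 4 / d * (alpha * si alpha / co alpha) ->
    s * beta * d / 4 * co alpha <= alpha * si alpha.
  move=> s2 sb c0 hb; have : s * beta <= `|beta|.
    apply: (le_trans (ler_norm _)); rewrite normrM.
    suff -> : `|s| = 1 by rewrite mul1r.
    by move/eqP: s2; rewrite sqrf_eq1 => /orP[] /eqP ->; rewrite ?normrN normr1.
  move=> h; have {h hb} : s * beta <= 4 / d * (alpha * si alpha / co alpha) by lra.
  have pos : 0 < d / 4 * co alpha by rewrite mulr_gt0 // divr_gt0.
  move=> /(ler_wpM2r (ltW pos)) h; apply: le_trans (le_trans h _).
    by rewrite le_eqVlt; apply/orP; left; apply/eqP; field.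
  by rewrite le_eqVlt; apply/orP; left; apply/eqP; field; rewrite !lt0r_neq0.
have [bp|bn] := leP 0 beta.
  have h1 : 1 ^+ 2 = 1 :> R by rewrite expr1n.
  have h2 : 0 <= 1 * beta by rewrite mul1r.
  have h3 (x : R) : has_der (@cos R) x (- 1 * sin x) by rewrite mulN1r; exact: der_cos.
  have h4 (x : R) : cos x ^+ 2 + 1 * sin x ^+ 2 = 1 by rewrite mul1r; exact: cos2Dsin2.
  have h5 (x : R) : `|x| <= 2^-1 -> 0 < cos x /\ `|sin x| <= 2 * `|x|.
    move=> x2; split; last by have := sin_le x; have := normr_ge0 x; lra.
    by move: x2; rewrite ler_norml => /andP[? ?]; apply: cos_gt0_pihalf; lra.
  have [E [C [C1 cell]]] := cell_function_of d0 al h1 h2 h3 der_sin (@cosN R) (@sinN R) (@sin0 R)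
    h4 h5 (fin 1 (@cos R) (@sin R) h1 h2 ca b1).
  do 5 eexists; split; first exact: cell.
    by rewrite lt_min ltr01 /=; lra.
  (* For beta >= 0 the bounds are m = 1 - 4 alpha^2 and M = 1, and the Hardy condition holds with
     equality. *)
  by case: (leP 1 (1 - 1 * (4 * alpha ^+ 2))); nra.
have h1 : (-1) ^+ 2 = 1 :> R by rewrite sqrrN expr1n.
have h2 : 0 <= -1 * beta by rewrite mulN1r oppr_ge0 ltW.
have h3 (x : R) : has_der ch x (- -1 * sh x).
  by rewrite opprK mul1r; exact: der_ch.
have h4 (x : R) : ch x ^+ 2 + -1 * sh x ^+ 2 = 1 by rewrite mulN1r; exact: ch2_sh2.
have h5 (x : R) : `|x| <= 2^-1 -> 0 < ch x /\ `|sh x| <= 2 * `|x|.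
  by move=> x2; split; [exact: ch_gt0|exact: sh_le].
have chN (x : R) : ch (- x) = ch x by rewrite /ch opprK addrC.
have [E [C [C1 cell]]] := cell_function_of d0 al h1 h2 h3 der_sh chN shN sh0
  h4 h5 (fin (-1) ch sh h1 h2 (ch_gt0 alpha) b2).
do 5 eexists; split; first exact: cell.
  by rewrite lt_min ltr01 /=; lra.
(* For beta < 0 the bounds are m = 1 and M = 1 + 4 alpha^2, and the left side is (1 - 16 alpha^4) /
   4. *)
by case: (leP 1 (1 - -1 * (4 * alpha ^+ 2))); nra.
Qed.

End Cell_function.

(** * One-sided limits and neighbourhoods *)

Section Limits.
Context {R : realType}.
Implicit Types (f g : R -> R).

Lemma cvg_near_eq (F : set_system R) {FF : Filter F} f g (l : R) :
  (\forall x \near F, f x = g x) -> f x @[x --> F] --> l -> g x @[x --> F] --> l.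
Proof.
move=> fg; apply: cvg_trans; apply: near_eq_cvg.
by apply: filterS fg => x.
Qed.

Lemma continuous_right f (x : R) : {for x, continuous f} -> f y @[y --> x^'+] --> f x.
Proof. by move=> cf; have /left_right_continuousP[] := cf. Qed.

Lemma continuous_left f (x : R) : {for x, continuous f} -> f y @[y --> x^'-] --> f x.
Proof. by move=> cf; have /left_right_continuousP[] := cf. Qed.

Lemma near_itv (a b x : R) : a < x < b -> \forall y \near x, a < y < b.
Proof.
move=> xab; have : nbhs x `]a, b[%classic.
  by apply: open_nbhs_nbhs; split; [exact: interval_open|rewrite /= in_itv].
by apply: filterS => y; rewrite /= in_itv.
Qed.

Lemma near_right_itv (a b : R) : a < b -> \forall y \near a^'+, a < y < b.
Proof.
by move=> ab; near=> y; apply/andP; split; near: y;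
  [exact: nbhs_right_gt|exact: nbhs_right_lt].
Unshelve. all: by end_near. Qed.

Lemma near_left_itv (a b : R) : a < b -> \forall y \near b^'-, a < y < b.
Proof.
by move=> ab; near=> y; apply/andP; split; near: y;
  [exact: nbhs_left_gt|exact: nbhs_left_lt].
Unshelve. all: by end_near. Qed.

End Limits.

(** * Periodic extension of the cell function *)

Section Ground_state.
Context {R : realType}.
Variables (d beta E m M : R) (C C1 : R -> R).
Hypotheses (d0 : 0 < d) (cell : cell_function d beta E m M C C1).

(** Cells are centred at the multiples of d and their walls are the circles. The floor assigns a
    wall to the cell on its right, so on a circle [ground_state1] is the right derivative of u. *)
Definition cell_center (r : R) : R := d * (Num.floor (r / d + 2^-1))%:~R.
Definition ground_state (r : R) : R := C (r - cell_center r).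
Definition ground_state1 (r : R) : R := C1 (r - cell_center r).
Let u := ground_state.
Let u1 := ground_state1.

Lemma cell_centerE (r : R) (n : nat) :
  d * (n%:R - 2^-1) <= r < d * (n%:R + 2^-1) -> cell_center r = d * n%:R.
Proof.
move=> /andP[h1 h2]; rewrite /cell_center (@floor_def _ _ (n : int)) //.
rewrite intrD -!pmulrn; apply/andP; split.
  by rewrite -lerBlDr ler_pdivlMr // mulrC.
have : r / d < n%:R + 2^-1 by rewrite ltr_pdivrMr // mulrC.
by lra.
Qed.

Lemma cell_of (r : R) : 0 < r ->
  exists n : nat, d * (n%:R - 2^-1) <= r < d * (n%:R + 2^-1).
Proof.
move=> r0; pose x := r / d + 2^-1.
have x0 : 0 <= x by rewrite addr_ge0 ?invr_ge0 // divr_ge0 // ltW.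
exists `|Num.floor x|%N; have := floor_itv x.
have -> : (Num.floor x)%:~R = `|Num.floor x|%N%:R :> R.
  by rewrite -[LHS]ger0_norm ?ler0z ?floor_ge0 // -intr_norm -abszE.
rewrite intrD -[X in X%:~R](@gez0_abs (Num.floor x)) ?floor_ge0 // -pmulrn.
set n := `|_|%N; rewrite /x => /andP[h1 h2].
apply/andP; split.
  have : n%:R - 2^-1 <= r / d by lra.
  by rewrite ler_pdivlMr // mulrC.
have : r / d < n%:R + 2^-1 by move: h2; rewrite mulr1z; lra.
by rewrite ltr_pdivrMr // mulrC.
Qed.

Lemma cell_of_regular (r : R) : regular_radii d r ->
  exists n : nat, d * (n%:R - 2^-1) < r < d * (n%:R + 2^-1).
Proof.
move=> [r0 rn]; have [n /andP[h1 h2]] := cell_of r0; exists n; rewrite h2 andbT.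
rewrite lt_neqAle h1 andbT; case: n {h1 h2} => [|n].
  have : d * (0%:R - 2^-1) < 0 by rewrite sub0r mulrN oppr_lt0 mulr_gt0 ?invr_gt0.
  by move=> h; rewrite lt_eqF // (lt_trans h).
rewrite eq_sym; apply: contra_neq (rn n) => ->; rewrite /circle_radius.
by congr (_ * _); rewrite (mulrS _ n); lra.
Qed.

Lemma regular_of_cell (r : R) (n : nat) : 0 < r ->
  d * (n%:R - 2^-1) < r < d * (n%:R + 2^-1) -> regular_radii d r.
Proof.
move=> r0 /andP[h1 h2]; split=> // k; have [kn|nk] := ltnP k n.
  rewrite gt_eqF // (le_lt_trans _ h1) // /circle_radius ler_pM2l //.
  have : (k.+1%:R : R) <= n%:R by rewrite ler_nat.
  by rewrite (mulrS _ k); lra.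
rewrite lt_eqF // (lt_le_trans h2) // /circle_radius ler_pM2l //.
by have : (n%:R : R) <= k%:R; [rewrite ler_nat|lra].
Qed.

Lemma cell_offset (r : R) : 0 < r -> `|r - cell_center r| <= d / 2.
Proof.
move=> /cell_of[n nr]; rewrite (cell_centerE nr); move: nr => /andP[h1 h2].
by rewrite ler_norml; apply/andP; split; lra.
Qed.

Lemma ground_state_gt0 (r : R) : 0 < r -> 0 < u r.
Proof. by move=> /cell_offset; exact: cell_gt0 cell _. Qed.

Lemma ground_state_bound (r : R) : 0 < r -> m <= u r ^+ 2 <= M.
Proof. by move=> /cell_offset; exact: cell_bound cell _. Qed.

Let dshift (a x : R) : has_der (fun z => z - a) x 1.
Proof. by apply: has_der_eq; first (by der); rewrite /=; ring. Qed.

Lemma der_ground_state (r : R) : regular_radii d r -> has_der u r (u1 r).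
Proof.
move=> /cell_of_regular[n nr].
have cr : cell_center r = d * n%:R by apply: cell_centerE; lra.
apply: (der_near (f := fun z => C (z - d * n%:R))).
  near=> z; rewrite /u /ground_state (@cell_centerE z n) //.
  have : d * (n%:R - 2^-1) < z < d * (n%:R + 2^-1) by near: z; exact: near_itv.
  by move=> /andP[h1 h2]; rewrite h2 ltW.
apply: (has_der_eq (der_comp (cell_der cell _) (dshift _ _))).
by rewrite mul1r /u1 /ground_state1 cr.
Unshelve. all: by end_near. Qed.

Lemma der_ground_state1 (r : R) : regular_radii d r -> has_der u1 r (- E * u r).
Proof.
move=> /cell_of_regular[n nr].
have cr : cell_center r = d * n%:R by apply: cell_centerE; lra.
apply: (der_near (f := fun z => C1 (z - d * n%:R))).
  near=> z; rewrite /u1 /ground_state1 (@cell_centerE z n) //.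
  have : d * (n%:R - 2^-1) < z < d * (n%:R + 2^-1) by near: z; exact: near_itv.
  by move=> /andP[h1 h2]; rewrite h2 ltW.
apply: (has_der_eq (der_comp (cell_der1 cell _) (dshift _ _))).
by rewrite mul1r /u /ground_state cr.
Unshelve. all: by end_near. Qed.

Lemma near_right_circle (n : nat) : \forall x \near (circle_radius d n)^'+,
  regular_radii d x /\ cell_center x = d * n.+1%:R.
Proof.
have h : circle_radius d n < d * (n.+1%:R + 2^-1).
  by rewrite /circle_radius ltr_pM2l // ltrD2r ltr_nat.
near=> x; have /andP[h1 h2] : circle_radius d n < x < d * (n.+1%:R + 2^-1).
  by near: x; exact: near_right_itv.
have rE : d * (n.+1%:R - 2^-1) = circle_radius d n.
  by rewrite /circle_radius (mulrS _ n); congr (_ * _); lra.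
split; last by apply: cell_centerE; rewrite rE h2 ltW.
apply: (@regular_of_cell _ n.+1); last by rewrite rE h1 h2.
by apply: lt_trans h1; exact: circle_radius_gt0.
Unshelve. all: by end_near. Qed.

Lemma near_left_circle (n : nat) : \forall x \near (circle_radius d n)^'-,
  regular_radii d x /\ cell_center x = d * n%:R.
Proof.
have h : Num.max 0 (d * (n%:R - 2^-1)) < circle_radius d n.
  by rewrite gt_max circle_radius_gt0 //= /circle_radius ltr_pM2l //; lra.
near=> x; have /andP[] : Num.max 0 (d * (n%:R - 2^-1)) < x < circle_radius d n.
  by near: x; exact: near_left_itv.
rewrite gt_max => /andP[x0 h1] h2.
split; last by apply: cell_centerE; rewrite ltW.
by apply: (@regular_of_cell _ n) => //; rewrite h1.
Unshelve. all: by end_near. Qed.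

Let circle_shift (n : nat) : circle_radius d n - d * n.+1%:R = - (d / 2) /\
  circle_radius d n - d * n%:R = d / 2.
Proof. by rewrite /circle_radius (mulrS _ n); split; lra. Qed.

Lemma ground_state_circle (n : nat) : u (circle_radius d n) = C (d / 2).
Proof.
rewrite /u /ground_state (@cell_centerE _ n.+1).
  by rewrite (circle_shift n).1 (cell_even cell).
rewrite /circle_radius (mulrS _ n); apply/andP; split; last by rewrite ltr_pM2l //; lra.
by rewrite ler_pM2l //; lra.
Qed.

Lemma ground_state1_right (n : nat) :
  u1 x @[x --> (circle_radius d n)^'+] --> - C1 (d / 2).
Proof.
apply: (@cvg_near_eq _ _ _ (fun x => C1 (x - d * n.+1%:R))).
  by apply: filterS (near_right_circle n) => x [_]; rewrite /u1 /ground_state1 => ->.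
rewrite -(cell_odd cell) -(circle_shift n).1.
apply: (@continuous_right _ (fun x => C1 (x - d * n.+1%:R))).
exact: der_cont (der_comp (cell_der1 cell _) (dshift _ _)).
Qed.

Lemma ground_state1_left (n : nat) :
  u1 x @[x --> (circle_radius d n)^'-] --> C1 (d / 2).
Proof.
apply: (@cvg_near_eq _ _ _ (fun x => C1 (x - d * n%:R))).
  by apply: filterS (near_left_circle n) => x [_]; rewrite /u1 /ground_state1 => ->.
rewrite -(circle_shift n).2.
apply: (@continuous_left _ (fun x => C1 (x - d * n%:R))).
exact: der_cont (der_comp (cell_der1 cell _) (dshift _ _)).
Qed.

Lemma regular_or_circle (r : R) : 0 < r ->
  regular_radii d r \/ exists n, r = circle_radius d n.
Proof.
move=> r0; have [[n ->]|H] := pselect (exists n, r = circle_radius d n).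
  by right; exists n.
by left; split=> // n; apply/eqP => rn; apply: H; exists n.
Qed.

Lemma continuous_ground_state (r : R) : 0 < r -> {for r, continuous u}.
Proof.
move=> /regular_or_circle[/der_ground_state/der_cont//|[n ->]].
apply/left_right_continuousP; rewrite -/u ground_state_circle; split.
  apply: (@cvg_near_eq _ _ _ (fun x => C (x - d * n%:R))).
    by apply: filterS (near_left_circle n) => x [_]; rewrite /u /ground_state => ->.
  rewrite -(circle_shift n).2.
  apply: (@continuous_left _ (fun x => C (x - d * n%:R))).
  exact: der_cont (der_comp (cell_der cell _) (dshift _ _)).
apply: (@cvg_near_eq _ _ _ (fun x => C (x - d * n.+1%:R))).
  by apply: filterS (near_right_circle n) => x [_]; rewrite /u /ground_state => ->.
rewrite -(cell_even cell) -(circle_shift n).1.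
apply: (@continuous_right _ (fun x => C (x - d * n.+1%:R))).
exact: der_cont (der_comp (cell_der cell _) (dshift _ _)).
Qed.

Lemma ground_state1_bounded : exists2 K : R, 0 <= K & forall r : R, 0 < r -> `|u1 r| <= K.
Proof.
have d2 : 0 <= d / 2 by rewrite divr_ge0 // ltW.
have M0 : 0 <= M.
  have [] := andP (cell_bound cell (x := 0) _); rewrite ?normr0 // => h.
  by apply: le_trans; exact: sqr_ge0.
have h (x : R) : 0 <= x <= d / 2 -> `|C1 x| <= `|E| * (M + 1) * (d / 2).
  move=> /andP[x0 xd].
  have C10 : C1 0 = 0 by have := cell_odd cell 0; rewrite oppr0; lra.
  have : `|C1 x - C1 0| <= `|E| * (M + 1) * x - `|E| * (M + 1) * 0.
    apply: (ler_dist_der (dh := fun z => - E * C z)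
      (g := fun z => `|E| * (M + 1) * z) (dg := fun=> `|E| * (M + 1))) => // z.
    - by move=> _; exact: cell_der1 cell _.
    - by move=> _; apply: has_der_eq; first (by der); rewrite /=; ring.
    - move=> /andP[z0 zx]; rewrite normrM normrN ler_wpM2l //.
      have zd : `|z| <= d / 2 by rewrite ger0_norm // (le_trans zx).
      have /andP[_ CM] := cell_bound cell zd; rewrite ler_norml; apply/andP; split; nra.
  rewrite C10 subr0 mulr0 subr0 => /le_trans; apply.
  by rewrite ler_wpM2l // mulr_ge0 // addr_ge0.
exists (`|E| * (M + 1) * (d / 2)) => [|r r0].
  by apply: mulr_ge0 => //; apply: mulr_ge0 => //; exact: addr_ge0.
have := cell_offset r0; rewrite /u1 /ground_state1; set x := r - _ => xd.
have [x0|x0] := leP 0 x; first by apply: h; move: xd; rewrite ger0_norm ?x0.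
rewrite -normrN -(cell_odd cell); apply: h.
by move: xd; rewrite ltr0_norm // => xd; apply/andP; split; lra.
Qed.

End Ground_state.

(** * The radial equation *)

Section Primitive.
Context {R : realType}.
Local Notation mu := (@lebesgue_measure R).

Lemma sqr_normcE (z : R[i]) :
  ComplexField.Normc.normc z ^+ 2 = complex.Re z ^+ 2 + complex.Im z ^+ 2.
Proof. by case: z => a b /=; rewrite sqr_sqrtr // addr_ge0 ?sqr_ge0. Qed.

(** Square integrability in the form used by the growth argument: F is the integral over ]0, r],
    differentiable at every r by continuity of f, and bounded by the full integral. *)
Lemma L2fun_primitive (f : R -> R[i]) :
  L2fun mu `]0, +oo[%classic f ->
  (forall r : R, 0 < r -> {for r, continuous (fun x => complex.Re (f x))}) ->
  (forall r : R, 0 < r -> {for r, continuous (fun x => complex.Im (f x))}) ->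
  exists F K, forall r : R, 0 < r ->
    has_der F r (complex.Re (f r) ^+ 2 + complex.Im (f r) ^+ 2) /\ 0 <= F r <= K.
Proof.
move=> [mRe mIm]; rewrite /sqnorm => fin cRe cIm.
pose D r := complex.Re (f r) ^+ 2 + complex.Im (f r) ^+ 2.
have D0 r : 0 <= D r by rewrite addr_ge0 ?sqr_ge0.
have mD : measurable_fun (`]0, +oo[%classic : set (measurableTypeR R)) D.
  by apply: measurable_funD; exact: measurable_funX.
have finE : (\int[mu]_(x in `]0%R, +oo[) (D x)%:E < +oo)%E.
  move: fin; congr (_ < _)%E.
  by apply: eq_integral => x _; rewrite sqr_normcE.
have intD : mu.-integrable `]0, +oo[ (EFin \o D).
  apply/integrableP; split; first exact/measurable_EFinP.
  apply: le_lt_trans finE; rewrite le_eqVlt; apply/orP; left; apply/eqP.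
  by apply: eq_integral => x _; rewrite gee0_abs // lee_fin.
have sub (r : R) : `]0, r] `<=` `]0%R, +oo[%classic.
  by move=> x /=; rewrite !in_itv /= andbT => /andP[].
have intDr r : mu.-integrable `]0, r] (EFin \o D).
  by apply: (integrableS _ _ _ intD) => //; exact: sub.
pose F r := (\int[mu]_(t in [set` `]0, r]]) D t)%R.
exists F, (fine (\int[mu]_(x in `]0%R, +oo[) (D x)%:E)) => r r0; split.
  have cD : {for r, continuous D}.
    by have := cRe r r0; have := cIm r r0 => *; rewrite /D; cts.
  have ax : (BRight (0 : R) < BRight r)%O by rewrite bnd_simp.
  have rr : r < r + 1 by rewrite ltrDl.
  have [dF F'] := continuous_FTC1 rr (intDr _) ax cD.
  exact: DeriveDef dF (etrans (esym (derive1E _ _)) F').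
apply/andP; split; first by apply: Rintegral_ge0 => x _; exact: D0.
rewrite fine_le //.
- exact: integrable_fin_num.
- exact: integrable_fin_num.
- apply: ge0_subset_integral => //.
    exact/measurable_EFinP.
  by move=> x _; rewrite lee_fin.
Qed.

End Primitive.

Section Radial_equation.
Context {R : realType}.
Variables (d alpha beta : R) (l : int).
Hypothesis d0 : 0 < d.
Local Notation mu := (@lebesgue_measure R).
Let c := centrifugal alpha l.

Lemma regular_itv (r : R) : regular_radii d r -> exists a b : R,
  [/\ 0 < a, a < r < b & `[a, b]%classic `<=` regular_radii d].
Proof.
move=> rr; have r0 : 0 < r by case: rr.
have [n /andP[h1 h2]] := cell_of_regular d0 rr.
pose lo := Num.max 0 (d * (n%:R - 2^-1)).
have lo_r : lo < r by rewrite gt_max r0.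
have lo0 : 0 <= lo by rewrite le_max lexx.
have lon : d * (n%:R - 2^-1) <= lo by rewrite le_max lexx orbT.
exists ((lo + r) / 2), ((r + d * (n%:R + 2^-1)) / 2); split.
- by lra.
- by apply/andP; split; lra.
- move=> x /=; rewrite in_itv /= => /andP[x1 x2].
  by apply: (@regular_of_cell _ d d0 _ n); [lra|apply/andP; split; lra].
Qed.

(** The operator prescribes f'' only almost everywhere. For an eigenfunction the right-hand side is
    continuous and f' is locally absolutely continuous, so the equation holds at every regular
    radius. *)
Lemma radial_real_der f g k : radial_real d alpha beta l f g ->
  (forall r : R, 0 < r -> {for r, continuous k}) ->
  {ae mu, forall r : R, 0 < r -> g r = k r} ->
  forall r : R, regular_radii d r ->
    has_der f r (derive1 f r) /\ has_der (derive1 f) r (c / r ^+ 2 * f r - k r).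
Proof.
move=> [cf [df acf acf'] aeg _ _] ck aek r rr.
split.
  by apply: DeriveDef; [exact: df|rewrite derive1E].
have [a [b [a0 rab sub]]] := regular_itv rr.
have aeN : {ae mu, forall x : R, 0 < x -> has_der (derive1 f) x (c / x ^+ 2 * f x - k x)}.
  have FF := ae_filter_ringOfSetsType mu.
  apply: filterS2 aeg aek => x h1 h2 x0.
  have [dx gx] := h1 x0; apply: DeriveDef => //.
  by rewrite -derive1E -(h2 x0) gx /c; ring.
have ab : a <= b by move: rab => /andP[h1 h2]; lra.
apply: (abs_cont_has_der (phi := fun x => c / x ^+ 2 * f x - k x) (acf' a b ab sub) aeN).
- move=> x /andP[ax xb] Nx; have [] := pselect (0 < x -> has_der (derive1 f) x (c / x ^+ 2 * f x - k x)).
    by apply; exact: lt_le_trans ax.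
  by move=> H; exfalso; exact: Nx.
- exact: rab.
have r0 : 0 < r by case: rr.
have := ck r r0; have := cf r r0 => ? ?.
have ? : {for r, continuous (fun z : R => (z ^+ 2)^-1)}.
  by apply: ctsV; [rewrite lt0r_neq0 // exprn_gt0|cts].
by cts.
Qed.

Variables (E m M : R) (C C1 : R -> R).
Hypothesis cell : cell_function d beta E m M C C1.
Let u := ground_state d C.
Let u1 := ground_state1 d C1.

(* The right derivative, so that the Wronskian below is continuous. *)
Definition right_derivative (f : R -> R) (r : R) : R := lim (derive1 f x @[x --> r^'+]).

(** This is u^2 (f / u)', the function w of the growth argument. *)
Definition wronskian (f : R -> R) (r : R) : R :=
  u r * right_derivative f r - u1 r * f r.

Section One_component.
Variables (f g k : R -> R).
Hypothesis fg : radial_real d alpha beta l f g.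
Hypothesis ck : forall r : R, 0 < r -> {for r, continuous k}.
Hypothesis gk : {ae mu, forall r : R, 0 < r -> g r = k r}.

Lemma right_derivativeE (r : R) : regular_radii d r -> right_derivative f r = derive1 f r.
Proof.
move=> rr; have [_ /der_cont] := radial_real_der fg ck gk rr.
by move=> /continuous_right /cvg_lim; apply.
Qed.

Lemma der_wronskian (r : R) : regular_radii d r ->
  has_der (wronskian f) r (((c / r ^+ 2 + E) * f r - k r) * u r).
Proof.
move=> rr; have [a [b [a0 rab sub]]] := regular_itv rr.
have [df df1] := radial_real_der fg ck gk rr.
have ? := der_ground_state d0 cell rr.
have ? := der_ground_state1 d0 cell rr.
apply: (der_near (f := fun z => u z * derive1 f z - u1 z * f z)).
  near=> z; rewrite /wronskian right_derivativeE //; apply: sub.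
  have /andP[h1 h2] : a < z < b by near: z; exact: near_itv.
  by rewrite /= in_itv /= !ltW.
by apply: has_der_eq; first (by rewrite /u /u1; der); rewrite /= /u /u1; ring.
Unshelve. all: by end_near. Qed.

(** On a circle f' jumps by beta f and u' by beta u, and these jumps cancel in u f' - u' f. *)
Lemma continuous_wronskian (r : R) : 0 < r -> {for r, continuous (wronskian f)}.
Proof.
move=> r0; have [|[n rn]] := regular_or_circle d r0.
  by move=> /der_wronskian/der_cont.
have [cf _ _ jump _] := fg.
have [p [q [hp hq pq]]] := jump n; rewrite -rn in hp hq pq.
have rp : right_derivative f r = p by exact: cvg_lim.
have u1r : u1 r = - C1 (d / 2).
  rewrite /u1 /ground_state1 rn (@cell_centerE _ d d0 _ n.+1).
    rewrite -(cell_odd cell); congr C1.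
    by rewrite /circle_radius (mulrS _ n); lra.
  rewrite /circle_radius (mulrS _ n); apply/andP; split.
    by rewrite ler_pM2l //; lra.
  by rewrite ltr_pM2l //; lra.
have ur : u r = C (d / 2) by rewrite rn; exact: (ground_state_circle d0 cell).
have cu := continuous_ground_state d0 cell r0.
apply/left_right_continuousP; split.
  apply: (@cvg_near_eq _ _ _ (fun z => u z * derive1 f z - u1 z * f z)).
    rewrite rn; apply: filterS (near_left_circle d0 n) => x [rx _].
    by rewrite /wronskian right_derivativeE.
  have -> : wronskian f r = u r * q - C1 (d / 2) * f r.
    rewrite /wronskian rp u1r ur.
    have := cell_jump cell; have -> : p = q + beta * f r by lra.
    set A := C1 _; set B := C _ => h.
    rewrite mulrDr (_ : B * (beta * f r) = beta * B * f r); last by ring.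
    by rewrite -h; ring.
  apply: cvgB; apply: cvgM.
  - exact: continuous_left.
  - exact: hq.
  - by rewrite rn; exact: (ground_state1_left d0 cell).
  - by apply: continuous_left; exact: cf.
apply: (@cvg_near_eq _ _ _ (fun z => u z * derive1 f z - u1 z * f z)).
  rewrite rn; apply: filterS (near_right_circle d0 n) => x [rx _].
  by rewrite /wronskian right_derivativeE.
rewrite /wronskian rp; apply: cvgB; apply: cvgM.
- exact: continuous_right.
- exact: hp.
- by rewrite u1r rn; exact: (ground_state1_right d0 cell).
- by apply: continuous_right; exact: cf.
Qed.

End One_component.

End Radial_equation.

(** * Uniqueness for the radial eigenvalue equation *)

Section Radial_uniqueness.
Context {R : realType}.
Variables (d alpha beta : R) (l : int).
Hypotheses (d0 : 0 < d) (alpha0 : 0 < alpha) (alpha1 : alpha < 2^-1).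
Local Notation mu := (@lebesgue_measure R).
Let c := centrifugal alpha l.

Variables (a b ga gb : R -> R) (x y : R).
Hypothesis rad_a : radial_real d alpha beta l a ga.
Hypothesis rad_b : radial_real d alpha beta l b gb.
Hypothesis ga_ae : {ae mu, forall r : R, 0 < r -> ga r = x * a r - y * b r}.
Hypothesis gb_ae : {ae mu, forall r : R, 0 < r -> gb r = x * b r + y * a r}.
Variables (F : R -> R) (K : R).
Hypothesis dF : forall r : R, 0 < r -> has_der F r (a r ^+ 2 + b r ^+ 2).
Hypothesis FK : forall r : R, 0 < r -> 0 <= F r <= K.

Let ca (r : R) : 0 < r -> {for r, continuous a}.
Proof. by have [cf _ _ _ _] := rad_a; exact: cf. Qed.

Let cb (r : R) : 0 < r -> {for r, continuous b}.
Proof. by have [cf _ _ _ _] := rad_b; exact: cf. Qed.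


Let cka (r : R) : 0 < r -> {for r, continuous (fun r => x * a r - y * b r)}.
Proof. by move=> r0; have := ca r0; have := cb r0 => *; cts. Qed.

Let ckb (r : R) : 0 < r -> {for r, continuous (fun r => x * b r + y * a r)}.
Proof. by move=> r0; have := ca r0; have := cb r0 => *; cts. Qed.

Let da := radial_real_der d0 rad_a cka ga_ae.
Let db := radial_real_der d0 rad_b ckb gb_ae.

Let first_cell (r : R) : 0 < r -> r < d / 2 -> regular_radii d r.
Proof.
move=> r0 rd; apply: (@regular_of_cell _ d d0 _ 0) => //.
by apply/andP; split; move: d0; lra.
Qed.

Let nu := `|l%:~R + alpha|.

Let cE : c = nu ^+ 2 - 4^-1.
Proof. by rewrite /c /centrifugal real_normK ?num_real // addrC. Qed.

(** The two channels with nu < 1, where both exponents are square integrable at 0, are exactly those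
    that carry a boundary condition; l = 1 and l = -2 already give 1 + alpha and 2 - alpha. *)
Lemma weak_or_strong : [\/ l = 0 /\ nu = alpha, l = -1 /\ nu = 1 - alpha | 1 < nu].
Proof.
have al0 := alpha0; have al1 := alpha1; rewrite /nu.
case: l => [[|n]|[|n]].
- by apply: Or31; rewrite add0r gtr0_norm.
- apply: Or33; apply: lt_le_trans (ler_norm _).
  by rewrite -pmulrn (mulrS _ n); have := ler0n R n; lra.
- by apply: Or32; rewrite NegzE mulrN1z ler0_norm; [split=> //; lra|lra].
- apply: Or33; rewrite NegzE mulrNz -pmulrn -normrN; apply: lt_le_trans (ler_norm _).
  by rewrite (mulrS _ n.+1) (mulrS _ n); have := ler0n R n; lra.
Qed.

(** The exponent eta is nu for l = 0 and l = -1, and 1 in the other channels. All estimates take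
    place in ]0, d / 2[, which contains no circle. The source term is z f: in L^2 by assumption in
    the strong case, and O(q) by the boundary condition in the weak case. *)
Lemma boundary_at_zero : exists C eta s : R, [/\ 0 <= C, 0 < eta, 0 < s &
  forall r : R, 0 < r -> r < s ->
  [/\ `|a r| <= C * r `^ (2^-1 + eta), `|b r| <= C * r `^ (2^-1 + eta),
      `|derive1 a r| <= C * r `^ (eta - 2^-1) &
      `|derive1 b r| <= C * r `^ (eta - 2^-1)]].
Proof.
have al0 := alpha0; have al1 := alpha1; have d00 := d0.
have nu0 : 0 < nu by have := weak_or_strong; case=> [[_ ->]|[_ ->]|]; lra.
have combine (Ca Cb eta s : R) : 0 <= Ca -> 0 <= Cb -> 0 < eta -> 0 < s ->
    (forall r : R, 0 < r -> r < s / 2 -> `|a r| <= Ca * r `^ (2^-1 + eta) /\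
       `|derive1 a r| <= Ca * r `^ (eta - 2^-1)) ->
    (forall r : R, 0 < r -> r < s / 2 -> `|b r| <= Cb * r `^ (2^-1 + eta) /\
       `|derive1 b r| <= Cb * r `^ (eta - 2^-1)) ->
    exists C eta s : R, [/\ 0 <= C, 0 < eta, 0 < s &
      forall r : R, 0 < r -> r < s ->
      [/\ `|a r| <= C * r `^ (2^-1 + eta), `|b r| <= C * r `^ (2^-1 + eta),
          `|derive1 a r| <= C * r `^ (eta - 2^-1) &
          `|derive1 b r| <= C * r `^ (eta - 2^-1)]].
  move=> Ca0 Cb0 eta0 s0 ha hb; exists (Ca + Cb), eta, (s / 2); split => //.
  - exact: addr_ge0.
  - by rewrite divr_gt0.
  move=> r r0 rs; have [h1 h2] := ha r r0 rs; have [h3 h4] := hb r r0 rs.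
  split; [apply: (le_trans h1)|apply: (le_trans h3)|apply: (le_trans h2)
    |apply: (le_trans h4)]; by rewrite ler_wpM2r ?powR_ge0 // ?lerDl ?lerDr.
have [nu1|nu1] := ltP 1 nu.
  have hs (f f1 g : R -> R) :
      (forall r : R, regular_radii d r -> has_der f r (f1 r) /\
        has_der f1 r (c / r ^+ 2 * f r - g r)) ->
      (forall r : R, f r ^+ 2 <= a r ^+ 2 + b r ^+ 2) ->
      (forall r : R, g r ^+ 2 <= (x ^+ 2 + y ^+ 2) * (a r ^+ 2 + b r ^+ 2)) ->
      exists2 C : R, 0 <= C & forall r : R, 0 < r -> r < d / 2 / 2 ->
        `|f r| <= C * r `^ (2^-1 + 1) /\ `|f1 r| <= C * r `^ (1 - 2^-1).
    move=> hf fD gD.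
    apply: (@strong_singularity_bound R nu (d / 2) nu0 _ nu1 f f1 (fun r => - g r)
      (fun r => a r ^+ 2 + b r ^+ 2) F (x ^+ 2 + y ^+ 2) K).
    - by rewrite divr_gt0.
    - by move=> r r0 rd; have [] := hf r (first_cell r0 rd).
    - by move=> r r0 rd; rewrite -cE; have [] := hf r (first_cell r0 rd).
    - by move=> r r0 rd; exact: dF.
    - by move=> r r0 rd; exact: FK.
    - by [].
    - by move=> r r0 rd; rewrite sqrrN.
  have [Ca Ca0 ha] := hs a (derive1 a) (fun r => x * a r - y * b r) da
    ltac:(by move=> r; rewrite lerDl sqr_ge0)
    ltac:(by move=> r; have := sqr_ge0 (x * b r + y * a r); lra).
  have [Cb Cb0 hb] := hs b (derive1 b) (fun r => x * b r + y * a r) db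
    ltac:(by move=> r; rewrite lerDr sqr_ge0)
    ltac:(by move=> r; have := sqr_ge0 (x * a r - y * b r); lra).
  have d20 : 0 < d / 2 by rewrite divr_gt0.
  exact: (combine Ca Cb 1 (d / 2) Ca0 Cb0 ltr01 d20 ha hb).
have nu1' : nu < 1 by have := weak_or_strong; case=> [[_ ->]|[_ ->]|]; lra.
(* In both singular channels the weight of the boundary condition is r^(nu - 1/2) = 1 / q. *)
have decay (f gf : R -> R) : radial_real d alpha beta l f gf ->
    forall e : R, 0 < e -> exists2 t : R, 0 < t &
    forall r : R, 0 < r -> r < t -> `|f r / r `^ (2^-1 - nu)| <= e.
  move=> [_ _ _ _ [hl0 hl1]] e e0.
  have : (r `^ (nu - 2^-1) * f r) @[r --> 0^'+] --> (0 : R).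
    have := weak_or_strong; case=> [[lE ->]|[lE ->]|]; [exact: hl0|exact: hl1|lra].
  move=> /cvgrPdist_le/(_ e e0); rewrite near_withinE => -[t /= t0 ht].
  exists t => // r r0 rt; rewrite -powRN opprB mulrC.
  by have := ht r; rewrite /= !sub0r !normrN (gtr0_norm r0); exact.
have [ta ta0 hta] := decay a ga rad_a 1 ltr01.
have [tb tb0 htb] := decay b gb rad_b 1 ltr01.
pose s := Num.min (d / 2) (Num.min ta tb).
have s0 : 0 < s by rewrite !lt_min divr_gt0 // ta0.
have [sd [sa sb]] : s <= d / 2 /\ s <= ta /\ s <= tb.
  by split; [|split]; rewrite !ge_min lexx ?orbT.
have q0 (r : R) : 0 < r -> 0 < r `^ (2^-1 - nu) by exact: powR_gt0.
have aq (r : R) : 0 < r -> r < s -> `|a r| <= r `^ (2^-1 - nu).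
  move=> r0 rs; have := hta r r0 (lt_le_trans rs sa).
  by rewrite normrM normfV (gtr0_norm (q0 r r0)) ler_pdivrMr ?q0 // mul1r.
have bq (r : R) : 0 < r -> r < s -> `|b r| <= r `^ (2^-1 - nu).
  move=> r0 rs; have := htb r r0 (lt_le_trans rs sb).
  by rewrite normrM normfV (gtr0_norm (q0 r r0)) ler_pdivrMr ?q0 // mul1r.
have hw (f f1 g gf : R -> R) :
    (forall r : R, regular_radii d r -> has_der f r (f1 r) /\
      has_der f1 r (c / r ^+ 2 * f r - g r)) ->
    radial_real d alpha beta l f gf ->
    (forall r : R, 0 < r -> r < s -> `|g r| <= (`|x| + `|y|) * r `^ (2^-1 - nu)) ->
    exists2 C : R, 0 <= C & forall r : R, 0 < r -> r < s / 2 ->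
      `|f r| <= C * r `^ (2^-1 + nu) /\ `|f1 r| <= C * r `^ (nu - 2^-1).
  move=> hf radf gq.
  apply: (@weak_singularity_bound R nu s nu0 s0 f f1 (fun r => - g r) (`|x| + `|y|) nu1').
  - by move=> r r0 rd; have [] := hf r (first_cell r0 (lt_le_trans rd sd)).
  - by move=> r r0 rd; rewrite -cE; have [] := hf r (first_cell r0 (lt_le_trans rd sd)).
  - by move=> r r0 rd; rewrite normrN; exact: gq.
  - exact: decay radf.
have mul_bound (z w q : R) : `|w| <= q -> `|z * w| <= `|z| * q.
  by move=> wq; rewrite normrM ler_wpM2l.
have [Ca Ca0 ha] := hw a (derive1 a) (fun r => x * a r - y * b r) ga da rad_a
  ltac:(by move=> r r0 rs; rewrite mulrDl; apply: (le_trans (ler_normB _ _));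
    apply: lerD; apply: mul_bound; [exact: aq|exact: bq]).
have [Cb Cb0 hb] := hw b (derive1 b) (fun r => x * b r + y * a r) gb db rad_b
  ltac:(by move=> r r0 rs; rewrite mulrDl; apply: (le_trans (ler_normD _ _));
    apply: lerD; apply: mul_bound; [exact: bq|exact: aq]).
exact: (combine Ca Cb nu s Ca0 Cb0 nu0 s0 ha hb).
Qed.

Variables (E m M : R) (C C1 : R -> R).
Hypothesis cell : cell_function d beta E m M C C1.
Hypotheses (m0 : 0 < m) (hardy : (4^-1 - alpha ^+ 2) * M <= m / 4).
Let u := ground_state d C.
Let u1 := ground_state1 d C1.

(** Since alpha < 1/2, the smallest value of |l + alpha| is alpha, so l = 0 is the worst channel. *)
Lemma centrifugal_hardy : - c * M <= m / 4.
Proof.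
have M0 : 0 <= M.
  have /andP[_] := ground_state_bound d0 cell (@ltr01 R).
  by apply: le_trans; exact: sqr_ge0.
have : - c <= 4^-1 - alpha ^+ 2.
  have nua : alpha ^+ 2 <= nu ^+ 2.
    rewrite lerXn2r ?nnegrE ?normr_ge0 // ?(ltW alpha0) //.
    by have al0 := alpha0; have al1 := alpha1;
      have := weak_or_strong; case=> [[_ ->]|[_ ->]|]; lra.
  by rewrite cE; lra.
by move=> /(ler_wpM2r M0) h; exact: le_trans h hardy.
Qed.

Lemma radial_uniqueness : y != 0 \/ x < E -> forall r : R, 0 < r -> a r = 0 /\ b r = 0.
Proof.
move=> yx.
have u_gt0 (r : R) : 0 < r -> 0 < u r by exact: (ground_state_gt0 d0 cell).
have cu (r : R) : 0 < r -> {for r, continuous u}.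
  exact: (continuous_ground_state d0 cell).
have ub (r : R) : 0 < r -> m <= u r ^+ 2 <= M.
  exact: (ground_state_bound d0 cell).
have [K1 K10 u1K] := ground_state1_bounded d0 cell.
have [Cs [eta [s [C0 eta0 s0 hs]]]] := boundary_at_zero.
have dgf (f f1 : R -> R) (r : R) : regular_radii d r -> has_der f r (f1 r) ->
    has_der (fun z => f z / u z) r ((u r * f1 r - u1 r * f r) / u r ^+ 2).
  move=> rr df; have r0 : 0 < r by case: rr.
  have du := der_ground_state d0 cell rr.
  have ? := derV (lt0r_neq0 (u_gt0 r r0)) du.
  apply: has_der_eq; first by der.
  by rewrite /= -/u -/u1; field; exact/lt0r_neq0/u_gt0.
have cgf (f : R -> R) (r : R) : 0 < r -> {for r, continuous f} ->
    {for r, continuous (fun z => f z / u z)}.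
  move=> r0 cf; have ? := ctsV (lt0r_neq0 (u_gt0 r r0)) (cu r r0).
  by cts.
pose wa := wronskian d C C1 a; pose wb := wronskian d C C1 b.
have reg_gt0 (r : R) : regular_radii d r -> 0 < r by case.
have waE (r : R) : regular_radii d r -> wa r = u r * derive1 a r - u1 r * a r.
  by move=> rr; rewrite /wa /wronskian (right_derivativeE d0 rad_a cka ga_ae rr).
have wbE (r : R) : regular_radii d r -> wb r = u r * derive1 b r - u1 r * b r.
  by move=> rr; rewrite /wb /wronskian (right_derivativeE d0 rad_b ckb gb_ae rr).
pose s1 := Num.min s (d / 2).
have s10 : 0 < s1 by rewrite lt_min s0 divr_gt0.
have s1s (r : R) : 0 < r -> r < s1 -> r < s /\ regular_radii d r.
  move=> r0; rewrite lt_min => /andP[-> rd]; split=> //; exact: first_cell.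
(* Every boundary quantity is O(r^(2 eta)). *)
have small (h : R -> R) (B : R) : 0 <= B ->
    (forall r : R, 0 < r -> r < s1 -> r <= 1 -> `|h r| <= B * r `^ (2 * eta)) ->
    forall e : R, 0 < e -> exists2 t : R, 0 < t &
    forall r : R, 0 < r -> r < t -> `|h r| <= e.
  move=> B0 hB e e0.
  have eta2 : 0 < 2 * eta by rewrite mulr_gt0.
  have eB : 0 < e / (B + 1) by rewrite divr_gt0 // ltr_pwDr.
  have /cvgrPdist_le/(_ _ eB) := powR_cvg0 eta2.
  rewrite near_withinE => -[t /= t0 ht].
  exists (Num.min t (Num.min s1 1)) => [|r r0]; first by rewrite lt_min t0 lt_min s10 /=.
  rewrite lt_min => /andP[rt]; rewrite lt_min => /andP[rs r1].
  apply: (le_trans (hB r r0 rs (ltW r1))).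
  have := ht r; rewrite /= !sub0r !normrN !gtr0_norm ?powR_gt0 // => /(_ rt r0).
  rewrite ler_pdivlMr ?ltr_pwDr // => hE.
  have := powR_ge0 r (2 * eta); lra.
have powE (r : R) : 0 < r ->
    r `^ (2^-1 + eta) * r `^ (eta - 2^-1) = r `^ (2 * eta) /\
    r `^ (2^-1 + eta) * r `^ (2^-1 + eta) = r * r `^ (2 * eta).
  move=> r0; rewrite -!powRDp //; split; first by congr (_ `^ _); lra.
  rewrite -[X in _ = X * _](powRr1 (ltW r0)) -powRDp //; congr (_ `^ _); lra.
have prod_bound (f f1 : R -> R) (r : R) : 0 < r ->
    `|f r| <= Cs * r `^ (2^-1 + eta) -> `|f1 r| <= Cs * r `^ (eta - 2^-1) ->
    `|f r * f1 r| <= Cs ^+ 2 * r `^ (2 * eta).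
  move=> r0 hf hf1; rewrite normrM -(powE r r0).1.
  have -> : Cs ^+ 2 * (r `^ (2^-1 + eta) * r `^ (eta - 2^-1)) =
    (Cs * r `^ (2^-1 + eta)) * (Cs * r `^ (eta - 2^-1)) by ring.
  exact: ler_pM.
have sqr_bound (f : R -> R) (r : R) : 0 < r -> `|f r| <= Cs * r `^ (2^-1 + eta) ->
    f r ^+ 2 <= Cs ^+ 2 * (r * r `^ (2 * eta)).
  move=> r0 hf; rewrite -(powE r r0).2 -(real_normK (num_real (f r))).
  have -> : Cs ^+ 2 * (r `^ (2^-1 + eta) * r `^ (2^-1 + eta)) =
    (Cs * r `^ (2^-1 + eta)) ^+ 2 by ring.
  by rewrite lerXn2r // nnegrE // mulr_ge0 // powR_ge0.
pose u0 := Num.sqrt m; have u00 : 0 < u0 by rewrite sqrtr_gt0.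
have u0u (r : R) : 0 < r -> u0 <= u r.
  move=> r0; have /andP[mu_ _] := ub r r0.
  have -> : u r = Num.sqrt (u r ^+ 2) by rewrite sqrtr_sqr gtr0_norm ?u_gt0.
  exact: ler_wsqrtr.
have comp (f f1 : R -> R) (r : R) : 0 < r -> r <= 1 ->
    `|f r| <= Cs * r `^ (2^-1 + eta) -> `|f1 r| <= Cs * r `^ (eta - 2^-1) ->
    `|f r / u r * (u r * f1 r - u1 r * f r)| <=
    (Cs ^+ 2 + K1 / u0 * Cs ^+ 2) * r `^ (2 * eta).
  move=> r0 r1 hf hf1; have ur := u_gt0 r r0.
  have -> : f r / u r * (u r * f1 r - u1 r * f r) =
      f r * f1 r - u1 r / u r * f r ^+ 2 by field; exact: lt0r_neq0.
  rewrite mulrDl; apply: (le_trans (ler_normB _ _)); apply: lerD.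
    exact: prod_bound.
  rewrite normrM (ger0_norm (sqr_ge0 (f r))) -mulrA; apply: ler_pM => //.
  - exact: sqr_ge0.
  - rewrite normrM normfV (gtr0_norm ur); apply: ler_pM => //.
    + by rewrite invr_ge0 ltW.
    + exact: u1K.
    + by rewrite lef_pV2 ?posrE ?u0u.
  - apply: (le_trans (sqr_bound f r r0 hf)); rewrite ler_wpM2l ?sqr_ge0 //.
    by rewrite ler_piMl // powR_ge0.
have double (X z : R) : X * 2 * z = X * z + X * z by ring.
have H := @no_square_integrable_solution R d u (fun r => a r / u r)
  (fun r => b r / u r) wa wb F c E x y m M K d0 m0 ub.
suff G : forall r : R, 0 < r -> a r / u r = 0 /\ b r / u r = 0.
  move=> r r0; have [/eqP h1 /eqP h2] := G r r0; move: h1 h2.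
  by rewrite !mulf_eq0 invr_eq0 (gt_eqF (u_gt0 r r0)) !orbF => /eqP -> /eqP ->.
apply: H.
- by move=> r r0; apply: cgf => //; exact: ca.
- by move=> r r0; apply: cgf => //; exact: cb.
- by move=> r r0; exact: (continuous_wronskian d0 cell rad_a cka ga_ae).
- by move=> r r0; exact: (continuous_wronskian d0 cell rad_b ckb gb_ae).
- by move=> r r0; exact: der_cont (dF r0).
- by move=> r rr; rewrite waE //; apply: dgf => //; exact: (da rr).1.
- by move=> r rr; rewrite wbE //; apply: dgf => //; exact: (db rr).1.
- move=> r rr; have := u_gt0 r (reg_gt0 r rr).
  move=> ur; apply: (has_der_eq (der_wronskian d0 cell rad_a cka ga_ae rr)).
  by rewrite -/c -/u; field; rewrite !lt0r_neq0 // reg_gt0.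
- move=> r rr; have := u_gt0 r (reg_gt0 r rr).
  move=> ur; apply: (has_der_eq (der_wronskian d0 cell rad_b ckb gb_ae rr)).
  by rewrite -/c -/u; field; rewrite !lt0r_neq0 // reg_gt0.
- move=> r rr; have := u_gt0 r (reg_gt0 r rr) => ur.
  apply: (has_der_eq (dF (reg_gt0 r rr))).
  by rewrite !expr_div_n; field; exact: lt0r_neq0.
- exact: FK.
- exact: centrifugal_hardy.
- apply: (small _ ((Cs ^+ 2 + K1 / u0 * Cs ^+ 2) * 2)) => [|r r0 rs r1].
    have K1u : 0 <= K1 / u0 by rewrite divr_ge0 // ltW.
    by rewrite mulr_ge0 // addr_ge0 ?sqr_ge0 // mulr_ge0 // sqr_ge0.
  have [/hs[//|ha hb ha1 hb1] rr] := s1s r r0 rs.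
  have := comp a (derive1 a) r r0 r1 ha ha1; have := comp b (derive1 b) r r0 r1 hb hb1.
  rewrite waE // wbE // => h1 h2; apply: (le_trans (ler_normD _ _)).
  by rewrite double; exact: lerD.
- apply: (small _ (Cs ^+ 2 * 2)) => [|r r0 rs r1]; first by rewrite mulr_ge0 ?sqr_ge0.
  have [/hs[//|ha hb ha1 hb1] rr] := s1s r r0 rs.
  (* The terms in u' cancel: Q is the Wronskian of the two components of f. *)
  have -> : a r / u r * wb r - b r / u r * wa r = a r * derive1 b r - b r * derive1 a r.
    by rewrite waE // wbE //; field; exact/lt0r_neq0/u_gt0.
  apply: (le_trans (ler_normB _ _)); rewrite double.
  by apply: lerD; exact: prod_bound.
- move=> e e0.
  have [||t t0 ht] := small (fun r => ((a r / u r) ^+ 2 + (b r / u r) ^+ 2) / r)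
      (Cs ^+ 2 / m * 2) _ _ e e0.
  + by rewrite mulr_ge0 // divr_ge0 ?sqr_ge0 // ltW.
  + move=> r r0 rs r1; have [/hs[//|ha hb ha1 hb1] rr] := s1s r r0 rs.
    rewrite ger0_norm; last by rewrite divr_ge0 ?addr_ge0 ?sqr_ge0 // ltW.
    have h (f : R -> R) : `|f r| <= Cs * r `^ (2^-1 + eta) ->
        (f r / u r) ^+ 2 <= Cs ^+ 2 / m * r `^ (2 * eta) * r.
      move=> hf; have := sqr_bound f r r0 hf; have /andP[um _] := ub r r0.
      have u2 := lt_le_trans m0 um.
      rewrite expr_div_n ler_pdivrMr // => h; apply: (le_trans h).
      rewrite [X in _ <= X](_ : _ = Cs ^+ 2 * (r * r `^ (2 * eta)) * (u r ^+ 2 / m)); last first.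
        by field; exact: lt0r_neq0.
      rewrite ler_peMr ?ler_pdivlMr ?mul1r // mulr_ge0 ?sqr_ge0 // mulr_ge0 ?powR_ge0 //.
      exact: ltW.
    by rewrite ler_pdivrMr //; have := h a ha; have := h b hb; lra.
  by exists t => // r r0 rt; apply: le_trans (ht r r0 rt); exact: ler_norm.
- exact: yx.
Qed.

End Radial_uniqueness.

(** * Plane measure and rotations *)

Section Measure_transport.
Context {R : realType}.
Local Notation RT := (measurableTypeR R).
Local Notation mu := (@lebesgue_measure R).

Lemma measure_ocitv_unique (m1 m2 : {measure set RT -> \bar R}) :
  (forall a b : R, a < b -> m1 `]a, b]%classic = m2 `]a, b]%classic) ->
  (forall a b : R, (m1 `]a, b]%classic < +oo)%E) ->
  forall A : set RT, measurable A -> m1 A = m2 A.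
Proof.
move=> m12 fin.
pose g (n : nat) : set RT := `](- n%:R), n%:R]%classic.
have gT : \bigcup_k g k = [set: RT].
  apply/seteqP; split => // x _.
  exists (Num.truncn `|x|).+1 => //; rewrite /g /= in_itv /=.
  have := truncnS_gt `|x|; set n : R := _%:R => h.
  by have := ler_norm x; have := ler_norm (- x); rewrite normrN => h1 h2;
    apply/andP; split; lra.
apply: (measure_unique (@ocitv R : set (set RT)) g) => //.
- exact: ocitvI.
- by move=> n; exact: is_ocitv.
- by move=> A /ocitvP[->|[[a b] /= ab ->]]; [rewrite !measure0|exact: m12].
- by move=> k; exact: fin.
Qed.

Section Pushforward.
Context {dX : measure_display} {X : measurableType dX}.
Variables (m : {measure set X -> \bar R}) (f : X -> RT).
Hypothesis mf : measurable_fun setT f.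

Lemma pushforward_unique (m2 : {measure set RT -> \bar R}) :
  (forall a b : R, a < b -> m (f @^-1` `]a, b]%classic) = m2 `]a, b]%classic) ->
  (forall a b : R, (m2 `]a, b]%classic < +oo)%E) ->
  forall A : set RT, measurable A -> m (f @^-1` A) = m2 A.
Proof.
move=> H fin A mA; apply/esym.
apply: (measure_ocitv_unique (m1 := m2)
  (m2 := measure_function_pushforward__canonical__measure_function_Measure m mf)) => //.
by move=> a b ab; rewrite -(H a b ab).
Qed.

End Pushforward.

Lemma lebesgue_itv_lt (a b : R) : (mu `]a, b]%classic < +oo)%E.
Proof. by rewrite lebesgue_measure_itv /=; case: ifP => _; rewrite ltry. Qed.

Lemma lebesgue_translate (t : R) (A : set RT) : measurable A ->
  mu ((fun x => x + t) @^-1` A) = mu A.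
Proof.
move=> mA; apply: (pushforward_unique (f := fun x : RT => (x + t : RT))) => //.
- exact: measurable_funD.
- move=> a b ab; have -> : (fun x : RT => (x + t : RT)) @^-1` `]a, b]%classic =
      `](a - t), (b - t)]%classic.
    by apply/seteqP; split => x /=; rewrite !in_itv /= => /andP[h1 h2]; lra.
  rewrite /= !lebesgue_measure_itv /= !lte_fin ltrD2r ab -!EFinD.
  by congr (_%:E); ring.
- exact: lebesgue_itv_lt.
Qed.

Lemma lebesgue_dilate (s : R) (A : set RT) : 0 < s -> measurable A ->
  mu ((fun x => s * x) @^-1` A) = (s^-1%:E * mu A)%E.
Proof.
move=> s0 mA.
pose s' : {nonneg R} := NngNum (ltW (etrans (invr_gt0 s) s0)).
have -> : (s^-1%:E * mu A)%E = mscale s' mu A by [].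
apply: (pushforward_unique (f := fun x : RT => (s * x : RT))) => //.
- exact: measurable_funM.
- move=> a b ab; have -> : (fun x : RT => (s * x : RT)) @^-1` `]a, b]%classic =
      `](s^-1 * a), (s^-1 * b)]%classic.
    apply/seteqP; split => x /=; rewrite !in_itv /= => /andP[h1 h2].
      by rewrite ltr_pdivrMl // ler_pdivlMl // h1 h2.
    by move: h1 h2; rewrite ltr_pdivrMl // ler_pdivlMl // => -> ->.
  rewrite /= /mscale /= !lebesgue_measure_itv /= !lte_fin ltr_pM2l ?invr_gt0 // ab.
  by rewrite -!EFinD -EFinM; congr (_%:E); ring.
- move=> a b; rewrite /= /mscale /= lebesgue_measure_itv /=; case: ifP => _.
    by rewrite -EFinD -EFinM ltry.
  by rewrite mule0 ltry.
Qed.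

End Measure_transport.

(** * Shears, dilations, rotations and areas of annuli *)

Section Plane_maps.
Context {R : realType}.
Local Notation RT := (measurableTypeR R).
Local Notation mu := (@lebesgue_measure R).
Local Notation P := (@lebesgue_plane R).

Lemma plane_xsectionE (A : set (RT * RT)) : measurable A ->
  P A = (\int[mu]_x mu (xsection A x))%E.
Proof. by []. Qed.

Lemma plane_ysectionE (A : set (RT * RT)) : measurable A ->
  P A = (\int[mu]_y mu (ysection A y))%E.
Proof.
move=> mA; rewrite /lebesgue_plane.
apply: (@product_measure_unique _ _ RT RT R mu mu (mu \x^ mu)%E _ A mA).
by move=> B C mB mC; rewrite /= product_measure2E.
Qed.

Lemma plane_rectangle (A B : set RT) : measurable A -> measurable B ->
  P (A `*` B) = (mu A * mu B)%E.
Proof. by move=> mA mB; exact: product_measure1E. Qed.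

Lemma measurable_plane_map (f g : RT * RT -> RT) : measurable_fun setT f ->
  measurable_fun setT g -> measurable_fun setT (fun p => (f p, g p) : RT * RT).
Proof. by move=> mf mg; apply/measurable_fun_pairP. Qed.

Lemma measurable_preimage (T : RT * RT -> RT * RT) (A : set (RT * RT)) :
  measurable_fun setT T -> measurable A -> measurable (T @^-1` A).
Proof. by move=> mT mA; rewrite -[X in measurable X]setTI; exact: mT. Qed.

Let m1 : measurable_fun setT (fst : RT * RT -> RT). Proof. exact: measurable_fst. Qed.
Let m2 : measurable_fun setT (snd : RT * RT -> RT). Proof. exact: measurable_snd. Qed.

Lemma measurable_scaled_coord (s : R) (f : RT * RT -> RT) : measurable_fun setT f ->
  measurable_fun setT (fun p => s * f p : RT).
Proof. by move=> mf; apply: measurable_funM => //; exact: measurable_cst. Qed.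

Definition shear_x (t : R) (p : RT * RT) : RT * RT := (p.1 + t * p.2, p.2).
Definition shear_y (t : R) (p : RT * RT) : RT * RT := (p.1, p.2 + t * p.1).
Definition dilate_x (s : R) (p : RT * RT) : RT * RT := (s * p.1, p.2).
Definition dilate_y (s : R) (p : RT * RT) : RT * RT := (p.1, s * p.2).

Lemma measurable_shear_x t : measurable_fun setT (shear_x t).
Proof.
apply: measurable_plane_map => //.
by apply: measurable_funD => //; exact: measurable_scaled_coord.
Qed.

Lemma measurable_shear_y t : measurable_fun setT (shear_y t).
Proof.
apply: measurable_plane_map => //.
by apply: measurable_funD => //; exact: measurable_scaled_coord.
Qed.

Lemma measurable_dilate_x s : measurable_fun setT (dilate_x s).
Proof. by apply: measurable_plane_map => //; exact: measurable_scaled_coord. Qed.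

Lemma measurable_dilate_y s : measurable_fun setT (dilate_y s).
Proof. by apply: measurable_plane_map => //; exact: measurable_scaled_coord. Qed.

(** A shear translates each horizontal section, so Fubini reduces the claim to translation
    invariance on the line. Rotations inherit the invariance by factoring into shears. *)
Lemma plane_shear_x t (A : set (RT * RT)) : measurable A ->
  P (shear_x t @^-1` A) = P A.
Proof.
move=> mA; have mS := measurable_preimage (measurable_shear_x t) mA.
rewrite !plane_ysectionE //; apply: eq_integral => y _.
have -> : ysection (shear_x t @^-1` A) y = (fun x => x + t * y) @^-1` ysection A y.
  by apply/seteqP; split => x; rewrite /preimage /= !ysectionP.
by rewrite lebesgue_translate //; exact: measurable_ysection.
Qed.

Lemma plane_shear_y t (A : set (RT * RT)) : measurable A ->
  P (shear_y t @^-1` A) = P A.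
Proof.
move=> mA; have mS := measurable_preimage (measurable_shear_y t) mA.
rewrite !plane_xsectionE //; apply: eq_integral => x _.
have -> : xsection (shear_y t @^-1` A) x = (fun y => y + t * x) @^-1` xsection A x.
  by apply/seteqP; split => y; rewrite /preimage /= !xsectionP.
by rewrite lebesgue_translate //; exact: measurable_xsection.
Qed.

Lemma plane_dilate_x s (A : set (RT * RT)) : 0 < s -> measurable A ->
  P (dilate_x s @^-1` A) = (s^-1%:E * P A)%E.
Proof.
move=> s0 mA; have mS := measurable_preimage (measurable_dilate_x s) mA.
rewrite !plane_ysectionE // -ge0_integralZl //.
- apply: eq_integral => y _.
  have -> : ysection (dilate_x s @^-1` A) y = (fun x => s * x) @^-1` ysection A y.
    by apply/seteqP; split => x; rewrite /preimage /= !ysectionP.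
  by rewrite lebesgue_dilate //; exact: measurable_ysection.
- exact: (measurable_fun_ysection mu mA).
- by rewrite lee_fin invr_ge0 ltW.
Qed.

Lemma plane_dilate_y s (A : set (RT * RT)) : 0 < s -> measurable A ->
  P (dilate_y s @^-1` A) = (s^-1%:E * P A)%E.
Proof.
move=> s0 mA; have mS := measurable_preimage (measurable_dilate_y s) mA.
rewrite !plane_xsectionE // -ge0_integralZl //.
- apply: eq_integral => x _.
  have -> : xsection (dilate_y s @^-1` A) x = (fun y => s * y) @^-1` xsection A x.
    by apply/seteqP; split => y; rewrite /preimage /= !xsectionP.
  by rewrite lebesgue_dilate //; exact: measurable_xsection.
- exact: (measurable_fun_xsection mu mA).
- by rewrite lee_fin invr_ge0 ltW.
Qed.

Definition rotation (co si : R) (p : RT * RT) : RT * RT :=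
  (co * p.1 - si * p.2, si * p.1 + co * p.2).

(* A rotation by an angle other than pi is a product of three shears. *)
Lemma rotation_shears (co si : R) : co ^+ 2 + si ^+ 2 = 1 -> 1 + co != 0 ->
  rotation co si = shear_x (- si / (1 + co)) \o (shear_y si \o shear_x (- si / (1 + co))).
Proof.
move=> cs c1; apply/funext => -[x y]; rewrite /rotation /shear_x /shear_y /=.
have s2 : si ^+ 2 = (1 - co) * (1 + co) by move: cs; set z := si ^+ 2; lra.
congr (_, _).
  apply: (mulIf c1); rewrite [RHS](_ : _ = x * (1 + co - si ^+ 2)
    - si * y * (2 - si ^+ 2 / (1 + co))); last by field.
  by rewrite s2; field.
apply: (mulIf c1); rewrite [RHS](_ : _ = y * (1 + co - si ^+ 2) + si * x * (1 + co));
  last by field.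
by rewrite s2; ring.
Qed.

Lemma measurable_rotation co si : measurable_fun setT (rotation co si).
Proof.
apply: measurable_plane_map.
  by apply: measurable_funB; exact: measurable_scaled_coord.
by apply: measurable_funD; exact: measurable_scaled_coord.
Qed.

Lemma plane_rotation (co si : R) (A : set (RT * RT)) : co ^+ 2 + si ^+ 2 = 1 ->
  1 + co != 0 -> measurable A -> P (rotation co si @^-1` A) = P A.
Proof.
move=> cs c1 mA; rewrite rotation_shears // comp_preimage comp_preimage.
have mA1 := measurable_preimage (measurable_shear_x (- si / (1 + co))) mA.
rewrite plane_shear_x ?plane_shear_y ?plane_shear_x //.
exact: measurable_preimage (measurable_shear_y si) mA1.
Qed.

Definition plane_radius (p : RT * RT) : R := Num.sqrt (p.1 ^+ 2 + p.2 ^+ 2).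

Lemma measurable_plane_radius : measurable_fun setT (plane_radius : RT * RT -> RT).
Proof.
apply: (@measurableT_comp _ _ _ _ _ _ (@Num.sqrt R : RT -> RT)).
  by apply: continuous_measurable_fun; exact: sqrt_continuous.
by apply: measurable_funD; exact: measurable_funX.
Qed.

Lemma plane_radius_rotation co si p : co ^+ 2 + si ^+ 2 = 1 -> plane_radius (rotation co si p) = plane_radius p.
Proof.
move=> cs; rewrite /plane_radius /rotation /=; congr Num.sqrt.
rewrite [LHS](_ : _ = (co ^+ 2 + si ^+ 2) * (p.1 ^+ 2 + p.2 ^+ 2)); last by ring.
by rewrite cs mul1r.
Qed.

(** The number pi, kept as an abstract positive constant: it is a common factor of the two norm
    estimates compared in the Weyl argument. *)
Definition unit_disc_area : R := fine (P [set p | (plane_radius p <= 1)%R]).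

Let mdisc (s : R) : measurable [set p : RT * RT | plane_radius p <= s].
Proof.
rewrite (_ : [set p | _] = plane_radius @^-1` `]-oo, s]%classic).
  by rewrite -[X in measurable X]setTI; apply: (measurable_plane_radius measurableT).
by apply/seteqP; split => p; rewrite /preimage /= in_itv.
Qed.

Lemma coord_le_plane_radius (p : R * R) : `|p.1| <= plane_radius p /\ `|p.2| <= plane_radius p.
Proof.
by split; rewrite -sqrtr_sqr; apply: ler_wsqrtr; rewrite ?lerDl ?lerDr sqr_ge0.
Qed.

Lemma unit_disc_area_fin : P [set p | (plane_radius p <= 1)%R] = unit_disc_area%:E /\ 0 < unit_disc_area.
Proof.
have fin : (P [set p | (plane_radius p <= 1)%R] < +oo)%E.
  apply: (@le_lt_trans _ _ (P (`[(-1 : R), 1]%classic `*` `[(-1 : R), 1]%classic))).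
    apply: le_measure; rewrite ?inE //; first exact: measurableX.
    move=> p /= rp; have [h1 h2] := coord_le_plane_radius p.
    by split; rewrite /= in_itv /= -ler_norml; [exact: le_trans h1 rp|exact: le_trans h2 rp].
  rewrite plane_rectangle //= !lebesgue_measure_itv /= -EFinD.
  by case: ifP => _; rewrite -?EFinM ?mule0 ?mul0e ltry.
have finE : P [set p | (plane_radius p <= 1)%R] \is a fin_num by rewrite ge0_fin_numE.
split; first by rewrite /unit_disc_area fineK.
rewrite -lte_fin fineK //.
apply: (@lt_le_trans _ _ (P (`]0 : R, 2^-1]%classic `*` `]0 : R, 2^-1]%classic))).
  rewrite plane_rectangle //= !lebesgue_measure_itv /= lte_fin.
  by rewrite invr_gt0 ltr0n /= -EFinD -EFinM lte_fin subr0 mulr_gt0 // invr_gt0.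
apply: le_measure; rewrite ?inE //; first exact: measurableX.
move=> [x y] /= [/=]; rewrite !in_itv /= => /andP[x0 x1] /andP[y0 y1].
by rewrite /plane_radius -[leRHS]sqrtr1; apply: ler_wsqrtr => /=; nra.
Qed.

(** Dilating both coordinates gives the square of a positive radius. For s <= 0 the set is empty or
    the origin, and it lies in arbitrarily small discs. *)
Lemma disc_area (s : R) : P [set p | (plane_radius p <= s)%R] = (unit_disc_area * Num.max 0 s ^+ 2)%:E.
Proof.
have pos (r : R) : 0 < r -> P [set p | (plane_radius p <= r)%R] = (unit_disc_area * r ^+ 2)%:E.
  move=> r0; have -> : [set p | (plane_radius p <= r)%R] =
      dilate_x r^-1 @^-1` (dilate_y r^-1 @^-1` [set p | (plane_radius p <= 1)%R]).
    apply/seteqP; split => -[x y]; rewrite /preimage /dilate_x /dilate_y /plane_radius /=;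
      rewrite !exprMn -mulrDr sqrtrM ?sqr_ge0 // sqrtr_sqr gtr0_norm ?invr_gt0 //;
      by rewrite ler_pdivrMl // mulr1.
  have mD := measurable_preimage (measurable_dilate_y r^-1) (mdisc 1).
  rewrite plane_dilate_x ?invr_gt0 // plane_dilate_y ?invr_gt0 //.
  by rewrite unit_disc_area_fin.1 invrK -!EFinM; congr (_%:E); ring.
have [|s0] := ltP 0 s; first exact: pos.
rewrite expr0n /= mulr0; apply/eqP; rewrite eq_le measure_ge0 andbT.
apply/lee_addgt0Pr => e e0; rewrite add0e.
have A0 := unit_disc_area_fin.2; pose r := Num.min 1 (e / unit_disc_area).
have r0 : 0 < r by rewrite lt_min ltr01 divr_gt0.
apply: (le_trans (y := P [set p | (plane_radius p <= r)%R])).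
  apply: le_measure; rewrite ?inE //.
  by move=> p /= /le_trans; apply; rewrite (le_trans s0) // ltW.
rewrite pos // lee_fin mulrC -ler_pdivlMr //; apply: (le_trans (y := r)).
  have r1 : r <= 1 by rewrite ge_min lexx.
  by rewrite expr2; apply: ler_piMl => //; exact: ltW.
by rewrite ge_min lexx orbT.
Qed.

Lemma annulus_area (a b : R) : a <= b -> P (plane_radius @^-1` `]a, b]%classic) =
  (unit_disc_area * (Num.max 0 b ^+ 2 - Num.max 0 a ^+ 2))%:E.
Proof.
move=> ab; have -> : plane_radius @^-1` `]a, b]%classic =
    [set p | (plane_radius p <= b)%R] `\` [set p | (plane_radius p <= a)%R].
  apply/seteqP; split => p; rewrite /preimage /= in_itv /=.
    by move=> /andP[h1 h2]; split => //; apply/negP; rewrite -ltNge.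
  by move=> [h1 /negP]; rewrite -ltNge => h2; rewrite h1 h2.
have sub : [set p : RT * RT | (plane_radius p <= a)%R] `<=` [set p | (plane_radius p <= b)%R].
  by move=> p /= /le_trans; exact.
have bfin : (P [set p | (plane_radius p <= b)%R] < +oo)%E.
  by move: (disc_area b) => ->; exact: ltry.
have E : (P ([set p | (plane_radius p <= b)%R] `\` [set p | (plane_radius p <= a)%R]) =
    P [set p | (plane_radius p <= b)%R] - P [set p | (plane_radius p <= a)%R])%E.
  by have := measureD (mdisc b) (mdisc a) bfin; rewrite setIidr.
by apply: (etrans E); rewrite !disc_area -EFinB -mulrBr.
Qed.

End Plane_maps.

Section Positive_part.
Context {R : realType}.

(** The exponent is at least 2, which flattens the corner at 0. The square serves for the area of a
    disc, the cube for the cutoff of the quasimode. *)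
Lemma der_pospart (n : nat) (x : R) :
  has_der (fun z => Num.max 0 z ^+ n.+2) x (n.+2%:R * Num.max 0 x ^+ n.+1).
Proof.
have [x0|x0|<-] := ltrgtP 0 x.
- apply: (der_near (f := fun z => z ^+ n.+2)).
    near=> z; have z0 : 0 < z by near: z; exact: lt_nbhsr.
    by rewrite max_r // ltW.
  by apply: (has_der_eq (derX n.+1 (der_id x))); rewrite mulr1.
- apply: (der_near (f := fun=> 0)).
    near=> z; have z0 : z < 0 by near: z; exact: lt_nbhsl.
    by rewrite max_l ?expr0n // ltW.
  by rewrite expr0n mulr0; exact: der_cst.
rewrite expr0n mulr0; apply/has_der_epsP => e e0.
exists (Num.min 1 e) => [|z]; first by rewrite lt_min ltr01.
rewrite !subr0 lt_min => /andP[z1 ze]; rewrite mul0r subr0 maxxx expr0n subr0.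
have mz : 0 <= Num.max 0 z <= `|z| by rewrite le_max lexx ge_max normr_ge0 ler_norm.
have /andP[m0 m1] := mz.
rewrite ger0_norm ?exprn_ge0 // exprS exprS mulrA.
apply: (@le_trans _ _ (e * `|z| * 1)); last by rewrite mulr1.
apply: ler_pM; rewrite ?mulr_ge0 ?exprn_ge0 //.
- by apply: ler_pM => //; apply: le_trans m1 (ltW ze).
- by rewrite exprn_ile1 // (le_trans m1) // ltW.
Unshelve. all: by end_near. Qed.

End Positive_part.

(** * Integration in polar coordinates *)

Section Radial_density.
Context {R : realType}.
Local Notation RT := (measurableTypeR R).
Local Notation mu := (@lebesgue_measure R).
Local Notation P := (@lebesgue_plane R).
Let k := @unit_disc_area R.
Let k0 : 0 < k. Proof. exact: unit_disc_area_fin.2. Qed.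

(** The derivative of the area of the disc of radius x, that is 2 pi x for x > 0. *)
Definition radial_density (x : R) : R := 2 * unit_disc_area * Num.max 0 x.

Lemma radial_density_ge0 x : 0 <= radial_density x.
Proof. by rewrite mulr_ge0 ?le_max ?lexx // mulr_ge0 // ltW. Qed.

Lemma continuous_radial_density : continuous radial_density.
Proof.
move=> x; apply: (@ctsM _ (fun=> 2 * unit_disc_area) (Num.max 0)); first exact: cts_cst.
by apply: (@continuous_max _ _ (fun=> 0) (fun z => z)); [exact: cts_cst|exact: cts_id].
Qed.

Lemma measurable_radial_density (D : set RT) :  measurable_fun D (EFin \o radial_density).
Proof.
apply: measurable_funTS; apply/measurable_EFinP.
by apply: continuous_measurable_fun; exact: continuous_radial_density.
Qed.

Definition radial_measure (B : set RT) : \bar R :=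
  (\int[mu]_(x in B) (radial_density x)%:E)%E.

Let radial_measure0 : radial_measure set0 = 0%E.
Proof. by rewrite /radial_measure integral_set0. Qed.

Let radial_measure_ge0 B : (0 <= radial_measure B)%E.
Proof. by apply: integral_ge0 => x _; rewrite lee_fin radial_density_ge0. Qed.

Let radial_measure_sigma_additive : semi_sigma_additive radial_measure.
Proof.
move=> /= F mF tF mUF; rewrite /radial_measure; apply: cvg_toP.
  apply: ereal_nondecreasing_is_cvgn => m n mn.
  apply: lee_sum_nneg_natr => // i _ _.
  by apply: integral_ge0 => /= x _; rewrite lee_fin radial_density_ge0.
rewrite ge0_integral_bigcup //=.
- exact: measurable_radial_density.
- by move=> x _; rewrite lee_fin radial_density_ge0.
Qed.

HB.instance Definition _ := isMeasure.Build _ _ _ radial_measure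
  radial_measure0 radial_measure_ge0 radial_measure_sigma_additive.

Lemma radial_measure_itv (a b : R) : a < b -> radial_measure `]a, b]%classic =
  (unit_disc_area * (Num.max 0 b ^+ 2 - Num.max 0 a ^+ 2))%:E.
Proof.
move=> ab; pose F x := k * Num.max 0 x ^+ 2.
have dF x : has_der F x (radial_density x).
  have := der_pospart 0 x => ?.
  by apply: has_der_eq; first (by rewrite /F; der); rewrite /= /radial_density -/k; ring.
have cF x : {for x, continuous F} by exact: der_cont (dF x).
rewrite /radial_measure integral_itv_obnd_cbnd; last exact: measurable_radial_density.
rewrite (@continuous_FTC2 R radial_density F a b ab).
- by rewrite -EFinB /F mulrBr.
- by apply: continuous_subspaceT; exact: continuous_radial_density.
- split.
  + by move=> x _; case: (dF x).
  + exact: continuous_right.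
  + exact: continuous_left.
- by move=> x _; rewrite derive1E; case: (dF x).
Qed.

(** Both sides are measures in [B], so half-open intervals suffice; there the left side is the area
    of an annulus, the right side the integral of its density. *)
Lemma radial_pushforward (B : set RT) : measurable B ->
  P (plane_radius @^-1` B) = radial_measure B.
Proof.
move=> mB; pose m2 : {measure set RT -> \bar R} := radial_measure.
apply: (pushforward_unique (@measurable_plane_radius R) (m2 := m2)) => //.
- move=> a b ab; rewrite /= radial_measure_itv //.
  by apply: (etrans (annulus_area (ltW ab))).
- move=> a b; rewrite /=; have [ab|ba] := ltP a b.
    by rewrite radial_measure_itv // ltry.
  by rewrite set_itv_ge ?bnd_simp -?leNgt // radial_measure0 ltry.
Qed.

(** The density is positive on ]0, +oo[, so a plane null set that depends only on the radius comes
    from a null set of radii. *)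
Lemma radial_null (N : set RT) : measurable N -> P (plane_radius @^-1` N) = 0%E ->
  mu.-negligible (N `&` `]0, +oo[%classic).
Proof.
move=> mN; rewrite radial_pushforward // /radial_measure => h.
have /(ae_eq_integral_abs mu mN (@measurable_radial_density N)).1 :
    (\int[mu]_(x in N) `|(EFin \o radial_density) x| = 0)%E.
  by rewrite -h; apply: eq_integral => x _; rewrite gee0_abs // lee_fin radial_density_ge0.
apply: negligibleS => x /= [Nx]; rewrite in_itv /= andbT => x0 /(_ Nx)[] /eqP.
rewrite /radial_density max_r ?ltW // !mulf_eq0 pnatr_eq0 /=.
by rewrite (gt_eqF x0) (gt_eqF k0).
Qed.

End Radial_density.

(** * Complex square norms and angular modes *)

Section Complex_squared_modulus.
Local Open Scope complex_scope.
Context {R : realType}.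
Implicit Types z w : R[i].

Definition sqr_mod z : R := complex.Re z ^+ 2 + complex.Im z ^+ 2.

Lemma sqr_mod_ge0 z : 0 <= sqr_mod z.
Proof. by rewrite addr_ge0 ?sqr_ge0. Qed.

Lemma sqr_modM z w : sqr_mod (z * w) = sqr_mod z * sqr_mod w.
Proof. by case: z => a b; case: w => c d; rewrite /sqr_mod /=; ring. Qed.

Lemma sqr_mod1 : sqr_mod 1 = 1.
Proof. by rewrite /sqr_mod /= expr1n expr0n addr0. Qed.

Lemma sqr_mod_eq0 z : (sqr_mod z == 0) = (z == 0).
Proof.
case: z => a b; rewrite /sqr_mod /= paddr_eq0 ?sqr_ge0 // !sqrf_eq0.
by rewrite eq_complex.
Qed.

Lemma sqr_modX z n : sqr_mod (z ^+ n) = sqr_mod z ^+ n.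
Proof. by elim: n => [|n IH]; rewrite ?expr0 ?sqr_mod1 // !exprS sqr_modM IH. Qed.

Lemma sqr_modV z : sqr_mod z^-1 = (sqr_mod z)^-1.
Proof.
have [->|z0] := eqVneq z 0; first by rewrite invr0 /sqr_mod /= expr0n addr0 invr0.
apply: (mulIf (x := sqr_mod z)); first by rewrite sqr_mod_eq0.
by rewrite -sqr_modM mulVf // sqr_mod1 mulVf // sqr_mod_eq0.
Qed.

Lemma sqr_modN z : sqr_mod (- z) = sqr_mod z.
Proof. by case: z => a b; rewrite /sqr_mod /= !sqrrN. Qed.

Lemma sqr_modD_le z w : sqr_mod (z + w) <= 2 * sqr_mod z + 2 * sqr_mod w.
Proof.
case: z => a b; case: w => c d; rewrite /sqr_mod /=.
by have := sqr_ge0 (a - c); have := sqr_ge0 (b - d); lra.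
Qed.

Lemma Re_sum (I : Type) (r : seq I) (F : I -> R[i]) :
  complex.Re (\sum_(i <- r) F i) = \sum_(i <- r) complex.Re (F i).
Proof. by apply: big_morph => // -[a b] [c d]. Qed.

Lemma Im_sum (I : Type) (r : seq I) (F : I -> R[i]) :
  complex.Im (\sum_(i <- r) F i) = \sum_(i <- r) complex.Im (F i).
Proof. by apply: big_morph => // -[a b] [c d]. Qed.

Lemma sqr_sum_le (n : nat) (a : 'I_n -> R) :
  (\sum_(i < n) a i) ^+ 2 <= n%:R * \sum_(i < n) a i ^+ 2.
Proof.
pose S := \sum_(i < n) a i ^+ 2.
have e1 : \sum_(i < n) \sum_(j < n) a i ^+ 2 / 2 = n%:R * (S / 2).
  under eq_bigr do rewrite sumr_const card_ord -[_ *+ n]mulr_natl.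
  by rewrite -mulr_sumr -mulr_suml.
have e2 : \sum_(i < n) \sum_(j < n) a j ^+ 2 / 2 = n%:R * (S / 2).
  by rewrite sumr_const card_ord -[_ *+ n]mulr_natl -mulr_suml.
have -> : n%:R * S = n%:R * (S / 2) + n%:R * (S / 2) by field.
rewrite -{1}e1 -e2 -big_split expr2 big_distrl /=.
apply: ler_sum => i _; rewrite -big_split big_distrr /=; apply: ler_sum => j _.
by have := sqr_ge0 (a i - a j); lra.
Qed.

Lemma sqr_mod_sum_le (n : nat) (a : 'I_n -> R[i]) :
  sqr_mod (\sum_(i < n) a i) <= n%:R * \sum_(i < n) sqr_mod (a i).
Proof.
rewrite /sqr_mod Re_sum Im_sum big_split /= mulrDr.
by apply: lerD; exact: sqr_sum_le.
Qed.

Definition cis (t : R) : R[i] := cos t +i* sin t.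

Lemma cisD s t : cis (s + t) = cis s * cis t.
Proof. by rewrite /cis cosD sinD; apply/eqP; rewrite eq_complex /=; apply/andP; split; apply/eqP; ring. Qed.

Lemma cisX t n : cis t ^+ n = cis (t *+ n).
Proof.
elim: n => [|n IH]; last by rewrite exprS IH mulrS cisD.
by rewrite expr0 mulr0n /cis cos0 sin0.
Qed.

(** With x = pi n / M in ]0, pi[, the real part of the power is cos (2 x) = 1 - 2 (sin x)^2 < 1. *)
Lemma cis_neq1 (n M : nat) : (0 < n)%N -> (n < M)%N -> cis (2 * pi / M%:R) ^+ n != 1.
Proof.
move=> n0 nM; have M0 : 0 < M%:R :> R by rewrite ltr0n (ltn_trans n0).
pose x : R := pi * n%:R / M%:R.
have x0 : 0 < x by rewrite divr_gt0 // mulr_gt0 ?pi_gt0 // ltr0n.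
have xpi : x < pi.
  by rewrite /x ltr_pdivrMr // ltr_pM2l ?pi_gt0 // ltr_nat.
have xE : (2 * pi / M%:R) *+ n = x *+ 2.
  by rewrite -[_ *+ n]mulr_natr [x *+ 2]mulr2n /x; set m : R := n%:R; ring.
rewrite cisX xE; apply/eqP => -[+ _]; rewrite cos_mulr2n cos2sin2.
have := sin_gt0_pi (x := x); rewrite x0 xpi => /(_ isT) s0.
by have := exprn_gt0 2 s0; set w := sin x ^+ 2; rewrite mulr2n; lra.
Qed.

Lemma cis_unity (M : nat) : (0 < M)%N -> cis (2 * pi / M%:R) ^+ M = 1.
Proof.
move=> M0; rewrite cisX -[_ *+ M]mulr_natr divfK; last by rewrite pnatr_eq0 -lt0n.
by rewrite mulr_natl /cis cos2pi sin2pi.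
Qed.

End Complex_squared_modulus.

Section Complex_measurability.
Local Open Scope complex_scope.
Context {R : realType} {d : measure_display} {T : measurableType d}.
Implicit Types (f g : T -> R[i]) (D : set T).

Definition cmeasurable D f := measurable_fun D (fun x => complex.Re (f x)) /\
  measurable_fun D (fun x => complex.Im (f x)).

Lemma cmeasurableD D f g : cmeasurable D f -> cmeasurable D g ->
  cmeasurable D (fun x => f x + g x).
Proof.
move=> [f1 f2] [g1 g2]; split.
  rewrite (_ : (fun x => _) = fun x => complex.Re (f x) + complex.Re (g x)).
    exact: measurable_funD.
  by apply/funext => x; case: (f x); case: (g x).
rewrite (_ : (fun x => _) = fun x => complex.Im (f x) + complex.Im (g x)).
  exact: measurable_funD.
by apply/funext => x; case: (f x); case: (g x).
Qed.

Lemma cmeasurableM D f g : cmeasurable D f -> cmeasurable D g ->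
  cmeasurable D (fun x => f x * g x).
Proof.
move=> [f1 f2] [g1 g2]; split.
  rewrite (_ : (fun x => _) = fun x => complex.Re (f x) * complex.Re (g x) -
      complex.Im (f x) * complex.Im (g x)).
    by apply: measurable_funB; exact: measurable_funM.
  by apply/funext => x; case: (f x); case: (g x).
rewrite (_ : (fun x => _) = fun x => complex.Re (f x) * complex.Im (g x) +
    complex.Im (f x) * complex.Re (g x)).
  by apply: measurable_funD; exact: measurable_funM.
by apply/funext => x; case: (f x) => a b; case: (g x) => a' b'.
Qed.

Lemma cmeasurable_cst D z : cmeasurable D (fun=> z).
Proof. by split; exact: measurable_cst. Qed.

Lemma cmeasurableN D f : cmeasurable D f -> cmeasurable D (fun x => - f x).
Proof.
move=> mf; rewrite (_ : (fun x => _) = fun x => (-1) * f x).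
  by apply: cmeasurableM => //; exact: cmeasurable_cst.
by apply/funext => x; rewrite mulN1r.
Qed.

Lemma cmeasurableX D f n : cmeasurable D f -> cmeasurable D (fun x => f x ^+ n).
Proof.
move=> mf; elim: n => [|n IH]; first exact: cmeasurable_cst.
rewrite (_ : (fun x => _) = fun x => f x * f x ^+ n); first exact: cmeasurableM.
by apply/funext => x; rewrite exprS.
Qed.

Lemma cmeasurable_sum D (n : nat) (F : 'I_n -> T -> R[i]) :
  (forall i, cmeasurable D (F i)) -> cmeasurable D (fun x => \sum_(i < n) F i x).
Proof.
elim: n F => [|n IH] F mF.
  rewrite (_ : (fun x => _) = fun=> 0); first exact: cmeasurable_cst.
  by apply/funext => x; rewrite big_ord0.
rewrite (_ : (fun x => _) = fun x => F ord0 x + \sum_(i < n) F (lift ord0 i) x).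
  by apply: cmeasurableD => //; exact: IH.
by apply/funext => x; rewrite big_ord_recl.
Qed.

Lemma measurable_sqr_mod D f : cmeasurable D f -> measurable_fun D (fun x => sqr_mod (f x)).
Proof. by move=> [f1 f2]; apply: measurable_funD; exact: measurable_funX. Qed.

Lemma measurable_sqr_modE D f : cmeasurable D f ->
  measurable_fun D (fun x => (sqr_mod (f x))%:E).
Proof. by move=> mf; apply/measurable_EFinP; exact: measurable_sqr_mod. Qed.

Lemma sqnormE (m : {measure set T -> \bar R}) D f :
  sqnorm m D f = (\int[m]_(x in D) (sqr_mod (f x))%:E)%E.
Proof. by apply: eq_integral => x _; rewrite sqr_normcE. Qed.

End Complex_measurability.

(** * Modulus and measurability of the angular modes *)

Section Angular_modes.
Local Open Scope complex_scope.
Context {R : realType}.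
Local Notation RT := (measurableTypeR R).
Local Notation mu := (@lebesgue_measure R).
Local Notation P := (@lebesgue_plane R).
Implicit Types (h : R -> R[i]) (l : int).

Lemma angular_modeE l h (p : R * R) : angular_mode l h p =
  ((Num.sqrt (2 * pi))^-1 * (Num.sqrt (plane_radius p))^-1)%:C * h (plane_radius p) *
  ((p.1 +i* p.2) / (plane_radius p)%:C) ^ l.
Proof. by []. Qed.

Lemma plane_radius_ge0 (p : R * R) : 0 <= plane_radius p.
Proof. exact: sqrtr_ge0. Qed.

Lemma plane_radius_gt0 (p : R * R) : plane_radius p != 0 -> 0 < plane_radius p.
Proof. by move=> p0; rewrite lt_neqAle eq_sym p0 plane_radius_ge0. Qed.

Lemma angular_mode0 l h p : plane_radius p = 0 -> angular_mode l h p = 0.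
Proof. by move=> p0; rewrite angular_modeE p0 sqrtr0 invr0 mulr0 !mul0r. Qed.

Lemma eq_angular_mode l h h' : (forall r : R, 0 < r -> h r = h' r) ->
  angular_mode l h = angular_mode l h'.
Proof.
move=> hh'; apply/funext => p; have [p0|/plane_radius_gt0 p0] := eqVneq (plane_radius p) 0.
  by rewrite !angular_mode0.
by rewrite !angular_modeE hh'.
Qed.

Lemma angular_modeB l h h' p z : angular_mode l h p - z * angular_mode l h' p =
  angular_mode l (fun r => h r - z * h' r) p.
Proof. by rewrite !angular_modeE; ring. Qed.

Let unit_vector (p : R * R) : R[i] := (p.1 +i* p.2) / (plane_radius p)%:C.

Lemma sqr_mod_unit_vector p : plane_radius p != 0 -> sqr_mod (unit_vector p) = 1.
Proof.
move=> p0; rewrite /unit_vector sqr_modM sqr_modV {1 2}/sqr_mod /= expr0n addr0.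
have -> : p.1 ^+ 2 + p.2 ^+ 2 = plane_radius p ^+ 2.
  by rewrite sqr_sqrtr // addr_ge0 ?sqr_ge0.
by rewrite mulfV // expf_neq0.
Qed.

Lemma sqr_mod_exprz (z : R[i]) l : sqr_mod z = 1 -> sqr_mod (z ^ l) = 1.
Proof.
move=> z1; case: l => n; first by rewrite -exprnP sqr_modX z1 expr1n.
by rewrite NegzE -exprnN sqr_modV sqr_modX z1 expr1n invr1.
Qed.

Lemma sqr_mod_angular_mode l h p : plane_radius p != 0 ->
  sqr_mod (angular_mode l h p) =
  (2 * pi * plane_radius p)^-1 * sqr_mod (h (plane_radius p)).
Proof.
move=> p0; rewrite angular_modeE 2!sqr_modM sqr_mod_exprz ?mulr1; last first.
  exact: sqr_mod_unit_vector.
congr (_ * _); rewrite {1}/sqr_mod /= expr0n addr0 exprMn !exprVn !sqr_sqrtr.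
- by rewrite [RHS]invfM.
- exact: plane_radius_ge0.
- by rewrite mulr_ge0 // pi_ge0.
Qed.

Lemma cmeasurable_angular_mode l h : cmeasurable (`]0, +oo[%classic : set RT) h ->
  cmeasurable setT (angular_mode l h : RT * RT -> R[i]).
Proof.
move=> [mRe mIm].
(* [h] is measurable only on ]0, +oo[. Extending it by 0 leaves the mode unchanged, since the mode
   vanishes at the origin, where the inverse of 0 is 0. *)
pose h' r := if 0 < r then h r else 0.
rewrite (@eq_angular_mode l h h'); last by move=> r r0; rewrite /h' r0.
have mh' (g : R[i] -> R) : g 0 = 0 -> measurable_fun (`]0, +oo[%classic : set RT) (g \o h) ->
    measurable_fun (setT : set RT) (fun r => g (h' r)).
  move=> g0 mg; rewrite (_ : (fun r => _) = (g \o h) \_ `]0, +oo[%classic).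
    by apply/(measurable_restrictT _ _).1 => //.
  apply/funext => r; rewrite patchE /h' mem_setE in_itv /= andbT.
  by rewrite /=; case: ifP => // _; rewrite g0.
have mr := @measurable_plane_radius R.
have inv_meas (f : RT * RT -> RT) : (forall p, 0 <= f p) -> measurable_fun setT f ->
    measurable_fun setT (fun p => (f p)^-1 : RT).
  move=> f0 mf; rewrite (_ : (fun p => _) = fun p => f p `^ (-1)).
    by apply: (measurableT_comp (f := fun x : RT => x `^ (-1) : RT)) => //;
      exact: measurable_powR.
  by apply/funext => p; rewrite powR_inv1.
have cr (f : RT * RT -> RT) : measurable_fun setT f ->
    cmeasurable setT (fun p => (f p)%:C : R[i]).
  by move=> mf; split => //; exact: measurable_cst.
have mu_ : cmeasurable setT (unit_vector : RT * RT -> R[i]).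
  apply: cmeasurableM.
    by split; [exact: measurable_fst|exact: measurable_snd].
  rewrite (_ : (fun p => _) = fun p => ((plane_radius p)^-1)%:C).
    by apply: cr; apply: inv_meas => //; exact: plane_radius_ge0.
  by apply/funext => p; rewrite -fmorphV.
have mpow : cmeasurable setT (fun p : RT * RT => unit_vector p ^ l).
  case: l => n; first exact: cmeasurableX.
  (* The inverse of a unit vector is its conjugate; at the origin both are 0 by convention. *)
  rewrite (_ : (fun p => _) = fun p => (complex.Re (unit_vector p) +i* (- complex.Im (unit_vector p))) ^+ n.+1).
    apply: cmeasurableX; split; first exact: mu_.1.
    by apply: (measurableT_comp (f := fun x : RT => - x : RT)) mu_.2; exact: oppr_measurable.
  apply/funext => p; rewrite NegzE -exprnN -exprVn; congr (_ ^+ _).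
  have [p0|p0] := eqVneq (plane_radius p) 0.
    rewrite /unit_vector p0 rmorph0 invr0 mulr0 invr0.
    by apply/eqP; rewrite eq_complex /= oppr0 !eqxx.
  have z1 := sqr_mod_unit_vector p0; set z := unit_vector p in z1 *.
  have z0 : z != 0 by rewrite -sqr_mod_eq0 z1 oner_eq0.
  apply: (mulfI z0); rewrite mulfV //; move: z1; case: (z) => x y.
  rewrite /sqr_mod /= => z1; apply/eqP; rewrite eq_complex /=.
  by apply/andP; split; apply/eqP; lra.
apply: cmeasurableM => //; apply: cmeasurableM.
  apply: cr; apply: measurable_funM; first exact: measurable_cst.
  apply: inv_meas; first by move=> p; exact: sqrtr_ge0.
  apply: (@measurableT_comp _ _ _ _ _ _ (@Num.sqrt R : RT -> RT)) => //.
  by apply: continuous_measurable_fun; exact: sqrt_continuous.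
by split; [apply: (measurableT_comp (mh' (@complex.Re R) erefl mRe) mr)
          |apply: (measurableT_comp (mh' (@complex.Im R) erefl mIm) mr)].
Qed.

End Angular_modes.

(** * Extraction of one angular mode by rotations *)

Section Orthogonality.
Local Open Scope complex_scope.
Context {R : realType}.
Local Notation RT := (measurableTypeR R).
Local Notation mu := (@lebesgue_measure R).
Local Notation P := (@lebesgue_plane R).
Implicit Types (h : R -> R[i]) (l : int).

Lemma angular_mode_rotation co si l h (p : R * R) : co ^+ 2 + si ^+ 2 = 1 ->
  angular_mode l h (rotation co si p) = (co +i* si) ^ l * angular_mode l h p.
Proof.
move=> cs; rewrite !angular_modeE plane_radius_rotation //.
rewrite (_ : (rotation co si p).1 +i* (rotation co si p).2 =
    (co +i* si) * (p.1 +i* p.2)); last first.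
  by apply/eqP; rewrite eq_complex /=; apply/andP; split; apply/eqP; ring.
by rewrite -[X in X ^ l]mulrA expfzMl mulrCA.
Qed.

Lemma integral_rotation co si (phi : RT * RT -> \bar R) : co ^+ 2 + si ^+ 2 = 1 ->
  1 + co != 0 -> measurable_fun setT phi -> (forall p, (0 <= phi p)%E) ->
  (\int[P]_p phi (rotation co si p) = \int[P]_p phi p)%E.
Proof.
move=> cs c1 mphi phi0; have mrot := @measurable_rotation R co si.
have := ge0_integral_pushforward mrot P measurableT mphi (fun p _ => phi0 p).
rewrite preimage_setT => <-.
apply: (@eq_measure_integral _ _ _ setT P
  (measure_function_pushforward__canonical__measure_function_Measure P mrot)).
by move=> A mA _; exact: plane_rotation.
Qed.

Lemma integral_iter_rotation co si (phi : RT * RT -> \bar R) j : co ^+ 2 + si ^+ 2 = 1 ->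
  1 + co != 0 -> measurable_fun setT phi -> (forall p, (0 <= phi p)%E) ->
  (\int[P]_p phi (iter j (rotation co si) p) = \int[P]_p phi p)%E.
Proof.
move=> cs c1; elim: j phi => [//|j IH] phi mphi phi0.
rewrite -[RHS](integral_rotation cs c1) //.
apply: (IH (phi \o rotation co si)) => [|p]; last exact: phi0.
exact: measurableT_comp mphi (@measurable_rotation R co si).
Qed.

Lemma measurable_iter_rotation co si j :
  measurable_fun setT (iter j (rotation co si) : RT * RT -> RT * RT).
Proof.
elim: j => [|j IH]; first exact: measurable_id.
exact: measurableT_comp (@measurable_rotation R co si) IH.
Qed.

Lemma angular_mode_iter_rotation co si l h j (p : R * R) : co ^+ 2 + si ^+ 2 = 1 ->
  angular_mode l h (iter j (rotation co si) p) =
  ((co +i* si) ^ l) ^+ j * angular_mode l h p.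
Proof.
move=> cs; elim: j => [|j IH]; first by rewrite mul1r.
by rewrite iterS (angular_mode_rotation _ _ _ cs) IH exprS mulrA.
Qed.

Section Averaging.
Variables (h : int -> R -> R[i]) (N M : nat) (co si : R).
Hypothesis mh : forall l, cmeasurable (`]0, +oo[%classic : set RT) (h l).
Hypothesis NM : (N.*2 < M)%N.
Hypotheses (cs : co ^+ 2 + si ^+ 2 = 1) (c1 : 1 + co != 0).
Let omega : R[i] := co +i* si.
Hypothesis omegaM : omega ^+ M = 1.
Hypothesis omega_prim : forall n, (0 < n)%N -> (n < M)%N -> omega ^+ n != 1.

Let idx (k : 'I_(N.*2.+1)) : int := k%:Z - N%:Z.
Let S (p : R * R) : R[i] := \sum_(k < N.*2.+1) angular_mode (idx k) (h (idx k)) p.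

Let cmS : cmeasurable setT (S : RT * RT -> R[i]).
Proof. by apply: cmeasurable_sum => k; exact: cmeasurable_angular_mode. Qed.

Let T := @rotation R co si.

Let sqr_mod_omega : sqr_mod omega = 1. Proof. exact: cs. Qed.

Let omega0 : omega != 0.
Proof. by rewrite -sqr_mod_eq0 sqr_mod_omega oner_eq0. Qed.

Let M0 : (0 < M)%N. Proof. exact: leq_ltn_trans NM. Qed.

Let geometric_sum (m : int) : m != 0 -> (`|m| < M)%N -> \sum_(j < M) (omega ^ m) ^+ j = 0.
Proof.
move=> m0 mM; have w1 : omega ^ m != 1.
  case: m m0 mM => n n0 nM; first by apply: omega_prim; rewrite ?lt0n.
  by rewrite NegzE -exprnN invr_eq1 omega_prim.
have wM : (omega ^ m) ^+ M = 1.
  by rewrite exprnP exprzAC -[X in X ^ m]exprnP omegaM exp1rz.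
apply: (mulfI (x := omega ^ m - 1)); first by rewrite subr_eq0.
by rewrite mulr0 -subrX1 wM subrr.
Qed.

(* Averaging over the rotations by M-th roots of unity isolates one mode. *)
Lemma sqnorm_angular_mode_le (k0 : 'I_(N.*2.+1)) :
  (sqnorm P setT (angular_mode (idx k0) (h (idx k0))) <= sqnorm P setT S)%E.
Proof.
pose f := angular_mode (idx k0) (h (idx k0)).
(* Discrete Fourier inversion: the j-th rotation multiplies the mode of index k by omega^(k j).
   After weighting by omega^(- k0 j), every other index gives a vanishing geometric sum, since index
   differences are at most 2 N < M. *)
have fE p : M%:R * f p = \sum_(j < M) (omega ^ (- idx k0)) ^+ j * S (iter j T p).
  rewrite /S; under eq_bigr do rewrite mulr_sumr.
  rewrite exchange_big /= (bigD1 k0) //= [X in _ + X]big1 ?addr0.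
    under eq_bigr => j _.
      rewrite (angular_mode_iter_rotation _ _ _ _ cs) mulrA -exprMn -expfzDr // addNr expr0z expr1n mul1r.
      over.
    by rewrite sumr_const card_ord mulr_natl.
  move=> k kk0; under eq_bigr => j _.
    rewrite (angular_mode_iter_rotation _ _ _ _ cs) mulrA -exprMn -expfzDr //.
    over.
  rewrite -mulr_suml geometric_sum ?mul0r //.
    by rewrite /idx; apply: contra_neq kk0 => e; apply/val_inj => /=; lia.
  by rewrite /idx; have := NM; have := ltn_ord k; have := ltn_ord k0; lia.
(* Cauchy-Schwarz for the M terms. Each rotated copy of [S] has the same norm, so integrating the
   average returns the norm of [S]. *)
have bound p : (sqr_mod (f p) <= M%:R^-1 * \sum_(j < M) sqr_mod (S (iter j T p)))%R.
  have M0' : 0 < M%:R :> R by rewrite ltr0n.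
  have := sqr_mod_sum_le (fun j : 'I_M => (omega ^ (- idx k0)) ^+ j * S (iter j T p)).
  rewrite -fE sqr_modM.
  under eq_bigr => j _ do rewrite sqr_modM sqr_modX sqr_mod_exprz // expr1n mul1r.
  rewrite (_ : sqr_mod M%:R = M%:R ^+ 2); last first.
    rewrite /sqr_mod -(rmorph_nat (real_complex R)) /= expr0n addr0 //.
  by rewrite expr2 -mulrA ler_pM2l // mulrC -ler_pdivlMr // mulrC.
have mSj (j : nat) : measurable_fun setT (fun p => (sqr_mod (S (iter j T p)))%:E).
  by apply: (measurableT_comp (measurable_sqr_modE cmS)); exact: measurable_iter_rotation.
rewrite !sqnormE.
apply: (@le_trans _ _ (\int[P]_p (M%:R^-1%:E * \sum_(j < M) (sqr_mod (S (iter j T p)))%:E))%E).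
  apply: ge0_le_integral => //.
  - by move=> p _; rewrite lee_fin sqr_mod_ge0.
  - by apply: measurable_sqr_modE; exact: cmeasurable_angular_mode.
  - by apply: measurable_funeM; exact: emeasurable_sum.
  - by move=> p _; rewrite sumEFin -EFinM lee_fin.
rewrite ge0_integralZl //.
- rewrite ge0_integral_sum //.
    rewrite (eq_bigr (fun=> \int[P]_p (sqr_mod (S p))%:E)%E); last first.
      move=> j _; apply: (@integral_iter_rotation _ _ (fun p => (sqr_mod (S p))%:E)) => //.
        exact: measurable_sqr_modE.
      by move=> p; rewrite lee_fin sqr_mod_ge0.
    set I := (\int[P]_p (sqr_mod (S p))%:E)%E.
    have -> : (\sum_(j < M) I = (M%:R)%:E * I)%E by rewrite mule_natl sumr_const card_ord.
    rewrite muleA -EFinM mulVf ?mul1e //.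
    by rewrite pnatr_eq0 -lt0n.
  by move=> j p _; rewrite lee_fin sqr_mod_ge0.
- exact: emeasurable_sum.
- by move=> p _; apply: sume_ge0 => j _; rewrite lee_fin sqr_mod_ge0.
Qed.

End Averaging.

End Orthogonality.

(** * Recovering the radial components from the sum *)

Section Angular_uniqueness.
Local Open Scope complex_scope.
Context {R : realType}.
Local Notation RT := (measurableTypeR R).
Local Notation mu := (@lebesgue_measure R).
Local Notation P := (@lebesgue_plane R).

Lemma half_circle_gt (M : nat) : (2 < M)%N -> 1 + cos (2 * pi / M%:R) != 0 :> R.
Proof.
move=> M2; set x : R := 2 * pi / M%:R.
have M0 : 0 < M%:R :> R by rewrite ltr0n (ltn_trans _ M2).
have x2 : x = (pi / M%:R) *+ 2 by rewrite /x mulr2n; set w : R := M%:R^-1; ring.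
rewrite x2 cos_mulr2n addrC subrK mulrn_eq0 /= sqrf_eq0 gt_eqF //.
apply: cos_gt0_pihalf; apply/andP; split.
  apply: (@lt_trans _ _ 0); last by rewrite divr_gt0 // pi_gt0.
  by rewrite oppr_lt0 divr_gt0 // pi_gt0.
by rewrite ltr_pM2l ?pi_gt0 // ltf_pV2 ?posrE // ltr_nat.
Qed.

Definition angular_partial_sum (h : int -> R -> R[i]) (N : nat) (p : R * R) : R[i] :=
  \sum_(k < N.*2.+1) angular_mode (k%:Z - N%:Z) (h (k%:Z - N%:Z)) p.

Lemma sqnorm_mode_le_partial_sum (h : int -> R -> R[i]) (N : nat) (l : int) :
  (forall l, cmeasurable (`]0, +oo[%classic : set RT) (h l)) -> (`|l| <= N)%N ->
  (sqnorm P setT (angular_mode l (h l)) <=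
   sqnorm P setT (angular_partial_sum h N))%E.
Proof.
(* This M exceeds 2 N, which separates the indices, and exceeds 2, so that the angle 2 pi / M is not
   pi and the rotation factors into shears. *)
move=> mh lN; pose M := N.*2.+3; pose t : R := 2 * pi / M%:R.
have NM : (N.*2 < M)%N by rewrite /M; lia.
have M0 : (0 < M)%N by [].
have M2 : (2 < M)%N by [].
have kN : (absz (l + N%:Z)%R < N.*2.+1)%N by lia.
pose k0 := Ordinal kN; have lE : l = k0%:Z - N%:Z by rewrite /=; lia.
have := @sqnorm_angular_mode_le R h N M (cos t) (sin t) mh NM (cos2Dsin2 t)
  (half_circle_gt M2) (@cis_unity R M M0) (fun n => @cis_neq1 R n M) k0.
by rewrite -lE.
Qed.

(** Off the origin the mode has squared modulus |h|^2 / (2 pi r), so the radii with h nonzero pull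
    back to a plane null set, and [radial_null] applies. *)
Lemma sqnorm_angular_mode_eq0 l (h : R -> R[i]) :
  cmeasurable (`]0, +oo[%classic : set RT) h -> sqnorm P setT (angular_mode l h) = 0%E ->
  {ae mu, forall r : R, 0 < r -> h r = 0}.
Proof.
move=> mh; rewrite sqnormE => s0.
have mmode := cmeasurable_angular_mode l mh.
have mE := measurable_sqr_modE mmode.
pose N : set RT := `]0, +oo[%classic `&` [set r | sqr_mod (h r) != 0].
have mN : measurable N.
  have m0 : measurable (`]0, +oo[%classic `&` (fun r : RT => sqr_mod (h r) : RT) @^-1` [set 0]).
    by apply: (measurable_sqr_mod mh) => //; exact: measurable_set1.
  rewrite (_ : N = `]0, +oo[%classic `\`
    (`]0, +oo[%classic `&` (fun r => sqr_mod (h r)) @^-1` [set 0])).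
    exact: measurableD.
  rewrite /N.
  apply/seteqP; split => r /= [r0]; first by move=> /eqP h0; split => // -[_].
  by move=> H; split => //; apply/eqP => h0; apply: H.
have PN : P (plane_radius @^-1` N) = 0%E.
  have : ae_eq P setT (fun p => (sqr_mod (angular_mode l h p))%:E) (cst 0%E).
    apply/(ae_eq_integral_abs P measurableT mE).
    rewrite -s0; apply: eq_integral => p _.
    by rewrite gee0_abs // lee_fin sqr_mod_ge0.
  have mrN : measurable (plane_radius @^-1` N).
    by rewrite -[X in measurable X]setTI; exact: measurable_plane_radius.
  move=> H; apply/(measure_negligible mrN)/(negligibleS _ H).
  move=> p [] /=; rewrite in_itv /= andbT => r0 hr0 /(_ I) [] /eqP.
  rewrite (sqr_mod_angular_mode l h (lt0r_neq0 r0)) mulf_eq0 (negbTE hr0) orbF.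
  by rewrite invr_eq0 gt_eqF // mulr_gt0 // mulr_gt0 // pi_gt0.
apply: negligibleS (radial_null mN PN) => r /= /not_implyP[r0 hr0].
have r1 : r \in `]0, +oo[ by rewrite in_itv /= r0.
by split => //; split => //; rewrite /= sqr_mod_eq0; apply/eqP.
Qed.

(** The partial sums of the modes of g l - z f l equal those of g minus z times those of f, and both
    converge to z psi, so they tend to 0 in norm. Each single mode is dominated by every partial sum
    that contains it, hence has norm 0. *)
Lemma angular_sum_eigen (f g : int -> R -> R[i]) (psi : R * R -> R[i]) (z : R[i]) :
  (forall l, cmeasurable (`]0, +oo[%classic : set RT) (f l)) ->
  (forall l, cmeasurable (`]0, +oo[%classic : set RT) (g l)) ->
  cmeasurable setT (psi : RT * RT -> R[i]) ->
  angular_sum f psi -> angular_sum g (fun p => z * psi p) ->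
  forall l, {ae mu, forall r : R, 0 < r -> g l r = z * f l r}.
Proof.
move=> mf mg mpsi sf sg l.
pose h (l : int) (r : R) := g l r - z * f l r.
have mh l' : cmeasurable (`]0, +oo[%classic : set RT) (h l').
  by apply: cmeasurableD => //; apply: cmeasurableN; apply: cmeasurableM.
pose Sum := angular_partial_sum.
have mSum u N : (forall l, cmeasurable (`]0, +oo[%classic : set RT) (u l)) ->
    cmeasurable setT (Sum u N : RT * RT -> R[i]).
  by move=> mu_; apply: cmeasurable_sum => k; exact: cmeasurable_angular_mode.
have SumB N p : Sum h N p = Sum g N p - z * Sum f N p.
  by rewrite /Sum /angular_partial_sum mulr_sumr -sumrB; apply: eq_bigr => k _; rewrite angular_modeB.
pose A N := sqnorm P setT (fun p => z * psi p - Sum g N p).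
pose B N := sqnorm P setT (fun p => psi p - Sum f N p).
have cA : A N @[N --> \oo] --> 0%E := sg.
have cB : B N @[N --> \oo] --> 0%E := sf.
have bound N : (`|l| <= N)%N -> (sqnorm P setT (angular_mode l (h l)) <=
    2%:E * A N + (2 * sqr_mod z)%:E * B N)%E.
  move=> lN; apply: (le_trans (sqnorm_mode_le_partial_sum mh lN)).
  rewrite -/(Sum h N) /A /B !sqnormE.
  have mA : cmeasurable setT (fun p : RT * RT => z * psi p - Sum g N p).
    apply: cmeasurableD; last by apply: cmeasurableN; exact: mSum.
    by apply: cmeasurableM => //; exact: cmeasurable_cst.
  have mB : cmeasurable setT (fun p : RT * RT => psi p - Sum f N p).
    by apply: cmeasurableD => //; apply: cmeasurableN; exact: mSum.
  have z0 : 0 <= 2 * sqr_mod z by rewrite mulr_ge0 // sqr_mod_ge0.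
  rewrite -!ge0_integralZl //; last 4 first.
  - exact: measurable_sqr_modE.
  - by move=> p _; rewrite lee_fin sqr_mod_ge0.
  - exact: measurable_sqr_modE.
  - by move=> p _; rewrite lee_fin sqr_mod_ge0.
  rewrite -ge0_integralD //; last 4 first.
  - by move=> p _; rewrite mule_ge0 ?lee_fin ?sqr_mod_ge0.
  - by apply: measurable_funeM; exact: measurable_sqr_modE.
  - by move=> p _; rewrite mule_ge0 ?lee_fin ?sqr_mod_ge0.
  - by apply: measurable_funeM; exact: measurable_sqr_modE.
  apply: ge0_le_integral => //.
  - by move=> p _; rewrite lee_fin sqr_mod_ge0.
  - by apply: measurable_sqr_modE; exact: mSum.
  - by apply: emeasurable_funD; apply: measurable_funeM; exact: measurable_sqr_modE.
  move=> p _; rewrite -!EFinM -EFinD lee_fin SumB -mulrA -sqr_modM.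
  rewrite -sqr_modN [X in sqr_mod X](_ : _ = (z * psi p - Sum g N p) - z * (psi p - Sum f N p)).
    by apply: (le_trans (sqr_modD_le _ _)); rewrite sqr_modN.
  set a := psi p; set b := Sum g N p; set c := Sum f N p.
  by rewrite mulrBr !opprB [RHS]addrC addrA subrK.
have lim0 : (2%:E * A N + (2 * sqr_mod z)%:E * B N)%E @[N --> \oo] --> 0%E.
  rewrite -[X in _ --> X]adde0 -[X in _ --> (X + _)%E](mule0 2%:E)
    -[X in _ --> (_ + X)%E](mule0 (2 * sqr_mod z)%:E).
  by apply: cvgeD => //; apply: cvgeZl.
have : (sqnorm P setT (angular_mode l (h l)) <= 0)%E.
  move/cvg_lim : (lim0) => <- //; apply: lime_ge; first by apply/cvg_ex; exists 0%E.
  by exists `|l|%N => // N /= lN; exact: bound.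
have s0 : (0 <= sqnorm P setT (angular_mode l (h l)))%E.
  by apply: integral_ge0 => p _; rewrite lee_fin sqr_ge0.
move=> sle; have /eqP : sqnorm P setT (angular_mode l (h l)) == 0%E.
  by rewrite eq_le sle s0.
move=> /(sqnorm_angular_mode_eq0 (mh l)).
have FF := ae_filter_ringOfSetsType mu.
by apply: filterS => r hr r0; apply/eqP; rewrite -subr_eq0; apply/eqP; exact: hr.
Qed.

End Angular_uniqueness.

(** * Approximate eigenfunctions *)

Section Zero_and_lipschitz.
Context {R : realType}.
Local Notation mu := (@lebesgue_measure R).

Lemma abs_cont_C1 (a b : R) (f f1 : R -> R) : a <= b ->
  (forall x : R, a <= x <= b -> has_der f x (f1 x)) ->
  (forall x : R, a <= x <= b -> {for x, continuous f1}) -> abs_cont a b f.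
Proof.
move=> ab df cf1.
have cn (x : R) : a <= x <= b -> {for x, continuous (fun z => `|f1 z|)}.
  by move=> xab; apply: (@cvg_norm _ _ _ _ _ f1); exact: cf1.
have cw : {within `[a, b], continuous (fun z => `|f1 z|)}.
  by apply: continuous_in_subspaceT => x; rewrite inE /= in_itv /=; exact: cn.
have [x0 _ hx0] := EVT_max ab cw; pose K := `|f1 x0|.
have K0 : 0 <= K by exact: normr_ge0.
have lip (s t : R) : a <= s -> s <= t -> t <= b -> `|f t - f s| <= K * (t - s).
  move=> as_ st tb; rewrite mulrBr.
  apply: (ler_dist_der (dh := f1) (g := fun z => K * z) (dg := fun=> K)) => // z /andP[sz zt].
  - by apply: df; lra.
  - by apply: has_der_eq; first (by der); rewrite /=; ring.
  - by apply: hx0; rewrite in_itv /=; lra.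
move=> e e0; exists (e / (K + 1)); first by rewrite divr_gt0 // ltr_pwDr.
move=> n s t hst _ hsum.
apply: (@le_lt_trans _ _ (K * \sum_(i < n) (t i - s i))).
  by rewrite mulr_sumr; apply: ler_sum => i _; have [h1 h2 h3] := hst i; exact: (lip _ _ h1 h2 h3).
have S0 : 0 <= \sum_(i < n) (t i - s i).
  by apply: sumr_ge0 => i _; have [_ ? _] := hst i; rewrite subr_ge0.
move: hsum; rewrite ltr_pdivlMr ?ltr_pwDr // => h.
nra.
Qed.

Lemma abs_cont_eq (a b : R) (f g : R -> R) : (forall x : R, a <= x <= b -> f x = g x) ->
  abs_cont a b f -> abs_cont a b g.
Proof.
move=> fg af e /af[dl dl0 H]; exists dl => // n s t h1 h2 h3.
rewrite (eq_bigr (fun i => `|f (t i) - f (s i)|)); first exact: H.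
by move=> i _; have [? ? ?] := h1 i; rewrite !fg //; lra.
Qed.

Lemma radial_real0 (d alpha beta : R) l : radial_real d alpha beta l (fun=> 0) (fun=> 0).
Proof.
have d0 : derive1 (fun=> 0 : R) = fun=> 0 by apply/funext => r; rewrite derive1_cst.
have ac (D : set R) : loc_abs_cont D (fun=> 0 : R).
  move=> a b ab _ e e0; exists 1 => // n s t _ _ _.
  by under eq_bigr do rewrite subrr normr0; rewrite big1.
have lim0 (p : R -> R) : (p r * 0) @[r --> 0^'+] --> (0 : R).
  by under eq_fun do rewrite mulr0; exact: cvg_cst.
split.
- by move=> r _; exact: cts_cst.
- by split; rewrite ?d0 // => r _; exact: derivable_cst.
- have FF := ae_filter_ringOfSetsType mu.
  apply: filterE => r r0; rewrite d0 derive1_cst oppr0 mulr0 addr0.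
  by split=> //; exact: derivable_cst.
- move=> n; exists 0, 0; rewrite d0 subrr mulr0; split => //; exact: cvg_cst.
- by split=> _; exact: lim0.
Qed.

Lemma circles_negligible (d : R) : mu.-negligible [set r | exists n, r = circle_radius d n].
Proof.
rewrite (_ : [set r | _] = \bigcup_n [set circle_radius d n]).
  by apply: negligible_bigcup => n; apply/negligibleP => //; exact: lebesgue_measure_set1.
by apply/seteqP; split => r /=; [move=> [n ->]; exists n|move=> [n _ ->]; exists n].
Qed.

End Zero_and_lipschitz.

(** * A C^2 bump of width L around r0 *)

Section Cutoff.
Context {R : realType}.
Variables (r0 L : R).
Hypothesis L0 : 0 < L.

Let t r := (r - r0) / L.
Let q r := 1 - t r ^+ 2.

(** The positive part of 1 - t^2 is cubed to make the bump twice continuously differentiable;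
    [cutoff1] and [cutoff2] are its derivatives. *)
Definition cutoff (r : R) : R := Num.max 0 (q r) ^+ 3.
Definition cutoff1 (r : R) : R := 3 * Num.max 0 (q r) ^+ 2 * (- (2 * t r / L)).
Definition cutoff2 (r : R) : R := 6 * Num.max 0 (q r) * (2 * t r / L) ^+ 2 -
  3 * Num.max 0 (q r) ^+ 2 * (2 / L ^+ 2).

Let dt r : has_der t r L^-1.
Proof. by apply: has_der_eq; first (by rewrite /t; der); rewrite /=; ring. Qed.

Let dq r : has_der q r (- (2 * t r / L)).
Proof. by have := dt r => ?; apply: has_der_eq; first (by rewrite /q; der); rewrite /=; ring. Qed.

Lemma der_cutoff r : has_der cutoff r (cutoff1 r).
Proof.
apply: (has_der_eq (der_comp (f := fun z => Num.max 0 z ^+ 3) (der_pospart 1 (q r)) (dq r))).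
by rewrite /cutoff1 mulrC.
Qed.

Lemma der_cutoff1 r : has_der cutoff1 r (cutoff2 r).
Proof.
have ? := der_comp (f := fun z => Num.max 0 z ^+ 2) (der_pospart 0 (q r)) (dq r).
have := dt r => ?; apply: has_der_eq; first by rewrite /cutoff1; der.
by rewrite /= /cutoff2; field; exact: lt0r_neq0.
Qed.

Lemma continuous_cutoff2 r : {for r, continuous cutoff2}.
Proof.
have ct : {for r, continuous t} := der_cont (dt r).
have cq : {for r, continuous q} := der_cont (dq r).
have cm : {for r, continuous (fun z => Num.max 0 (q z))}.
  by apply: (@continuous_max _ _ (fun=> 0) q); [exact: cts_cst|].
by rewrite /cutoff2; cts.
Qed.

Lemma cutoff_out r : `|r - r0| >= L -> [/\ cutoff r = 0, cutoff1 r = 0 & cutoff2 r = 0].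
Proof.
move=> rL; have q0 : q r <= 0.
  rewrite /q subr_le0 /t -(real_normK (num_real _)) expr_ge1 //.
  by rewrite normrM normfV (gtr0_norm L0) ler_pdivlMr // mul1r.
by rewrite /cutoff /cutoff1 /cutoff2 max_l // !expr0n /= !(mulr0, mul0r) subrr.
Qed.

Let t_bound r : `|r - r0| <= L -> `|t r| <= 1.
Proof. by move=> h; rewrite /t normrM normfV (gtr0_norm L0) ler_pdivrMr // mul1r. Qed.

Let q_bound r : 0 <= Num.max 0 (q r) <= 1.
Proof. by rewrite le_max lexx ge_max ler01 /q gerBl sqr_ge0. Qed.

(** With w the positive part, the derivatives are - 6 w^2 t / L and (24 w t^2 - 6 w^2) / L^2, whence
    6 and 30 = 24 + 6. One factor 1 / L of the second is given up, using L >= 1, so that both errors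
    have the same order. *)
Lemma cutoff_bound r : 1 <= L ->
  [/\ 0 <= cutoff r <= 1, `|cutoff1 r| <= 6 / L & `|cutoff2 r| <= 30 / L].
Proof.
move=> L1; have /andP[m0 m1] := q_bound r; set w := Num.max 0 (q r) in m0 m1.
have [rL|rL] := leP L `|r - r0|.
  have [-> -> ->] := cutoff_out rL; rewrite normr0 lexx ler01.
  by split=> //; rewrite divr_ge0 // ltW.
have tb := t_bound (ltW rL); have Li : 0 < L^-1 by rewrite invr_gt0.
have w2 : 0 <= w ^+ 2 <= 1 by rewrite exprn_ge0 // exprn_ile1.
have /andP[w20 w21] := w2.
split.
- by rewrite /cutoff -/w exprn_ge0 // exprn_ile1.
- rewrite (_ : cutoff1 r = - (6 * (w ^+ 2 * t r)) / L); last first.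
    by rewrite /cutoff1 -/w; ring.
  rewrite normrM [`|L^-1|]gtr0_norm // ler_pM2r //.
  have : `|w ^+ 2 * t r| <= 1 by rewrite normrM mulr_ile1 // ger0_norm.
  by rewrite !ler_norml => /andP[h1 h2]; apply/andP; split; lra.
- have tb2 : 0 <= t r ^+ 2 <= 1.
    by rewrite sqr_ge0 -(real_normK (num_real (t r))) exprn_ile1.
  have /andP[t20 t21] := tb2.
  rewrite (_ : cutoff2 r = (24 * w * t r ^+ 2 - 6 * w ^+ 2) / L / L); last first.
    by rewrite /cutoff2 -/w; field; exact: lt0r_neq0.
  rewrite normrM [`|L^-1|]gtr0_norm // ler_pM2r // normrM [`|L^-1|]gtr0_norm //.
  rewrite ler_pdivrMr //; apply: (@le_trans _ _ 30); last by lra.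
  have wt : 0 <= w * t r ^+ 2 <= 1 by rewrite mulr_ge0 // mulr_ile1.
  by rewrite ler_norml; apply/andP; split; lra.
Qed.

Lemma cutoff_ge r : `|r - r0| <= L / 2 -> 4^-1 <= cutoff r.
Proof.
move=> rL; have tb : `|t r| <= 2^-1.
  by rewrite /t normrM normfV (gtr0_norm L0) ler_pdivrMr // mulrC.
have t2 : t r ^+ 2 <= 4^-1.
  rewrite -(real_normK (num_real (t r))) (_ : 4^-1 = 2^-1 ^+ 2); last by field.
  by rewrite lerXn2r // nnegrE.
have q34 : 3 / 4 <= Num.max 0 (q r) by rewrite le_max /q; apply/orP; right; lra.
apply: (@le_trans _ _ ((3 / 4) ^+ 3)); first by lra.
by rewrite lerXn2r // nnegrE; lra.
Qed.

End Cutoff.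

(** * The bump times the ground state as an approximate eigenfunction *)

Section Quasimode.
Context {R : realType}.
Local Notation RT := (measurableTypeR R).
Local Notation mu := (@lebesgue_measure R).
Variables (d alpha beta E m M : R) (C C1 : R -> R) (l : int) (r0 L : R).
Hypotheses (d0 : 0 < d) (cell : cell_function d beta E m M C C1).
Hypotheses (l0 : l != 0) (l1 : l != -1) (L0 : 0 < L).
Let c := centrifugal alpha l.
Let u := ground_state d C.
Let u1 := ground_state1 d C1.
Let chi := cutoff r0 L.
Let chi1 := cutoff1 r0 L.
Let chi2 := cutoff2 r0 L.

(** Off the circles, [quasimode1] and [quasimode2] below are its first and second derivatives, with
    u'' replaced by - E u. *)
Definition quasimode (r : R) : R := cutoff r0 L r * ground_state d C r.
Definition quasimode1 (r : R) : R :=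
  cutoff1 r0 L r * ground_state d C r + cutoff r0 L r * ground_state1 d C1 r.
Definition quasimode2 (r : R) : R :=
  cutoff2 r0 L r * ground_state d C r + 2 * cutoff1 r0 L r * ground_state1 d C1 r
  - E * (cutoff r0 L r * ground_state d C r).
Definition quasimode_image (r : R) : R :=
  - quasimode2 r + centrifugal alpha l / r ^+ 2 * quasimode r.

Lemma der_quasimode (r : R) : regular_radii d r -> has_der quasimode r (quasimode1 r).
Proof.
move=> rr; have ? := der_ground_state d0 cell rr; have ? := der_cutoff r0 L r.
by apply: has_der_eq; first (by rewrite /quasimode; der); rewrite /= /quasimode1.
Qed.

Lemma der_quasimode1 (r : R) : regular_radii d r -> has_der quasimode1 r (quasimode2 r).
Proof.
move=> rr; have ? := der_ground_state d0 cell rr; have ? := der_cutoff r0 L r.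
have ? := der_ground_state1 d0 cell rr; have ? := der_cutoff1 r0 L0 r.
by apply: has_der_eq; first (by rewrite /quasimode1; der); rewrite /= /quasimode2; ring.
Qed.

Lemma continuous_quasimode2 (r : R) : regular_radii d r -> {for r, continuous quasimode2}.
Proof.
move=> rr; have ? := der_cont (der_ground_state d0 cell rr).
have ? := der_cont (der_cutoff r0 L r).
have ? := der_cont (der_ground_state1 d0 cell rr).
have ? := der_cont (der_cutoff1 r0 L0 r); have ? : {for r, continuous (cutoff2 r0 L)} by exact: continuous_cutoff2.
by rewrite /quasimode2; cts.
Qed.

Lemma derive1_quasimode (r : R) : regular_radii d r -> derive1 quasimode r = quasimode1 r.
Proof. by move=> /der_quasimode dr; rewrite derive1E; case: dr. Qed.

(** Multiplying u by a C^2 function keeps the jump condition, because only the term chi u' jumps.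
    The conditions at 0 concern l = 0 and l = -1, which are excluded here. *)
Lemma radial_real_quasimode : radial_real d alpha beta l quasimode quasimode_image.
Proof.
have cu (r : R) : 0 < r -> {for r, continuous u} by exact: (continuous_ground_state d0 cell).
have cchi (r : R) : {for r, continuous chi} := der_cont (der_cutoff r0 L r).
have cchi1 (r : R) : {for r, continuous chi1} := der_cont (der_cutoff1 r0 L0 r).
split.
- move=> r rp; have := cu r rp; have := cchi r; rewrite /chi /u => *.
  by rewrite /quasimode; cts.
- split.
  + by move=> r rr; case: (der_quasimode rr).
  + move=> a b ab sub; have reg (x : R) : a <= x <= b -> regular_radii d x.
      by move=> xab; apply: sub; rewrite /= in_itv.
    apply: (abs_cont_C1 (f1 := quasimode1) ab) => x /reg rx; first exact: der_quasimode.
    exact: der_cont (der_quasimode1 rx).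
  + move=> a b ab sub; have reg (x : R) : a <= x <= b -> regular_radii d x.
      by move=> xab; apply: sub; rewrite /= in_itv.
    apply: (@abs_cont_eq _ _ _ quasimode1).
      by move=> x /reg rx; rewrite derive1_quasimode.
    apply: (abs_cont_C1 (f1 := quasimode2) ab) => x /reg rx; first exact: der_quasimode1.
    exact: continuous_quasimode2.
- apply: negligibleS (circles_negligible d) => r /= /not_implyP[rp H].
  apply: contrapT => Hn; apply: H.
  have rr : regular_radii d r.
    by split=> // n; apply/eqP => rn; apply: Hn; exists n.
  have [a [b [a0 rab sub]]] := regular_itv d0 rr.
  have D : has_der (derive1 quasimode) r (quasimode2 r).
    apply: (der_near (f := quasimode1)); last exact: der_quasimode1.
    near=> z; rewrite derive1_quasimode //; apply: sub.
    have /andP[h1 h2] : a < z < b by near: z; exact: near_itv.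
    by rewrite /= in_itv /= !ltW.
  by case: D => D1 D2; split=> //; rewrite derive1E D2.
- move=> n; set rn := circle_radius d n.
  have rn0 : 0 < rn by exact: circle_radius_gt0.
  exists (chi1 rn * u rn + chi rn * (- C1 (d / 2))), (chi1 rn * u rn + chi rn * C1 (d / 2)).
  have cc := @ctsM _ _ _ _ (cchi1 rn) (cu rn rn0).
  split.
  + apply: (@cvg_near_eq _ _ _ quasimode1).
      by apply: filterS (near_right_circle d0 n) => x [rx _]; rewrite derive1_quasimode.
    apply: cvgD; first exact: continuous_right cc.
    by apply: cvgM; [exact: continuous_right|exact: (ground_state1_right d0 cell)].
  + apply: (@cvg_near_eq _ _ _ quasimode1).
      by apply: filterS (near_left_circle d0 n) => x [rx _]; rewrite derive1_quasimode.
    apply: cvgD; first exact: continuous_left cc.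
    by apply: cvgM; [exact: continuous_left|exact: (ground_state1_left d0 cell)].
  + rewrite /quasimode -/chi (ground_state_circle d0 cell) mulrCA -(cell_jump cell); ring.
- by split=> le; [move: l0; rewrite le eqxx|move: l1; rewrite le eqxx].
Unshelve. all: by end_near. Qed.

Lemma measurable_ground_state (f : R -> R) : (forall x : R, {for x, continuous f}) ->
  measurable_fun setT (fun r : RT => f (r - cell_center d r) : RT).
Proof.
move=> cf; apply: (measurableT_comp (f := f : RT -> RT)).
  exact: continuous_measurable_fun.
apply: measurable_funB; first exact: measurable_id.
apply: measurable_funM; first exact: measurable_cst.
apply: nondecreasing_measurable => // x y xy; rewrite ler_int; apply: le_floor.
by rewrite lerD2r ler_pM2r // invr_gt0.
Qed.

Lemma measurable_quasimode : measurable_fun setT (quasimode : RT -> RT) /\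
  measurable_fun setT (quasimode_image : RT -> RT).
Proof.
have mu_ := measurable_ground_state (fun x => der_cont (cell_der cell x)).
have mu1 := measurable_ground_state (fun x => der_cont (cell_der1 cell x)).
have mchi : measurable_fun setT (chi : RT -> RT).
  by apply: continuous_measurable_fun => r; exact: der_cont (der_cutoff r0 L r).
have mchi1 : measurable_fun setT (chi1 : RT -> RT).
  by apply: continuous_measurable_fun => r; exact: der_cont (der_cutoff1 r0 L0 r).
have mchi2 : measurable_fun setT (chi2 : RT -> RT).
  by apply: continuous_measurable_fun => r; exact: continuous_cutoff2.
have mq : measurable_fun setT (quasimode : RT -> RT) by exact: measurable_funM.
have mcst (k : R) : measurable_fun setT (fun=> k : RT) by move=> *; exact: measurable_cst.
split=> //; apply: measurable_funD.
  apply: (measurableT_comp (f := fun x : RT => - x : RT)); first exact: oppr_measurable.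
  apply: measurable_funB; last exact: measurable_funM.
  apply: measurable_funD; first exact: measurable_funM.
  by apply: measurable_funM => //; exact: measurable_funM.
apply: measurable_funM => //; apply: measurable_funM => //.
rewrite (_ : (fun r => _) = fun r : RT => (r ^+ 2) `^ (-1)).
  apply: (measurableT_comp (f := fun x : RT => x `^ (-1) : RT)); first exact: measurable_powR.
  by apply: measurable_funX; exact: measurable_id.
by apply/funext => r; rewrite powR_inv1 ?sqr_ge0.
Qed.

Lemma quasimode_out (r : R) : L <= `|r - r0| -> quasimode r = 0 /\ quasimode_image r = 0.
Proof.
move=> rL; have [h1 h2 h3] := cutoff_out L0 rL.
rewrite /quasimode_image /quasimode2 /quasimode h1 h2 h3.
by split; rewrite !(mul0r, mulr0) // !(addr0, subr0, oppr0).
Qed.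

(** The residual is - chi'' u - 2 chi' u' + (c / r^2 - lambda) chi u. The first two terms are O(1 /
    L). In the third, c / r^2 - lambda = lambda (r0 - r) (r0 + r) / r^2; on the support |r - r0| < L
    <= r0 / 2, so r0 + r <= 5 r0 / 2 and r^2 >= r0^2 / 4, which produces the 10. The bound M + 1 for
    |u| follows from u^2 <= M. *)
Lemma quasimode_residual (lambda K1 r : R) : 1 <= L -> 2 * L <= r0 -> 0 < lambda ->
  c = lambda * r0 ^+ 2 -> (forall r : R, 0 < r -> `|u1 r| <= K1) -> 0 <= K1 -> 0 < r ->
  `|quasimode_image r - (E + lambda) * quasimode r| <=
    (30 * (M + 1) + 12 * K1) / L + 10 * lambda * (M + 1) * (L / r0).
Proof.
move=> L1 Lr lambda0 cE u1K K10 rp.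
have r00 : 0 < r0 by lra.
have M0 : 0 <= M + 1.
  have /andP[_] := ground_state_bound d0 cell rp.
  by move=> h; apply: addr_ge0 => //; apply: le_trans h; exact: sqr_ge0.
have B0 : 0 <= (30 * (M + 1) + 12 * K1) / L by rewrite divr_ge0 //; lra.
have B1 : 0 <= 10 * lambda * (M + 1) * (L / r0).
  by apply: mulr_ge0; [apply: mulr_ge0 => //; lra|rewrite divr_ge0 // ltW].
have [rL|rL] := leP L `|r - r0|.
  by have [-> ->] := quasimode_out rL; rewrite mulr0 subrr normr0 addr_ge0.
have uM : `|u r| <= M + 1.
  have /andP[_ h] := ground_state_bound d0 cell rp; rewrite -/u in h.
  by rewrite ler_norml; apply/andP; split; nra.
have [chib chi1b chi2b] := cutoff_bound r0 L0 r L1.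
have -> : quasimode_image r - (E + lambda) * quasimode r =
    - (chi2 r * u r) - 2 * (chi1 r * u1 r) + (c / r ^+ 2 - lambda) * (chi r * u r).
  by rewrite /quasimode_image /quasimode2 /quasimode -/c -/u -/u1 -/chi -/chi1 -/chi2; ring.
have h2 : `|chi2 r * u r| <= 30 / L * (M + 1) by rewrite normrM ler_pM.
have h1 : `|chi1 r * u1 r| <= 6 / L * K1 by rewrite normrM ler_pM // u1K.
have h0 : `|chi r * u r| <= M + 1.
  have /andP[c0 c1] := chib; rewrite normrM -[leRHS]mul1r ler_pM //.
  by rewrite ger0_norm.
have hc : `|c / r ^+ 2 - lambda| <= 10 * lambda * (L / r0).
  have /andP[g1 g2] : - L < r - r0 < L by rewrite -ltr_norml.
  have r2 : 0 < r ^+ 2 by rewrite exprn_gt0.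
  have -> : c / r ^+ 2 - lambda = lambda * ((r0 - r) * (r0 + r)) / r ^+ 2.
    by rewrite cE; field; exact: lt0r_neq0.
  rewrite normrM normfV (gtr0_norm r2) ler_pdivrMr // normrM (gtr0_norm lambda0).
  rewrite -!mulrA [X in _ <= X](_ : _ = lambda * (10 * (L / r0) * r ^+ 2)); last by ring.
  rewrite ler_pM2l // normrM distrC.
  have a1 : `|r - r0| <= L by exact: ltW.
  have a2 : `|r0 + r| <= 5 / 2 * r0 by rewrite ger0_norm; lra.
  have a3 : r0 ^+ 2 / 4 <= r ^+ 2 by nra.
  apply: (@le_trans _ _ (L * (5 / 2 * r0))); first by apply: ler_pM.
  apply: (@le_trans _ _ (10 * (L / r0) * (r0 ^+ 2 / 4))).
    rewrite le_eqVlt; apply/orP; left; apply/eqP; field; exact: lt0r_neq0.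
  by rewrite ler_wpM2l // mulr_ge0 // divr_ge0 // ltW.
apply: (le_trans (ler_normD _ _)); apply: lerD; last first.
  rewrite normrM (_ : _ * (L / r0) = 10 * lambda * (L / r0) * (M + 1)); last by ring.
  exact: ler_pM.
apply: (le_trans (ler_normB _ _)); rewrite normrN [`|2 * _|]normrM (ger0_norm (x := 2)) //.
have -> : (30 * (M + 1) + 12 * K1) / L = 30 / L * (M + 1) + 2 * (6 / L * K1).
  by field; exact: lt0r_neq0.
by apply: lerD => //; rewrite ler_pM2l.
Qed.

Lemma quasimode_ge (r : R) : 0 < m -> 0 < r -> `|r - r0| <= L / 2 -> m / 16 <= quasimode r ^+ 2.
Proof.
move=> m0 rp rL; rewrite /quasimode exprMn.
have /andP[h _] := ground_state_bound d0 cell rp.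
have h2 : 16^-1 <= cutoff r0 L r ^+ 2.
  have h4 := cutoff_ge L0 rL; have -> : 16^-1 = 4^-1 ^+ 2 :> R by field.
  by rewrite lerXn2r // nnegrE // (le_trans _ h4).
rewrite mulrC; apply: ler_pM => //.
exact: ltW.
Qed.

Lemma quasimode_le (r : R) : 1 <= L -> 0 < r -> quasimode r ^+ 2 <= M.
Proof.
move=> L1 rp; rewrite /quasimode exprMn.
have /andP[_ h] := ground_state_bound d0 cell rp.
have [/andP[c0 c1] _ _] := cutoff_bound r0 L0 r L1.
by rewrite -[leRHS]mul1r ler_pM ?sqr_ge0 // exprn_ile1.
Qed.

End Quasimode.

(** * Norm bounds for a single mode *)

Section Weyl.
Local Open Scope complex_scope.
Context {R : realType}.
Local Notation RT := (measurableTypeR R).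
Local Notation mu := (@lebesgue_measure R).
Local Notation P := (@lebesgue_plane R).

Lemma sqnorm_le_measure {dT : measure_display} {T : measurableType dT}
    (nu : {measure set T -> \bar R}) (D A : set T) (f : T -> R[i]) (K : R) :
  measurable D -> measurable A -> cmeasurable D f -> 0 <= K ->
  (forall x, D x -> A x -> sqr_mod (f x) <= K) -> (forall x, D x -> ~ A x -> f x = 0) ->
  (sqnorm nu D f <= K%:E * nu A)%E.
Proof.
move=> mD mA mf K0 fK f0; rewrite sqnormE.
apply: (@le_trans _ _ (K%:E * nu (A `&` D))%E); last first.
  by apply: lee_wpmul2l; rewrite ?lee_fin // le_measure ?inE //; exact: measurableI.
have mI : measurable_fun D (fun x => (\1_A x : R)%:E).
  by apply/measurable_EFinP; exact: measurable_indic.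
rewrite -(integral_indic nu mD mA) -ge0_integralZl //.
apply: ge0_le_integral => //.
- by move=> x _; rewrite lee_fin sqr_mod_ge0.
- exact: measurable_sqr_modE.
- exact: measurable_funeM.
- move=> x Dx; rewrite -EFinM lee_fin indicE; case: (boolP (x \in A)) => [|/negP] xA.
    by rewrite mulr1; apply: fK => //; rewrite inE in xA.
  rewrite mulr0 f0 //; last by move=> Ax; apply: xA; rewrite inE.
  by rewrite /sqr_mod /= expr0n addr0.
Qed.

Lemma sqnorm_ge_measure {dT : measure_display} {T : measurableType dT}
    (nu : {measure set T -> \bar R}) (A : set T) (f : T -> R[i]) (K : R) :
  measurable A -> cmeasurable setT f -> 0 <= K ->
  (forall x, A x -> K <= sqr_mod (f x)) -> (K%:E * nu A <= sqnorm nu setT f)%E.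
Proof.
move=> mA mf K0 fK; rewrite sqnormE.
have mI : measurable_fun setT (fun x => (\1_A x : R)%:E).
  by apply/measurable_EFinP; exact: measurable_indic.
rewrite -[A in nu A]setIT -(integral_indic nu measurableT mA) -ge0_integralZl //.
apply: ge0_le_integral => //.
- by move=> x _; rewrite -EFinM lee_fin mulr_ge0.
- exact: measurable_funeM.
- exact: measurable_sqr_modE.
- move=> x _; rewrite -EFinM lee_fin indicE; case: (boolP (x \in A)) => xA.
    by rewrite mulr1; apply: fK; rewrite inE in xA.
  by rewrite mulr0 sqr_mod_ge0.
Qed.

Lemma sqr_mod_real (x : R) : sqr_mod x%:C = x ^+ 2.
Proof. by rewrite /sqr_mod /= expr0n addr0. Qed.

Lemma cmeasurable_real (D : set RT) (h : R -> R) : measurable_fun setT (h : RT -> RT) ->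
  cmeasurable D (fun r : RT => (h r)%:C).
Proof.
by move=> mh; split; [apply: measurable_funS mh|exact: measurable_cst].
Qed.

Lemma measurable_annulus (a b : R) : measurable (plane_radius @^-1` `]a, b]%classic : set (RT * RT)).
Proof. by rewrite -[X in measurable X]setTI; exact: measurable_plane_radius. Qed.

Lemma sqnorm_mode_le (l : int) (h : R -> R) (a b K : R) : 0 < a -> a <= b ->
  measurable_fun setT (h : RT -> RT) -> 0 <= K ->
  (forall r : R, a < r <= b -> h r ^+ 2 <= K) ->
  (forall r : R, 0 < r -> ~~ (a < r <= b) -> h r = 0) ->
  (sqnorm P setT (angular_mode l (fun r => (h r)%:C)) <=
   (K / (2 * pi * a) * (unit_disc_area * (b ^+ 2 - a ^+ 2)))%:E)%E.
Proof.
move=> a0 ab mh K0 hK h0; have pi0 := @pi_gt0 R.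
have mm : cmeasurable setT (angular_mode l (fun r => (h r)%:C) : RT * RT -> R[i]).
  by apply: cmeasurable_angular_mode; exact: cmeasurable_real.
have B0 : 0 <= K / (2 * pi * a) by rewrite divr_ge0 // ltW // !mulr_gt0.
apply: le_trans (sqnorm_le_measure P measurableT (measurable_annulus a b) mm B0 _ _) _.
- move=> p _; rewrite /= in_itv /= => /andP[ap pb].
  have p0 : 0 < plane_radius p by exact: lt_trans ap.
  rewrite sqr_mod_angular_mode ?lt0r_neq0 // sqr_mod_real mulrC.
  apply: ler_pM; rewrite ?sqr_ge0 ?hK ?ap //.
    by rewrite invr_ge0 ltW // !mulr_gt0.
  by rewrite lef_pV2 ?posrE ?mulr_gt0 // ler_pM2l ?mulr_gt0 // ltW.
- move=> p _ /=; rewrite in_itv /= => /negP pn.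
  have [/eqP pr0|pr0] := boolP (plane_radius p == 0); first exact: angular_mode0.
  by rewrite angular_modeE h0 // ?plane_radius_gt0 // mulr0 mul0r.
- by rewrite annulus_area // (max_r (ltW a0)) (max_r (ltW (lt_le_trans a0 ab))).
Qed.

Lemma sqnorm_mode_ge (l : int) (h : R -> R) (a b K : R) : 0 < a -> a <= b ->
  measurable_fun setT (h : RT -> RT) -> 0 <= K ->
  (forall r : R, a < r <= b -> K <= h r ^+ 2) ->
  ((K / (2 * pi * b) * (unit_disc_area * (b ^+ 2 - a ^+ 2)))%:E <=
   sqnorm P setT (angular_mode l (fun r => (h r)%:C)))%E.
Proof.
move=> a0 ab mh K0 hK; have pi0 := @pi_gt0 R; have b0 := lt_le_trans a0 ab.
have mm : cmeasurable setT (angular_mode l (fun r => (h r)%:C) : RT * RT -> R[i]).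
  by apply: cmeasurable_angular_mode; exact: cmeasurable_real.
have B0 : 0 <= K / (2 * pi * b) by rewrite divr_ge0 // ltW // !mulr_gt0.
apply: le_trans (sqnorm_ge_measure P (measurable_annulus a b) mm B0 _).
  by rewrite annulus_area // (max_r (ltW a0)) (max_r (ltW b0)).
move=> p; rewrite /= in_itv /= => /andP[ap pb].
have p0 : 0 < plane_radius p by exact: lt_trans ap.
rewrite sqr_mod_angular_mode ?lt0r_neq0 // sqr_mod_real mulrC.
apply: ler_pM; rewrite ?hK ?ap //.
  by rewrite invr_ge0 ltW // !mulr_gt0.
by rewrite lef_pV2 ?posrE ?mulr_gt0 // ler_pM2l ?mulr_gt0.
Qed.

Lemma L2fun_real (h : R -> R) (a b K : R) : measurable_fun setT (h : RT -> RT) ->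
  0 <= K -> (forall r : R, 0 < r -> h r ^+ 2 <= K) ->
  (forall r : R, 0 < r -> ~~ (a < r <= b) -> h r = 0) ->
  L2fun mu `]0, +oo[%classic (fun r => (h r)%:C).
Proof.
move=> mh K0 hK h0; have [m1 m2] := cmeasurable_real (`]0, +oo[%classic : set RT) mh.
split=> //; apply: (@le_lt_trans _ _ (K%:E * mu (`]a, b]%classic : set RT))%E).
  apply: sqnorm_le_measure => //.
    by move=> r /=; rewrite in_itv /= andbT sqr_mod_real => r0 _; exact: hK.
  by move=> r /=; rewrite !in_itv /= andbT => r0 /negP rn; rewrite h0.
by rewrite lebesgue_measure_itv /=; case: ifP => _; rewrite ?mule0 // -EFinB -EFinM ltry.
Qed.

Lemma AB_op_mode (d alpha beta : R) (l : int) (f g : R -> R[i]) :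
  radial_op d alpha beta l f g -> L2fun P setT (angular_mode l f) ->
  L2fun P setT (angular_mode l g) ->
  AB_op d alpha beta (angular_mode l f) (angular_mode l g).
Proof.
move=> fg lf lg; split=> //.
pose single (h : R -> R[i]) (l' : int) : R -> R[i] := if l' == l then h else fun=> 0.
exists (single f), (single g).
have mode0 l' p : angular_mode l' (fun=> 0 : R[i]) p = 0.
  by rewrite angular_modeE mulr0 mul0r.
have sum_single h : angular_sum (single h) (angular_mode l h).
  apply: cvg_near_cst; exists `|l|%N => // N /= lN.
  rewrite sqnormE; apply: integral0_eq => p _.
  have kN : (absz (l + N%:Z)%R < N.*2.+1)%N by lia.
  pose k0 := Ordinal kN; have lE : k0%:Z - N%:Z = l by rewrite /=; lia.
  rewrite (bigD1 k0) //= [X in _ - (_ + X)]big1; last first.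
    move=> k kk0; rewrite /single ifF ?mode0 //; apply/negbTE.
    by apply: contra_neq kk0 => e; apply/val_inj => /=; lia.
  by rewrite -[(absz _)%:Z - _]/(k0%:Z - N%:Z) lE /single eqxx addr0 subrr sqr_mod_real expr0n.
split=> // l'; rewrite /single; have [->//|_] := eqVneq l' l.
have z0 := @radial_real0 R d alpha beta l'.
have L0 : L2fun mu `]0, +oo[%classic (fun=> 0 : R[i]).
  by apply: (@L2fun_real (fun=> 0) 0 0 0) => // r _; rewrite expr0n.
by split.
Qed.

End Weyl.

(** * Points above E belong to the spectrum *)

Section Weyl_sequence.
Local Open Scope complex_scope.
Context {R : realType}.
Local Notation RT := (measurableTypeR R).
Local Notation mu := (@lebesgue_measure R).
Local Notation P := (@lebesgue_plane R).

(** With w = A L / pi, the left side is at most 4 w m / 100 = m w / 25 and the right side at least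
    (4 / 5) m w / 16 = m w / 20. The value of [e] is tuned to leave this margin. *)
Lemma quasimode_norm_ratio (A L r0 e m M' : R) : 0 < A -> 0 < L -> 2 * L <= r0 -> 0 < m ->
  e ^+ 2 = m / (100 * (`|M'| + 1)) ->
  `|M'| * (e ^+ 2 / (2 * pi * (r0 - L)) * (A * ((r0 + L) ^+ 2 - (r0 - L) ^+ 2))) <
  m / 16 / (2 * pi * (r0 + L / 2)) * (A * ((r0 + L / 2) ^+ 2 - (r0 - L / 2) ^+ 2)).
Proof.
move=> A0 L0 Lr m0 e2; have pi0 := @pi_gt0 R.
have D0 : 0 < 100 * (`|M'| + 1) by rewrite mulr_gt0 // ltr_wpDl.
pose w := A * L / pi; have w0 : 0 < w by rewrite divr_gt0 // mulr_gt0.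
have b0 : 0 < r0 + L / 2 by lra.
have a0 : 0 < r0 - L by lra.
have -> : m / 16 / (2 * pi * (r0 + L / 2)) *
    (A * ((r0 + L / 2) ^+ 2 - (r0 - L / 2) ^+ 2)) = m / 16 * w * (r0 / (r0 + L / 2)).
  rewrite /w; set b := r0 + L / 2; rewrite (_ : b ^+ 2 - _ = 2 * r0 * L); last first.
    by rewrite /b; field.
  move: (lt0r_neq0 b0) (lt0r_neq0 pi0); rewrite -/b; clearbody b => b1.
  by move: (@pi R) => p p1; field; rewrite b1.
have -> : `|M'| * (e ^+ 2 / (2 * pi * (r0 - L)) * (A * ((r0 + L) ^+ 2 - (r0 - L) ^+ 2))) =
    2 * w * (`|M'| * e ^+ 2) * (r0 / (r0 - L)).
  rewrite /w; move: (lt0r_neq0 a0) (lt0r_neq0 pi0) => a1.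
  by move: (@pi R) => p p1; field; rewrite a1.
have h1 : 4 / 5 <= r0 / (r0 + L / 2) by rewrite ler_pdivlMr //; lra.
have h2 : r0 / (r0 - L) <= 2 by rewrite ler_pdivrMr //; lra.
have h3 : `|M'| * e ^+ 2 <= m / 100.
  rewrite e2 mulrA ler_pdivrMr //.
  by have := normr_ge0 M'; set x := `|M'| => x0; nra.
have h4 : 0 <= `|M'| * e ^+ 2 by rewrite mulr_ge0 // sqr_ge0.
have mw : 0 < m * w by rewrite mulr_gt0.
apply: (@le_lt_trans _ _ (2 * w * (m / 100) * 2)).
  apply: ler_pM => //; first by rewrite mulr_ge0 // mulr_ge0 // ltW.
    by apply: divr_ge0; lra.
  by rewrite ler_pM2l // mulr_gt0.
apply: (@lt_le_trans _ _ (m / 16 * w * (4 / 5))); first by lra.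
by rewrite ler_pM2l // mulr_gt0 // divr_gt0.
Qed.

(** L is chosen first, to make k1 / L small, then a lower bound q0 for r0. Since c_l must equal
    lambda r0^2 with l an integer, l is taken large and r0 is defined as the square root of c_l /
    lambda. *)
Lemma quasimode_scale (alpha lambda k1 k2 e : R) : 0 < alpha -> 0 < lambda ->
  0 <= k1 -> 0 <= k2 -> 0 < e -> exists (l : int) (L r0 : R),
  [/\ l != 0, l != -1, 1 <= L, 2 * L <= r0 &
      centrifugal alpha l = lambda * r0 ^+ 2 /\ k1 / L + k2 * (L / r0) <= e].
Proof.
move=> alpha0 lambda0 k10 k20 e0; pose L := 1 + 2 * k1 / e.
have L1 : 1 <= L by rewrite lerDl; apply: divr_ge0; [exact: mulr_ge0|exact: ltW].
have L0 : 0 < L by exact: lt_le_trans L1.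
have Le : k1 / L <= e / 2.
  rewrite ler_pdivrMr // /L mulrDr mulr1 [X in _ + X](_ : _ = k1); last first.
    by field; exact: lt0r_neq0.
  by rewrite lerDr divr_ge0 // ltW.
pose q0 := 2 * L + 2 * k2 * L / e.
have q1 : 0 <= 2 * k2 * L / e.
  by apply: divr_ge0; last exact: ltW; apply: mulr_ge0; [exact: mulr_ge0|exact: ltW].
have q00 : 0 < q0 by apply: ltr_wpDr => //; exact: mulr_gt0.
(* The second successor makes n - 1 exceed lambda q0^2, and (n + alpha)^2 - 1/4 is at least n -
   1. *)
pose n := (Num.truncn (lambda * q0 ^+ 2)).+2.
have nq : lambda * q0 ^+ 2 <= n%:R - 1.
  by rewrite /n -natr1 addrK; exact: ltW (truncnS_gt _).
pose c := centrifugal alpha n.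
have cn : lambda * q0 ^+ 2 <= c.
  apply: (le_trans nq); rewrite /c /centrifugal.
  have n1 : 1 <= n%:R :> R by rewrite ler1n.
  rewrite -[(Posz n)%:~R]/(n%:R : R); clear - n1 alpha0; nra.
pose r0 := Num.sqrt (c / lambda).
have c0 : 0 < c / lambda.
  by rewrite divr_gt0 // (lt_le_trans _ cn) // mulr_gt0 // exprn_gt0.
have cE : c = lambda * r0 ^+ 2.
  by rewrite sqr_sqrtr ?(ltW c0) // mulrC divfK // lt0r_neq0.
have rq : q0 <= r0.
  rewrite -[leLHS]ger0_norm ?(ltW q00) // -sqrtr_sqr ler_wsqrtr //.
  by rewrite ler_pdivlMr // mulrC.
have r00 : 0 < r0 by exact: lt_le_trans rq.
exists n, L, r0; split=> //; first by apply: (le_trans _ rq); rewrite lerDl.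
split=> //; rewrite [e]splitr; apply: lerD => //.
have : 2 * k2 * L / e <= r0 by apply: (le_trans _ rq); rewrite lerDr mulr_ge0 // ltW.
rewrite mulrA ler_pdivrMr // ler_pdivrMr //; clear; lra.
Qed.

Lemma norm_le_sqr (x M : R) : x ^+ 2 <= M -> `|x| <= M + 1.
Proof. by move=> xM; rewrite ler_norml; apply/andP; split; nra. Qed.

Lemma annulus_dist (r r0 L : R) : ~~ (r0 - L < r <= r0 + L) -> L <= `|r - r0|.
Proof.
move=> rn; rewrite leNgt ltr_norml; apply: contra rn => /andP[h1 h2].
by apply/andP; split; lra.
Qed.

(** A bounded resolvent with constant M' would force the norm estimate ||q||^2 <= M' ||res||^2 for
    the quasimode q and its residual. The tolerance [e] is chosen after M', so the scale L, r0, l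
    can violate it. *)
Lemma AB_op_spectrum (d alpha beta E m M : R) (C C1 : R -> R) (lambda : R) :
  0 < d -> 0 < alpha -> cell_function d beta E m M C C1 -> 0 < m -> 0 < lambda ->
  spectrum P (AB_op d alpha beta) (E + lambda)%:C.
Proof.
move=> d0 alpha0 cell m0 lambda0 [M' HM'].
have [K1 K10 u1K] := ground_state1_bounded d0 cell.
have M1 : 0 <= M.
  have /andP[h1 h2] := ground_state_bound d0 cell (r := 1) ltr01.
  by apply: le_trans h2; exact: sqr_ge0.
pose e := Num.sqrt (m / (100 * (`|M'| + 1))).
have D0 : 0 < 100 * (`|M'| + 1) by rewrite mulr_gt0 // ltr_wpDl.
have e0 : 0 < e by rewrite sqrtr_gt0 divr_gt0.
have e2 : e ^+ 2 = m / (100 * (`|M'| + 1)) by rewrite sqr_sqrtr // ltW // divr_gt0.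
have [||l [L [r0 [l0 l1 L1 Lr [cE Le]]]]] := quasimode_scale (k1 := 30 * (M + 1) + 12 * K1)
    (k2 := 10 * lambda * (M + 1)) alpha0 lambda0 _ _ e0.
- by rewrite addr_ge0 // mulr_ge0 // addr_ge0.
- by rewrite mulr_ge0 ?addr_ge0 // mulr_ge0 // ltW.
have L0 : 0 < L by exact: lt_le_trans L1.
have [r00 a0 ab] : [/\ 0 < r0, 0 < r0 - L & r0 - L <= r0 + L].
  by clear - L0 Lr; split; lra.
clearbody e.
pose q := quasimode d C r0 L; pose qi := quasimode_image d alpha E C C1 l r0 L.
pose res r := qi r - (E + lambda) * q r.
have [mq mqi] : measurable_fun setT (q : RT -> RT) /\ measurable_fun setT (qi : RT -> RT).
  exact: (measurable_quasimode alpha l r0 d0 cell L0).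
have mres : measurable_fun setT (res : RT -> RT).
  by apply: measurable_funB => //; apply: measurable_funM => //; exact: measurable_cst.
have out r : 0 < r -> ~~ (r0 - L < r <= r0 + L) -> q r = 0 /\ qi r = 0.
  move=> rp rn; apply: (quasimode_out _ _ _ _ _ _ L0).
  exact: annulus_dist.
have out_res r : 0 < r -> ~~ (r0 - L < r <= r0 + L) -> res r = 0.
  by move=> rp /(out r rp)[h1 h2]; rewrite /res h1 h2 mulr0 subrr.
have q_le r : 0 < r -> q r ^+ 2 <= M.
  by move=> rp; exact: (quasimode_le r0 d0 cell L0 L1 rp).
have res_le r : 0 < r -> `|res r| <= e.
  by move=> rp; apply: le_trans Le; exact: (quasimode_residual d0 cell L0).
have res_le2 r : 0 < r -> res r ^+ 2 <= e ^+ 2.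
  by move=> rp; rewrite -real_normK ?num_real // lerXn2r ?nnegrE ?(ltW e0) // res_le.
pose Kq := e + `|E + lambda| * (M + 1).
have Kq0 : 0 <= Kq by rewrite addr_ge0 ?(ltW e0) // mulr_ge0 // addr_ge0.
have qi_le r : 0 < r -> qi r ^+ 2 <= Kq ^+ 2.
  move=> rp; rewrite -real_normK ?num_real // lerXn2r ?nnegrE //.
  have -> : qi r = res r + (E + lambda) * q r by rewrite /res subrK.
  apply: (le_trans (ler_normD _ _)); apply: lerD; first exact: res_le.
  by rewrite normrM ler_wpM2l // norm_le_sqr // q_le.
pose mode (h : R -> R) := angular_mode l (fun r => (h r)%:C).
have L2mode (h : R -> R) K : measurable_fun setT (h : RT -> RT) -> 0 <= K ->
    (forall r : R, 0 < r -> h r ^+ 2 <= K) ->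
    (forall r : R, 0 < r -> ~~ (r0 - L < r <= r0 + L) -> h r = 0) ->
    L2fun P setT (mode h).
  move=> mh K0 hK h0; have [h1 h2] := cmeasurable_angular_mode l
    (cmeasurable_real (`]0, +oo[%classic : set RT) mh).
  split=> //; apply: (le_lt_trans (sqnorm_mode_le l a0 ab mh K0 _ h0)).
    by move=> r /andP[ar _]; apply: hK; exact: lt_trans ar.
  by rewrite ltry.
have L2q : L2fun P setT (mode q) by apply: (L2mode _ M) => // r rp rn; case: (out r rp rn).
have L2qi : L2fun P setT (mode qi).
  by apply: (L2mode _ (Kq ^+ 2)) => // [|r rp rn]; [exact: sqr_ge0|case: (out r rp rn)].
have L2res : L2fun P setT (mode res) by apply: (L2mode _ (e ^+ 2)) => //; exact: sqr_ge0.
have AB : AB_op d alpha beta (mode q) (mode qi).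
  apply: (AB_op_mode _ L2q L2qi); split.
  - by apply: (@L2fun_real _ q (r0 - L) (r0 + L) M) => // r rp rn; case: (out r rp rn).
  - apply: (@L2fun_real _ qi (r0 - L) (r0 + L) (Kq ^+ 2)) => //; first exact: sqr_ge0.
    by move=> r rp rn; case: (out r rp rn).
  - exact: (radial_real_quasimode alpha r0 d0 cell l0 l1 L0).
  - exact: radial_real0.
have resE : (fun r => (res r)%:C) = (fun r => (qi r)%:C - (E + lambda)%:C * (q r)%:C).
  by apply/funext => r; rewrite /res rmorphB rmorphM.
have eigE : (fun p => mode res p + (E + lambda)%:C * mode q p) = mode qi.
  by apply/funext => p; rewrite /mode resE -angular_modeB subrK.
(* The norm bound is given for some preimage f of the residual; the uniqueness clause identifies the
   quasimode with f almost everywhere and transfers the bound. *)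
have [f [[[mf1 mf2 _] _ _] uf fle]] := HM' _ L2res.
have qf : {ae P, forall p, mode q p = f p} by apply: uf; rewrite eigE.
have sqE : sqnorm P setT (mode q) = sqnorm P setT f.
  rewrite !sqnormE; apply: ge0_ae_eq_integral => //.
  - apply: measurable_sqr_modE; apply: cmeasurable_angular_mode; exact: cmeasurable_real.
  - exact: measurable_sqr_modE.
  - by move=> p _; rewrite lee_fin sqr_mod_ge0.
  - by move=> p _; rewrite lee_fin sqr_mod_ge0.
  - have FF := ae_filter_ringOfSetsType P.
    by apply: filterS qf => p qp _; rewrite qp.
have [_ A0] := @unit_disc_area_fin R.
have lower : ((m / 16 / (2 * pi * (r0 + L / 2)) *
    (unit_disc_area * ((r0 + L / 2) ^+ 2 - (r0 - L / 2) ^+ 2)))%:E <=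
    sqnorm P setT (mode q))%E.
  have m16 : 0 <= m / 16 by rewrite divr_ge0 // ltW.
  apply: sqnorm_mode_ge => //; clear - cell d0 L0 m0 Lr r00; try by lra.
  move=> r /andP[h1 h2]; apply: (quasimode_ge d0 cell L0 m0); first by lra.
  by rewrite ler_norml; apply/andP; split; clear - h1 h2; lra.
have upper : (sqnorm P setT (mode res) <= (e ^+ 2 / (2 * pi * (r0 - L)) *
    (unit_disc_area * ((r0 + L) ^+ 2 - (r0 - L) ^+ 2)))%:E)%E.
  apply: sqnorm_mode_le => //; first exact: sqr_ge0.
  by move=> r /andP[ar _]; apply: res_le2; exact: lt_trans ar.
have := quasimode_norm_ratio A0 L0 Lr m0 e2; rewrite ltNge => /negP; apply.
rewrite -lee_fin; apply: (le_trans lower); rewrite sqE; apply: (le_trans fle); rewrite EFinM.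
apply: (@le_trans _ _ (`|M'|%:E * sqnorm P setT (mode res))%E).
  apply: lee_wpmul2r; last by rewrite lee_fin ler_norm.
  by rewrite sqnormE; apply: integral_ge0 => p _; rewrite lee_fin sqr_mod_ge0.
by apply: lee_wpmul2l => //; rewrite lee_fin.
Qed.

End Weyl_sequence.

(** * Eigenvalues *)

Section Eigenvalues.
Local Open Scope complex_scope.
Context {R : realType}.
Local Notation RT := (measurableTypeR R).
Local Notation mu := (@lebesgue_measure R).
Local Notation P := (@lebesgue_plane R).
Variables (d alpha beta E m M : R) (C C1 : R -> R).
Hypotheses (d0 : 0 < d) (alpha0 : 0 < alpha) (alpha1 : alpha < 2^-1).
Hypotheses (cell : cell_function d beta E m M C C1) (m0 : 0 < m).
Hypothesis hardy : (4^-1 - alpha ^+ 2) * M <= m / 4.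

Lemma radial_eigenfunction0 (l : int) (f g : R -> R[i]) (z : R[i]) :
  radial_op d alpha beta l f g -> {ae mu, forall r : R, 0 < r -> g r = z * f r} ->
  complex.Im z != 0 \/ complex.Re z < E -> forall r : R, 0 < r -> f r = 0.
Proof.
move=> [L2f _ rad_re rad_im] gz zE r r0.
have [cre cim] : (forall r : R, 0 < r -> {for r, continuous (fun x => complex.Re (f x))}) /\
    (forall r : R, 0 < r -> {for r, continuous (fun x => complex.Im (f x))}).
  by split; [case: rad_re|case: rad_im].
have [F [K FK]] := L2fun_primitive L2f cre cim.
have FF := ae_filter_ringOfSetsType mu.
have ga : {ae mu, forall r : R, 0 < r -> complex.Re (g r) =
    complex.Re z * complex.Re (f r) - complex.Im z * complex.Im (f r)}.
  by apply: filterS gz => x gx x0; rewrite gx //; case: (z) => ? ?; case: (f x).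
have gb : {ae mu, forall r : R, 0 < r -> complex.Im (g r) =
    complex.Re z * complex.Im (f r) + complex.Im z * complex.Re (f r)}.
  by apply: filterS gz => x gx x0; rewrite gx //; case: (z) => ? ?; case: (f x).
have [a0 b0] := radial_uniqueness d0 alpha0 alpha1 rad_re rad_im ga gb
  (fun r r0 => (FK r r0).1) (fun r r0 => (FK r r0).2) cell m0 hardy zE r0.
by apply/eqP; rewrite eq_complex a0 b0 !eqxx.
Qed.

(** Otherwise all radial components vanish on ]0, +oo[ and so do all partial sums. The sequence that
    must tend to 0 is then constantly the squared norm of psi. *)
Lemma AB_op_eigenvalue_ge (z : R[i]) : Defs.eigenvalue P (AB_op d alpha beta) z ->
  complex.Im z = 0 /\ E <= complex.Re z.
Proof.
move=> [psi [[[mpsi1 mpsi2 _] _ [f [g [fg sf sg]]]] psi0]].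
apply: contrapT => /not_andP zE; apply: psi0.
have {}zE : complex.Im z != 0 \/ complex.Re z < E.
  by case: zE => [/eqP|/negP]; [left|rewrite -ltNge; right].
have mf l : cmeasurable (`]0, +oo[%classic : set RT) (f l) by case: (fg l) => -[].
have mg l : cmeasurable (`]0, +oo[%classic : set RT) (g l) by case: (fg l) => _ [].
have gz := angular_sum_eigen mf mg (conj mpsi1 mpsi2) sf sg.
have f0 l : angular_mode l (f l) = angular_mode l (fun=> 0).
  by apply: eq_angular_mode; exact: radial_eigenfunction0 (fg l) (gz l) zE.
have mode0 l p : angular_mode l (f l) p = 0.
  by rewrite f0 angular_modeE mulr0 mul0r.
have psi_sq : sqnorm P setT psi = 0%E.
  move: sf; rewrite /angular_sum; under eq_fun do under eq_fun => p do
    under eq_bigr do rewrite mode0.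
  under eq_fun do under eq_fun do rewrite big1_eq subr0.
  by move/(cvg_lim (@ereal_hausdorff R)); rewrite lim_cst //; exact: ereal_hausdorff.
have : ae_eq P setT (fun p => (sqr_mod (psi p))%:E) (cst 0%E).
  apply/(ae_eq_integral_abs P measurableT (measurable_sqr_modE (conj mpsi1 mpsi2))).
  rewrite -psi_sq sqnormE; apply: eq_integral => p _.
  by rewrite gee0_abs // lee_fin sqr_mod_ge0.
have FF := ae_filter_ringOfSetsType P.
by apply: filterS => p /(_ I)[] /eqP; rewrite sqr_mod_eq0 => /eqP.
Qed.

Lemma AB_op_discrete_spectrum0 : discrete_spectrum P (AB_op d alpha beta) = set0.
Proof.
apply/seteqP; split=> // z [[_ [e e0 isolated]] /AB_op_eigenvalue_ge[z0 zE] _].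
have z_real : z = (complex.Re z)%:C by apply/eqP; rewrite eq_complex z0 !eqxx.
(* This puts a spectral point E + lambda at distance e / 2 from z. The shift keeps lambda positive
   even when z is the threshold itself. *)
pose lambda := complex.Re z - E + e / 2.
have lambda0 : 0 < lambda.
  by rewrite /lambda ltr_wpDl ?divr_gt0 // subr_ge0.
have sp := AB_op_spectrum d0 alpha0 cell m0 lambda0.
have wz : (E + lambda)%:C - z = (e / 2)%:C.
  by rewrite [in LHS]z_real -rmorphB /lambda; congr (_%:C); ring.
have := isolated _ sp; rewrite -subr_eq0 wz => H.
have e2 : 0 < e / 2 by rewrite divr_gt0.
have /H : (e / 2)%:C != 0.
  by rewrite eq_complex /= eqxx andbT lt0r_neq0.
rewrite leNgt => /negP; apply.
rewrite /ComplexField.Normc.normc /= expr0n addr0 sqrtr_sqr gtr0_norm //; lra.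
Qed.

End Eigenvalues.

Theorem theorem4p1 (R : realType) (d : R) (hd : 0 < d)
    (alpha : R) (halpha0 : 0 < alpha) (halpha1 : alpha < 2^-1) :
  exists2 beta0 : R, 0 < beta0 &
    forall beta : R, `|beta| < beta0 ->
      discrete_spectrum (lebesgue_plane (R := R)) (AB_op d alpha beta) = set0.
Proof.
have [|beta0 beta00 H] := @exists_cell_function R d alpha hd; first by rewrite halpha0.
exists beta0 => // beta /H [E [m [M [C [C1 [cell m0 hardy]]]]]].
exact: AB_op_discrete_spectrum0 hd halpha0 halpha1 cell m0 hardy.
Qed.
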